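(* Let $\alpha>0$, let $W$ be a standard Brownian motion, and let $m$ be a locally finite signed measure on $[0,\infty)$ such that $m(\{0\})<\frac1\alpha$, $m([0,x])\leq\frac1\alpha$ for all $x\geq0$, and $\int_{[0,\infty)} e^{-cx^2}\,\mathrm{d}|m|(x)<\infty$ for all $c>0$. Then there exists a continuous function $\ell:[0,\infty)\to\mathbb{R}$ such that $$\ell_t=\int_{[0,\infty)}\mathbb{E}[L^x_t]\,\mathrm{d}m(x)\quad\text{for all } t\geq0,$$ where, for each $x\in[0,\infty)$, $(X^x,L^x)$ solves the Skorokhod problem for $x+W-\alpha\ell$.
   Context: **Signed measure.** A signed measure $m$ is of the form $m=m_+-m_-$ with measures $m_+,m_-$, at least one of which is finite; $|m|$ denotes its variation. **Skorokhod problem.** For a càdlàg function $f:[0,\infty)\to\mathbb{R}$ with $f_0\geq0$, a pair $(x,z)$ of càdlàg functions solves the Skorokhod problem for $f$ if $z$ is nondecreasing with $z_0=0$, $x_t = f_t+z_t\geq0$ and $\int_0^t \mathbf{1}_{\{x_s>0\}}\,\mathrm{d}z_s=0$ for all $t\geq0$. The unique solution is $z_t=\sup_{0\leq s\leq t}(f_s)_-$, $x=f+z$, where $(y)_-=\max(-y,0)$. For processes it is solved pathwise. *)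

(* Defs.v *)
From HB Require Import structures.
From mathcomp Require Export all_boot all_order all_algebra.
From mathcomp Require Export all_classical all_reals all_analysis.
Export Order.TTheory GRing.Theory Num.Theory.
Export numFieldNormedType.Exports.

Set Implicit Arguments.
Unset Strict Implicit.
Unset Printing Implicit Defensive.

Global Open Scope classical_set_scope.
Global Open Scope ring_scope.

(* The pair is any decomposition of the signed measure, not necessarily the
   Jordan one. *)
Record signed_measure {d} (T : measurableType d) (R : realType) := SignedMeasure {
  spos : {measure set T -> \bar R} ;
  sneg : {measure set T -> \bar R} ;
  spos_or_sneg_finite : (spos setT < +oo)%E \/ (sneg setT < +oo)%E }.

Definition signed_value {d} (T : measurableType d) (R : realType)
    (m : signed_measure T R) (A : set T) : \bar R :=
  (spos m A - sneg m A)%E.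

Coercion signed_value : signed_measure >-> Funclass.

Definition disjoint_family_in {d} (T : measurableType d) (A : set T) (n : nat)
    (F : 'I_n -> set T) : Prop :=
  [/\ forall i, measurable (F i), trivIset setT F & forall i, F i `<=` A].

(* For measurable [A] this is the supremum over finite measurable partitions of
   [A]: adding the leftover of [A] to a family only increases the sum. *)
Definition variation {d} (T : measurableType d) (R : realType)
    (m : signed_measure T R) (A : set T) : \bar R :=
  ereal_sup [set s : \bar R | exists n (F : 'I_n -> set T),
    disjoint_family_in A F /\ s = (\sum_(i < n) `| m (F i) |)%E].

Definition sintegrable {d} (T : measurableType d) (R : realType)
    (m : signed_measure T R) (D : set T) (f : T -> \bar R) : Prop :=
  (spos m).-integrable D f /\ (sneg m).-integrable D f.

(* For [sintegrable] integrands this does not depend on the decomposition, see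
   [sintegral_indep]. *)
Definition sintegral {d} (T : measurableType d) (R : realType)
    (m : signed_measure T R) (D : set T) (f : T -> \bar R) : \bar R :=
  (\int[spos m]_(x in D) f x - \int[sneg m]_(x in D) f x)%E.

Section variation_measure.
Context d (T : measurableType d) (R : realType) (m : signed_measure T R).
Local Open Scope ereal_scope.

Lemma signed_value0 : m set0 = 0.
Proof. by rewrite /signed_value !measure0 sube0. Qed.

Lemma signed_value_def (A : set T) : measurable A -> spos m A +? - sneg m A.
Proof.
move=> mA; case: (spos_or_sneg_finite m) => h.
- have : spos m A < +oo.
    by apply: (le_lt_trans _ h); apply: le_measure; rewrite ?inE.
  rewrite -ge0_fin_numE// => hA; exact: fin_num_adde_defr.
- have : sneg m A < +oo.
    by apply: (le_lt_trans _ h); apply: le_measure; rewrite ?inE.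
  rewrite -ge0_fin_numE// => hA; rewrite fin_num_adde_defl// fin_numN//.
Qed.

Lemma signed_value_sigma_additive : semi_sigma_additive m.
Proof.
move=> F mF tF mU.
have E n : \sum_(0 <= i < n) m (F i) =
    \sum_(0 <= i < n) spos m (F i) - \sum_(0 <= i < n) sneg m (F i).
  rewrite -sumeN ?big_split// => i j _ _.
  by apply: ge0_adde_def; rewrite inE measure_ge0.
rewrite (_ : (fun n => _) = (fun n => \sum_(0 <= i < n) spos m (F i)) \-
   (fun n => \sum_(0 <= i < n) sneg m (F i))); last by apply/funext.
apply: cvgeB; first exact: signed_value_def.
- exact: measure_semi_sigma_additive.
- exact: measure_semi_sigma_additive.
Qed.

Lemma abse_signed_value_le (F : (set T)^nat) : (forall i, measurable (F i)) ->
  trivIset setT F -> `|m (\bigcup_i F i)| <= \sum_(0 <= i <oo) `|m (F i)|.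
Proof.
move=> mF tF.
have mU : measurable (\bigcup_i F i) by exact: bigcup_measurable.
have h : `|\sum_(0 <= i < n) m (F i)| @[n --> \oo] --> `|m (\bigcup_i F i)|.
  exact/cvg_abse/signed_value_sigma_additive.
rewrite -(cvg_lim _ h)//; apply: lee_lim.
- by apply/cvg_ex; eexists; exact: h.
- exact: is_cvg_nneseries.
- by apply: nearW => n; exact: lee_abs_sum.
Qed.

Lemma variation_ge (A : set T) n (F : 'I_n -> set T) :
  disjoint_family_in A F -> \sum_(i < n) `|m (F i)| <= variation m A.
Proof. by move=> ?; apply: ereal_sup_ubound; exists n, F. Qed.

Lemma abse_le_variation (A : set T) : measurable A -> `|m A| <= variation m A.
Proof.
move=> mA; have := @variation_ge A 1 (fun=> A); rewrite big_ord1; apply.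
by split => [//|i j _ _ _|i //]; rewrite !ord1.
Qed.

Lemma variation_ge0 (A : set T) : 0 <= variation m A.
Proof.
have := @variation_ge A 0 (fun=> set0); rewrite big_ord0; apply.
by split => // -[].
Qed.

Lemma variation_set0 : variation m set0 = 0.
Proof.
apply/eqP; rewrite eq_le variation_ge0 andbT; apply: ub_ereal_sup.
move=> _ [n [F [[_ _ F0] ->]]]; rewrite big1// => i _.
by rewrite (_ : F i = set0) ?signed_value0 ?abse0//; apply/seteqP; split.
Qed.

Lemma le_variation (A B : set T) : A `<=` B -> variation m A <= variation m B.
Proof.
move=> AB; apply: ub_ereal_sup => _ [n [F [[mF tF FA] ->]]].
by apply: variation_ge; split => // i; exact: subset_trans (FA i) AB.
Qed.

Lemma variation_superadditive (A B : set T) : A `&` B = set0 ->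
  variation m A + variation m B <= variation m (A `|` B).
Proof.
move=> AB0.
have key n (F : 'I_n -> set T) n' (G : 'I_n' -> set T) :
    disjoint_family_in A F -> disjoint_family_in B G ->
    \sum_(i < n) `|m (F i)| + \sum_(i < n') `|m (G i)| <=
    variation m (A `|` B).
  move=> [mF tF FA] [mG tG GB].
  pose H (k : 'I_(n + n')) :=
    match fintype.split k with inl i => F i | inr j => G j end.
  have HF i : H (lshift n' i) = F i by rewrite /H (unsplitK (inl i)).
  have HG i : H (rshift n i) = G i by rewrite /H (unsplitK (inr i)).
  have := @variation_ge (A `|` B) _ H; rewrite big_split_ord/=.
  under eq_bigr do rewrite HF.
  under [X in _ + X]eq_bigr do rewrite HG.
  apply; split.
  - by move=> k; rewrite /H; case: fintype.split.
  - move=> k l _ _; rewrite -(splitK k) -(splitK l).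
    case: (fintype.split k) (fintype.split l) => [i|i] [j|j] /=;
      rewrite ?HF ?HG.
    + by move=> h; rewrite (tF i j).
    + by move=> [t [/FA At /GB Bt]]; have : (A `&` B) t by []; rewrite AB0.
    + by move=> [t [/GB Bt /FA At]]; have : (A `&` B) t by []; rewrite AB0.
    + by move=> h; rewrite (tG i j).
  - move=> k t; rewrite /H; case: fintype.split => i.
      by move=> /FA; left.
    by move=> /GB; right.
have [->|fin] := eqVneq (variation m (A `|` B)) +oo; first exact: leey.
have ff C : C `<=` A `|` B -> variation m C \is a fin_num.
  move=> /le_variation CAB; rewrite ge0_fin_numE ?variation_ge0//.
  by apply: (le_lt_trans CAB); rewrite ltey.
have fU : variation m (A `|` B) \is a fin_num by exact: ff.
have fA : variation m A \is a fin_num by apply: ff; exact: subsetUl.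
have fB : variation m B \is a fin_num by apply: ff; exact: subsetUr.
rewrite -leeBrDr//; apply: ub_ereal_sup => _ [n [F [pF ->]]].
have fs : \sum_(i < n) `|m (F i)| \is a fin_num.
  rewrite ge0_fin_numE ?sume_ge0//.
  by apply: (le_lt_trans (variation_ge pF)); rewrite ltey_eq fA.
rewrite leeBrDr// addeC -leeBrDr//; apply: ub_ereal_sup => _ [n' [G [pG ->]]].
by rewrite leeBrDr// addeC; exact: key.
Qed.

Lemma variation_sigma_additive : semi_sigma_additive (variation m).
Proof.
move=> A mA tA mU.
suff -> : variation m (\bigcup_n A n) = \sum_(0 <= n <oo) variation m (A n).
  by apply: is_cvg_nneseries => n _ _; exact: variation_ge0.
apply/eqP; rewrite eq_le; apply/andP; split.
- apply: ub_ereal_sup => _ [n [F [[mF tF FA] ->]]].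
  apply: (@le_trans _ _ (\sum_(i < n) \sum_(0 <= k <oo) `|m (F i `&` A k)|)).
    apply: lee_sum => i _.
    rewrite [X in m X](_ : F i = \bigcup_k (F i `&` A k)); last first.
      by rewrite -setI_bigcupr; apply/esym/setIidl/FA.
    apply: abse_signed_value_le; last exact: trivIset_setIl.
    by move=> k; exact: measurableI.
  rewrite -nneseries_sum; last by move=> *; exact: abse_ge0.
  apply: lee_nneseries => [k _ _|k _]; first exact: sume_ge0.
  apply: variation_ge; split => [i||i].
  + exact: measurableI.
  + exact: trivIset_setIr.
  + exact: subIsetr.
- apply: lime_le.
    by apply: is_cvg_nneseries => n _ _; exact: variation_ge0.
  apply: nearW => n.
  apply: (@le_trans _ _ (variation m (\big[setU/set0]_(0 <= k < n) A k))).
    elim: n => [|n ih].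
      by rewrite !big_geq// variation_ge0.
    rewrite !big_nat_recr//=; apply: le_trans (variation_superadditive _).
      exact: leeD.
    rewrite big_mkord; apply: (@trivIset_bigsetUI _ predT) => //.
    exact: sub_trivIset tA.
  apply: le_variation; rewrite big_mkord.
  exact: bigsetU_bigcup.
Qed.

HB.instance Definition _ := isMeasure.Build _ _ _ (variation m)
  variation_set0 variation_ge0 variation_sigma_additive.

End variation_measure.

Lemma sintegral_indep {d} (T : measurableType d) (R : realType)
    (m m' : signed_measure T R) (D : set T) (f : T -> \bar R) :
  measurable D -> (forall A, measurable A -> m A = m' A) ->
  sintegrable m D f -> sintegrable m' D f ->
  sintegral m D f = sintegral m' D f.
Proof.
move=> mD mm' [ip iN] [ip' iN'].
have mf := measurable_int _ ip.
have E A : measurable A -> A `<=` D ->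
    measure_add (spos m) (sneg m') A = measure_add (spos m') (sneg m) A.
  move=> mA _; rewrite /measure_add/= /msum !big_ord_recl !big_ord0/= !adde0.
  have := mm' _ mA; have := signed_value_def m mA; have := signed_value_def m' mA.
  rewrite /signed_value.
  have ny (mu : {measure set T -> \bar R}) : mu A == -oo%E = false.
    by apply/negbTE; rewrite -ltNye (lt_le_trans _ (measure_ge0 mu A))// ltNy0.
  have := ny (spos m); have := ny (sneg m).
  have := ny (spos m'); have := ny (sneg m').
  case: (spos m A) => [p||]; case: (sneg m A) => [n||];
    case: (spos m' A) => [p'||]; case: (sneg m' A) => [n'||] //= _ _ _ _ _ _.
  rewrite -!EFinB -!EFinD => -[h]; congr EFin; apply/eqP.
  by rewrite -subr_eq addrAC h subrK.
have Eint : (\int[measure_add (spos m) (sneg m')]_(x in D) f x =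
             \int[measure_add (spos m') (sneg m)]_(x in D) f x)%E.
  exact: eq_measure_integral.
rewrite !integral_measure_add// in Eint.
have [fp fn fp' fn'] := And4 (integrable_fin_num mD ip)
  (integrable_fin_num mD iN) (integrable_fin_num mD ip')
  (integrable_fin_num mD iN').
rewrite /sintegral; move: Eint fp fn fp' fn'.
case: (\int[spos m]_(x in D) f x)%E => [p||]//;
case: (\int[sneg m]_(x in D) f x)%E => [n||]//;
case: (\int[spos m']_(x in D) f x)%E => [p'||]//;
case: (\int[sneg m']_(x in D) f x)%E => [n'||]//.
rewrite -!EFinD => -[h] _ _ _ _; congr EFin; apply/eqP.
by rewrite subr_eq addrAC -h addrK.
Qed.

(* [B i = setT] is allowed, so the product rule for the whole family contains
   the rule for every subfamily. *)
Definition mutually_independent {d} (T : measurableType d) (R : realType)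
    (P : probability T R) (n : nat) (Y : 'I_n -> T -> R) : Prop :=
  forall B : 'I_n -> set R, (forall i, measurable (B i)) ->
    P [set w | forall i, B i (Y i w)] =
    (\prod_(i < n) P [set w | B i (Y i w)])%E.

(* Functions and processes on [0, oo) are encoded as total families over [R]
   whose values at negative times are never used. Paths are continuous for
   every outcome, so that the Skorokhod problem can be solved pathwise. *)
Record standard_brownian_motion {d} (T : measurableType d) (R : realType)
    (P : probability T R) (W : R -> {RV P >-> R}) : Prop := {
  bm_start : forall w, W 0 w = 0 ;
  bm_continuous : forall w, {within `[0, +oo[, continuous (W ^~ w)} ;
  bm_gaussian : forall s t : R, 0 <= s -> s < t ->
    forall B : set R, measurable B ->
      P [set w | B (W t w - W s w)] = normal_prob 0 (Num.sqrt (t - s)) B ;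
  bm_independent : forall (n : nat) (t : nat -> R),
    0 <= t 0%N -> (forall i, (i < n)%N -> t i <= t i.+1) ->
    mutually_independent P (fun (i : 'I_n) w => W (t i.+1) w - W (t i) w) }.

Definition cadlag {R : realType} (f : R -> R) : Prop :=
  (forall t : R, 0 <= t -> f @ t^'+ --> f t) /\
  (forall t : R, 0 < t -> cvg (f @ t^'-)).

(* [dz] extends [z] by its value [z 0] to the negative half-line, so that its
   Stieltjes measure is carried by ]0, oo[. *)
Definition stieltjes_extension {R : realType} (z : R -> R)
    (dz : cumulative R R) : Prop :=
  forall s : R, dz s = z (Num.max 0 s).

Lemma stieltjes_extension_exists {R : realType} (z : R -> R) :
  cadlag z -> (forall s t : R, 0 <= s -> s <= t -> z s <= z t) ->
  exists dz : cumulative R R, stieltjes_extension z dz.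
Proof.
move=> [rz _] nz; pose g s := z (Num.max 0 s).
have gnd : nondecreasing g.
  move=> s t st; apply: nz; first by rewrite le_max lexx.
  by rewrite ge_max le_max lexx/= le_max st orbT.
have grc : right_continuous g.
  move=> s; have [s0|s0] := leP 0 s.
    rewrite {2}/g (max_r s0); apply: cvg_trans (rz _ s0).
    apply: near_eq_cvg; near=> t.
    by rewrite /g max_r// (le_trans s0)//; near: t; exact: nbhs_right_ge.
  rewrite {2}/g (max_l (ltW s0)).
  apply: cvg_near_cst; near=> t; apply/eqP.
  by rewrite /g max_l//; near: t; exact: nbhs_right_le.
pose dz : cumulative R R := HB.pack g (isCumulative.Build R _ R g gnd grc).
by exists dz.
Unshelve. all: by end_near. Qed.

Record skorokhod_solution {R : realType} (f x z : R -> R) : Prop := {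
  skorokhod_data_cadlag : cadlag f ;
  skorokhod_data_start : 0 <= f 0 ;
  skorokhod_cadlag_x : cadlag x ;
  skorokhod_cadlag_z : cadlag z ;
  skorokhod_nondecreasing : forall s t : R, 0 <= s -> s <= t -> z s <= z t ;
  skorokhod_start : z 0 = 0 ;
  skorokhod_decomposition : forall t : R, 0 <= t -> x t = f t + z t ;
  skorokhod_ge0 : forall t : R, 0 <= t -> 0 <= x t ;
  skorokhod_flat : exists2 dz : cumulative R R, stieltjes_extension z dz &
    forall t : R, 0 <= t ->
      (\int[lebesgue_stieltjes_measure dz]_(s in `[0%R, t])
         (\1_[set s | 0 < x s] s)%:E = 0)%E }.

(* Main.v *)
(* The function ell is found through a = alpha * ell. The reflection of x + W -
   a at 0 is pushed up by L^x_t = (M_t - x)_+ with M_t = sup_{s <= t} (a_s -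
   W_s), so with g(y) = alpha * \int (y - x)_+ dm(x) one has to solve the fixed
   point equation a_t = E g(M_t).

   On a dyadic grid it is solved step by step for the value of a at the new
   grid point: y - g(y) is nondecreasing, and it is at least eta * y near 0, so
   the intermediate value theorem applies. Since E W_t = 0, the slack X_t = M_t
   - (a_t - W_t) has mean E (M_t - g(M_t)), which is nondecreasing in t. If a
   attains its maximum over [s, t] at t, and U bounds the oscillation of W
   there, then M increases by at most U + A - min(A, X_s), where A = a_t - a_s.
   As a = E g(M) and E (M - g(M)) does not decrease, taking expectations makes
   A cancel and leaves E min(A, X_s) <= E U. Because X_s >= W_s - a_s is large
   with a probability bounded below, this controls the increments of a
   uniformly in the grid. The grid solutions are thus bounded and
   equicontinuous, and a limit along an ultrafilter solves the equation by
   dominated convergence.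

   The random variables involved are dominated by multiples of Z or of
   exp(Z^2), with Z from a chaining argument: Z^2 is, up to constants, the
   logarithm of a weighted sum of exp(2^n D^2 / 4) over the dyadic increments D
   of level n. *)

(* The bound [m [0, x] <= 1 / alpha] may be attained, so [g] can have slope 1 and the map sending
   [a] to [t |-> E g(M_t)] need not be a contraction; this is why existence comes from compactness.
   Since [m] is signed, [a] need not be monotone, and the increment estimate gives only upper
   bounds, at points where [a] is maximal. Lower bounds come afterwards: upper bounds on [a] bound
   the nondecreasing [M], and [a = E g(M)] turns this into a two-sided estimate. Implicit stepping
   keeps the equation exact at each grid point, so the cancellation of [A] leaves no discretisation
   error. At time 0 the slack vanishes and gives no information; there the strict bound on [m {0}]
   takes its place. The mass of [m] on [[0, y]] is bounded by a multiple of [exp (c y^2)] for every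
   [c > 0], so [g(M)] is integrable whichever multiple of [Z] bounds [M]. *)
From HB Require Import structures.
Require Import Defs.
From mathcomp Require Import measurable_realfun ring lra.

Set Implicit Arguments.
Unset Strict Implicit.
Unset Printing Implicit Defensive.

(** * Dominated random variables *)

Section expectation.
Context {d : measure_display} {T : measurableType d} {R : realType}.
Variables (P : probability T R) (Z : T -> R).
Hypothesis mZ : measurable_fun setT Z.
Hypothesis Z1 : forall w, 1 <= Z w.
Hypothesis iZ : P.-integrable setT (fun w => (expR (Z w ^+ 2))%:E).

Implicit Types f g : T -> R.

Definition mean (f : T -> R) : R := \int[P]_w f w.

(** Both bounds hold at every outcome, so no exceptional null set has to be carried along. The
    linear class holds the paths and their running maxima; the exponential class also holds squares
    of these and their images under [g]. *)
Definition dominated (f : T -> R) : Prop := measurable_fun setT f /\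
  exists C : R, forall w, `|f w| <= C * expR (Z w ^+ 2).

Definition lin_dominated (f : T -> R) : Prop := measurable_fun setT f /\
  exists C : R, forall w, `|f w| <= C * Z w.

Lemma expZ_ge1 w : 1 <= expR (Z w ^+ 2).
Proof. by rewrite -[leLHS]expR0 ler_expR sqr_ge0. Qed.

Lemma sqrZ_le_exp w : Z w ^+ 2 <= expR (Z w ^+ 2).
Proof. by apply: le_trans (expR_ge1Dx _); rewrite lerDr. Qed.

Lemma Z_le_sqr w : Z w <= Z w ^+ 2.
Proof. by rewrite expr2 ler_peMr// (le_trans _ (Z1 w)). Qed.

Lemma dom_integrable f : dominated f -> P.-integrable setT (EFin \o f).
Proof.
move=> [mf [C fC]].
apply: (le_integrable _ _ _ (integrableZl measurableT C iZ)) => //.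
  exact/measurable_EFinP.
move=> w _ /=; rewrite lee_fin (le_trans (fC w))//; exact: ler_norm.
Qed.

Lemma dom_le f g : measurable_fun setT f -> dominated g ->
  (forall w, `|f w| <= g w) -> dominated f.
Proof.
move=> mf [_ [C gC]] fg; split => //; exists C => w.
by rewrite (le_trans (fg w))// (le_trans _ (gC w))// ler_norm.
Qed.

Lemma dom_cst c : dominated (fun=> c).
Proof.
by split => //; exists `|c| => w; rewrite ler_peMr// expZ_ge1.
Qed.

Lemma domD f g : dominated f -> dominated g -> dominated (fun w => f w + g w).
Proof.
move=> [mf [C fC]] [mg [D gD]]; split; first exact: measurable_funD.
exists (C + D) => w; rewrite mulrDl (le_trans (ler_normD _ _))// lerD//.
Qed.

Lemma domN f : dominated f -> dominated (fun w => - f w).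
Proof.
move=> [mf [C fC]]; split; first exact: measurable_funN.
by exists C => w; rewrite normrN.
Qed.

Lemma domB f g : dominated f -> dominated g -> dominated (fun w => f w - g w).
Proof. by move=> df dg; apply: domD => //; exact: domN. Qed.

Lemma domZ c f : dominated f -> dominated (fun w => c * f w).
Proof.
move=> [mf [C fC]]; split; first exact: measurable_funM.
by exists (`|c| * C) => w; rewrite normrM -mulrA ler_wpM2l.
Qed.

Lemma lin_dom f : lin_dominated f -> dominated f.
Proof.
move=> [mf [C fC]]; split => //; exists `|C| => w.
apply: le_trans (fC w) _.
apply: (@le_trans _ _ (`|C| * Z w)).
  by rewrite ler_wpM2r ?(le_trans _ (Z1 w))// ler_norm.
by rewrite ler_wpM2l// (le_trans (Z_le_sqr w))// sqrZ_le_exp.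
Qed.

Lemma lin_sqr_dom f : lin_dominated f -> dominated (fun w => f w ^+ 2).
Proof.
move=> [mf [C fC]]; split; first exact: measurable_funX.
exists (C ^+ 2) => w; rewrite normrX.
apply: (@le_trans _ _ ((C * Z w) ^+ 2)).
  by rewrite ler_pXn2r// ?nnegrE// (le_trans _ (fC w)).
by rewrite exprMn ler_wpM2l ?sqr_ge0// sqrZ_le_exp.
Qed.

Lemma lin_cst c : lin_dominated (fun=> c).
Proof. by split => //; exists `|c| => w; rewrite ler_peMr. Qed.

Lemma lin_Z : lin_dominated Z.
Proof. by split => //; exists 1 => w;
  rewrite mul1r ger0_norm// (le_trans _ (Z1 w)). Qed.

Lemma linD f g : lin_dominated f -> lin_dominated g ->
  lin_dominated (fun w => f w + g w).
Proof.
move=> [mf [C fC]] [mg [D gD]]; split; first exact: measurable_funD.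
exists (C + D) => w; rewrite mulrDl (le_trans (ler_normD _ _))// lerD//.
Qed.

Lemma linN f : lin_dominated f -> lin_dominated (fun w => - f w).
Proof.
move=> [mf [C fC]]; split; first exact: measurable_funN.
by exists C => w; rewrite normrN.
Qed.

Lemma linB f g : lin_dominated f -> lin_dominated g ->
  lin_dominated (fun w => f w - g w).
Proof. by move=> df dg; apply: linD => //; exact: linN. Qed.

Lemma linZ c f : lin_dominated f -> lin_dominated (fun w => c * f w).
Proof.
move=> [mf [C fC]]; split; first exact: measurable_funM.
by exists (`|c| * C) => w; rewrite normrM -mulrA ler_wpM2l.
Qed.

Lemma lin_max f g : lin_dominated f -> lin_dominated g ->
  lin_dominated (fun w => Num.max (f w) (g w)).
Proof.
move=> [mf [C fC]] [mg [D gD]]; split; first exact: measurable_maxr.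
exists (C + D) => w; have := fC w; have := gD w.
have C0 := le_trans (normr_ge0 _) (fC w).
have D0 := le_trans (normr_ge0 _) (gD w).
by rewrite mulrDl; case: (leP (f w) (g w)) => _ ? ?; lra.
Qed.

Lemma lin_min f g : lin_dominated f -> lin_dominated g ->
  lin_dominated (fun w => Num.min (f w) (g w)).
Proof.
move=> [mf [C fC]] [mg [D gD]]; split; first exact: measurable_minr.
exists (C + D) => w; have := fC w; have := gD w.
have C0 := le_trans (normr_ge0 _) (fC w).
have D0 := le_trans (normr_ge0 _) (gD w).
by rewrite mulrDl; case: (leP (f w) (g w)) => _ ? ?; lra.
Qed.

Lemma mean_le f g : dominated f -> dominated g -> (forall w, f w <= g w) ->
  mean f <= mean g.
Proof.
move=> df dg fg; apply: le_Rintegral => //; exact: dom_integrable.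
Qed.

Lemma meanD f g : dominated f -> dominated g -> mean (fun w => f w + g w) =
  mean f + mean g.
Proof. by move=> df dg; apply: RintegralD => //; exact: dom_integrable. Qed.

Lemma meanB f g : dominated f -> dominated g -> mean (fun w => f w - g w) =
  mean f - mean g.
Proof. by move=> df dg; apply: RintegralB => //; exact: dom_integrable. Qed.

Lemma meanZ c f : dominated f -> mean (fun w => c * f w) = c * mean f.
Proof. by move=> df; apply: RintegralZl => //; exact: dom_integrable. Qed.

Lemma mean_cst c : mean (fun=> c) = c.
Proof.
rewrite /mean Rintegral_cst//.
have := @probability_setT _ _ _ P => /= ->.
by rewrite mulr1.
Qed.

Lemma eq_mean f g : f =1 g -> mean f = mean g.
Proof. by move=> fg; apply: eq_Rintegral => w _; exact: fg. Qed.

Lemma mean_ge0 f : (forall w, 0 <= f w) -> 0 <= mean f.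
Proof. by move=> f0; apply: Rintegral_ge0. Qed.

Lemma mean_norm f : dominated f -> `|mean f| <= mean (fun w => `|f w|).
Proof. by move=> df; apply: le_normr_Rintegral => //;
  exact: dom_integrable. Qed.

Lemma mean_cvg (fn : nat -> T -> R) (f : T -> R) (C : R) :
  (forall n, measurable_fun setT (fn n)) ->
  (forall n w, `|fn n w| <= C * expR (Z w ^+ 2)) ->
  (forall w, fn n w @[n --> \oo] --> f w) ->
  mean (fn n) @[n --> \oo] --> mean f.
Proof.
move=> mfn fnC fnf.
have mf : measurable_fun setT f.
  by apply: (measurable_fun_cvg mfn) => w _; exact: fnf.
have := @dominated_convergence _ T R P setT measurableT
  (fun n => EFin \o fn n) (EFin \o f)
    (fun w => (C%:E * (expR (Z w ^+ 2))%:E)%E).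
case.
- by move=> n; exact/measurable_EFinP.
- exact/measurable_EFinP.
- apply: aeW => w _ /=; apply/fine_cvgP; split => /=; last exact: fnf.
  by apply: nearW.
- exact: integrableZl.
- by apply: aeW => w n _ /=; rewrite lee_fin.
move=> fi _ cv; rewrite /mean /Rintegral.
apply: fine_cvg; rewrite fineK//; exact: integrable_fin_num.
Qed.

End expectation.

(** * Properties of the nonlinearity *)

Section gap_function.
Context {R : realType}.

(* The four properties of [y |-> alpha * \int (y - x)_+ dm(x)] which are used:
   they come, in this order, from the absence of mass on the negative half-line,
   from [m `[0, x] <= 1 / alpha], from [m [set 0] < 1 / alpha], and from the
   Gaussian integrability of [m]. *)
Record admissible (g : R -> R) : Prop := {
  adm_le0 : forall y, y <= 0 -> g y = 0 ;
  adm_lip : forall x y, 0 <= x -> x <= y -> g y - g x <= y - x ;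
  adm_gap : exists eta y0 : R, [/\ 0 < eta, 0 < y0 &
    forall y, 0 <= y -> eta * Num.min y y0 <= y - g y] ;
  adm_growth : forall C : R, exists D : R, forall x y z : R,
    0 <= x -> x <= y -> 1 <= z -> y <= C * z ->
    `|g y - g x| <= D * expR (z ^+ 2 / 2) * (y - x) }.

End gap_function.

Section admissible_theory.
Context {R : realType} (g : R -> R).
Hypothesis adm : admissible g.

Lemma adm_max y : g (Num.max 0 y) = g y.
Proof.
by case: (leP 0 y) => // y0; rewrite (adm_le0 adm) ?lexx// (adm_le0 adm)// ltW.
Qed.

Lemma adm_continuous : continuous g.
Proof.
(* With [z = 1] the growth bound is a Lipschitz bound for arguments up to [|p| + 1]. *)
move=> p; have [D HD] := adm_growth adm (`|p| + 1).
pose K : R := `|D * expR (1 ^+ 2 / 2)|.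
have lip x y : x <= `|p| + 1 -> y <= `|p| + 1 -> `|g y - g x| <= K * `|y - x|.
  wlog xy : x y / x <= y.
    move=> H; case: (leP x y) => [xy|/ltW yx] hx hy; first exact: H.
    by rewrite distrC (distrC y); exact: H.
  move=> xp yp; rewrite -(adm_max x) -(adm_max y).
  have p0 : 0 <= `|p| + 1 by rewrite addr_ge0.
  apply: (@le_trans _ _ (K * (Num.max 0 y - Num.max 0 x))).
    have mm : Num.max 0 x <= Num.max 0 y.
      by rewrite ge_max le_max lexx/= le_max xy orbT.
    apply: le_trans (HD _ _ 1 _ mm (lexx _) _) _.
    - by rewrite le_max lexx.
    - by rewrite mulr1 ge_max p0.
    - by rewrite ler_wpM2r ?subr_ge0// ler_norm.
  apply: ler_wpM2l; first exact: normr_ge0.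
  rewrite (@ger0_norm _ (y - x)) ?subr_ge0//.
  by case: (leP 0 y) => ?; case: (leP 0 x) => ?; lra.
apply/cvgrPdist_le => e e0.
have K0 : 0 <= K by exact: normr_ge0.
have K1 : 0 < K + 1 by rewrite ltr_wpDl.
near=> x.
have xp : `|p - x| <= Num.min 1 (e / (K + 1)).
  near: x; apply: cvgr_dist_le; first exact: cvg_id.
  by rewrite lt_min ltr01 divr_gt0.
move: xp; rewrite le_min => /andP[x1 xe].
apply: le_trans (lip _ _ _ _) _.
- have := ler_norm p; have := ler_normB p (p - x).
  have -> : p - (p - x) = x by ring.
  by have := ler_norm x; lra.
- by rewrite (le_trans (ler_norm _))// lerDl.
- rewrite (le_trans _ (_ : (K + 1) * (e / (K + 1)) <= e))//.
    by apply: ler_pM => //; lra.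
  by rewrite mulrC divfK// gt_eqF.
Unshelve. all: by end_near. Qed.

Lemma adm_mono x y : 0 <= x -> x <= y -> x - g x <= y - g y.
Proof. by move=> x0 xy; have := adm_lip adm x0 xy; lra. Qed.

End admissible_theory.

(** * Implicit time stepping *)

Section scheme.
Context {d : measure_display} {T : measurableType d} {R : realType}.
Variables (P : probability T R) (Z : T -> R) (g : R -> R).
Hypothesis mZ : measurable_fun setT Z.
Hypothesis Z1 : forall w, 1 <= Z w.
Hypothesis iZ : P.-integrable setT (fun w => (expR (Z w ^+ 2))%:E).
Hypothesis adm : admissible g.

Local Notation mean := (mean P).
Local Notation dominated := (dominated Z).
Local Notation lin_dominated := (lin_dominated Z).

Let Z0 w : 0 <= Z w. Proof. by rewrite (le_trans _ (Z1 w)). Qed.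

(** The exponent in [adm_growth] is only [z ^+ 2 / 2]; the other half of [expR (Z w ^+ 2)] is kept
    to absorb a linear factor [Z w] through this bound. *)
Lemma Z_le_exp_half w : Z w <= expR (Z w ^+ 2 / 2).
Proof.
apply: le_trans (expR_ge1Dx _).
by have : 0 <= (Z w - 1) ^+ 2 by [exact: sqr_ge0]; lra.
Qed.

Lemma exp_halfM w : expR (Z w ^+ 2 / 2) * expR (Z w ^+ 2 / 2) = expR (Z w ^+ 2).
Proof. by rewrite -expRD -splitr. Qed.

(** The slope of [g] below [C * Z w] costs one factor [expR (Z w ^+ 2 / 2)] and the distance from 0
    costs the other. Arguments below 0 are harmless because [g] vanishes there. *)
Lemma adm_dom_bound (C : R) : exists D, forall y w, y <= C * Z w ->
  `|g y| <= D * expR (Z w ^+ 2).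
Proof.
have [D HD] := adm_growth adm `|C|; exists (`|D| * `|C|) => y w yC.
have CZ0 : 0 <= `|C| * Z w by rewrite mulr_ge0.
have yC' : Num.max 0 y <= `|C| * Z w.
  rewrite ge_max CZ0/= (le_trans yC)// ler_wpM2r// ler_norm//.
have := HD 0 (Num.max 0 y) (Z w) (lexx 0) _ (Z1 w) yC'.
rewrite (adm_max adm) (adm_le0 adm (lexx 0)) !subr0.
move=> /(_ _) H; apply: le_trans (H _) _; first by rewrite le_max lexx.
apply: (@le_trans _ _ (`|D| * expR (Z w ^+ 2 / 2) * (`|C| * Z w))).
  apply: (@le_trans _ _ (`|D| * expR (Z w ^+ 2 / 2) * Num.max 0 y)).
    rewrite ler_wpM2r ?le_max ?lexx// ler_wpM2r ?expR_ge0//; exact: ler_norm.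
  by rewrite ler_wpM2l// mulr_ge0 ?expR_ge0.
rewrite -(exp_halfM w) [leRHS](_ : _ = `|D| * expR (Z w ^+ 2 / 2) *
  (`|C| * expR (Z w ^+ 2 / 2))); last by ring.
rewrite ler_wpM2l ?mulr_ge0 ?expR_ge0// ler_wpM2l//; exact: Z_le_exp_half.
Qed.

Lemma adm_measurable (M : T -> R) : measurable_fun setT M ->
  measurable_fun setT (g \o M).
Proof.
move=> mM; apply: measurableT_comp => //; apply: continuous_measurable_fun.
exact: adm_continuous adm.
Qed.

Lemma adm_dom (M : T -> R) : lin_dominated M -> dominated (g \o M).
Proof.
move=> [mM [C MC]]; split; first exact: adm_measurable.
have [D HD] := adm_dom_bound C; exists D => w; apply: HD.
exact: le_trans (ler_norm _) (MC w).
Qed.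

Lemma adm_gap_dom (M : T -> R) : lin_dominated M ->
  dominated (fun w => M w - g (M w)).
Proof. by move=> lM; apply: domB; [exact: lin_dom|exact: adm_dom]. Qed.

(** Intermediate value theorem for [a - F a] between [- D], where [D] bounds [F] on the negative
    half-line, and a level [b] so large that the gap of [g] yields [F b <= b]. *)
Lemma solve_step (M V : T -> R) : lin_dominated M -> lin_dominated V ->
  (forall w, 0 <= M w) ->
  mean V = 0 ->
  (forall A c : R, 0 <= A -> 0 < c ->
    Num.min A c / 2 <= mean (fun w => Num.min (Num.max (A - V w) 0) c)) ->
  exists a, a = mean (fun w => g (Num.max (M w) (a - V w))).
Proof.
move=> lM lV M0 EV HV.
pose F a := mean (fun w => g (Num.max (M w) (a - V w))).
have lm a : lin_dominated (fun w => Num.max (M w) (a - V w)).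
  by apply: lin_max => //; apply: linB => //; exact: lin_cst.
have cF : continuous F.
  suff H (p : R) (u : nat -> R) : u n @[n --> \oo] --> p ->
      F (u n) @[n --> \oo] --> F p.
    by move=> p; apply/(@cvg_nbhsP _ R^o) => u up; exact: H.
  move=> up.
  have [B [_ uB]] := cvg_seq_bounded (cvgP _ up).
  have [_ [C1 MC]] := lM; have [_ [C2 VC]] := lV.
  pose B' : R := `|B| + 1.
  have uB' n : `|u n| <= B'.
    by apply: uB => //; rewrite /B'; have := ler_norm B; lra.
  clearbody B'.
  have [D HD] := adm_dom_bound (C1 + B' + C2).
  apply: (@mean_cvg _ _ _ P Z iZ _ _ D).
  - by move=> n; apply: adm_measurable; case: (lm (u n)).
  - move=> n w; apply: HD.
    have := MC w; have := VC w; have := uB' n; have := Z1 w => z1 ub vc mc.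
    have bz : B' <= B' * Z w by rewrite ler_peMr// (le_trans _ ub).
    have c1 := le_trans (normr_ge0 _) mc; have c2 := le_trans (normr_ge0 _) vc.
    have := ler_norm (M w); have := ler_norm (- V w); rewrite normrN.
    have := ler_norm (u n) => ? ? ?.
    have : 0 <= B' by rewrite (le_trans _ ub).
    by rewrite ge_max !mulrDl; move=> ?; apply/andP; split; lra.
  - move=> w.
    apply: (@cvg_comp _ _ _ (fun n => Num.max (M w) (u n - V w)) g); last first.
      exact: (adm_continuous adm).
    apply: (@cvg_comp _ _ _ u (fun x => Num.max (M w) (x - V w))).
      exact: up.
    apply: (@continuous_max R R (fun=> M w) (fun x => x - V w) p).
      exact: cst_continuous.
    by apply: cvgB; [exact: cvg_id|exact: cvg_cst].
have [eta [y0 [eta0 y00 gap]]] := adm_gap adm.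
(* For [a <= 0] the argument of [g] is at most [Num.max (M w) (- V w)], which gives a bound not
   depending on [a]. *)
have [D HD] : exists D, forall a, a <= 0 -> `|F a| <= D.
  have [_ [C1 MC]] := lM; have [_ [C2 VC]] := lV.
  have [D HD] := adm_dom_bound (C1 + C2).
  have dD : dominated (fun w => D * expR (Z w ^+ 2)).
    apply: domZ; split; last by exists 1 => w;
      rewrite mul1r ger0_norm ?expR_ge0.
    by apply: measurableT_comp => //; exact: measurable_funX.
  exists (mean (fun w => D * expR (Z w ^+ 2))) => a a0.
  have H w : `|g (Num.max (M w) (a - V w))| <= D * expR (Z w ^+ 2).
    apply: HD; have := MC w; have := VC w.
    have := ler_norm (M w); have := ler_norm (- V w);
      rewrite normrN => ? ? vc mc.
    have c1 := le_trans (normr_ge0 _) mc; have c2 := le_trans (normr_ge0 _) vc.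
    by rewrite mulrDl ge_max; apply/andP; split; lra.
  apply: (le_trans (mean_norm iZ (adm_dom (lm a)))).
  apply: (mean_le iZ _ dD) => [|w].
    apply: (dom_le _ dD) => [|w]; last by rewrite normr_id; exact: H.
    by apply: measurableT_comp => //; apply: adm_measurable; case: (lm a).
  exact: H.
have D0 : 0 <= D by rewrite (le_trans _ (HD 0 (lexx 0))).
pose S := mean (fun w => (V w + M w) ^+ 2).
have lVM : lin_dominated (fun w => V w + M w) by exact: linD.
have S0 : 0 <= S by apply: mean_ge0 => w; exact: sqr_ge0.
(* This choice makes the error [S / (4 * b)] below at most [eta * y0 / 2], which is the guaranteed
   mean of the gap term once [y0 <= b]. *)
pose b := y0 + S / (2 * eta * y0).
have b_y0 : y0 <= b by rewrite lerDl divr_ge0// !mulr_ge0// ltW.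
have b0 : 0 < b by exact: lt_le_trans b_y0.
have Sb : S / (4 * b) <= eta * y0 / 2.
  rewrite ler_pdivrMr; last by rewrite mulr_gt0.
  have -> : eta * y0 / 2 * (4 * b) = 2 * eta * y0 * y0 + S.
    by rewrite /b; field; rewrite !gt_eqF.
  by rewrite lerDr !mulr_ge0// ltW.
have Fb : F b <= b.
  rewrite -subr_ge0 -[X in X - _](mean_cst P).
  rewrite -(meanB iZ)/=; [|exact: dom_cst|exact: adm_dom].
  (* [low] bounds [b - g m] from below. The part [m - g m] is bounded by the gap condition; for the
     part [b - m], the inequality [(V + M - 2 * b) ^+ 2 >= 0] gives
     [M - (b - V) <= (V + M) ^+ 2 / (4 * b)]. *)
  pose low w := V w + (eta * Num.min (Num.max (b - V w) 0) y0 -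
    (4 * b)^-1 * (V w + M w) ^+ 2).
  have dmin : dominated (fun w => Num.min (Num.max (b - V w) 0) y0).
    apply: lin_dom => //; apply: lin_min; last exact: lin_cst.
    by apply: lin_max; [apply: linB => //; exact: lin_cst|exact: lin_cst].
  have dsq : dominated (fun w => (4 * b)^-1 * (V w + M w) ^+ 2).
    by apply: domZ; exact: lin_sqr_dom.
  have d1 : dominated (fun w => eta * Num.min (Num.max (b - V w) 0) y0 -
      (4 * b)^-1 * (V w + M w) ^+ 2).
    by apply: domB => //; exact: domZ.
  have dV : dominated V by exact: lin_dom.
  apply: (@le_trans _ _ (mean low)).
    rewrite (meanD iZ)// (meanB iZ)//; last exact: domZ.
    rewrite (meanZ iZ)// (meanZ iZ); last exact: lin_sqr_dom.
    rewrite EV add0r subr_ge0 -/S mulrC (le_trans Sb)// -mulrA ler_pM2l//.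
    by have := HV b y0 (ltW b0) y00; rewrite (min_idPr b_y0).
  apply: (mean_le iZ).
  - exact: domD.
  - by apply: domB; [exact: dom_cst|exact: adm_dom].
  move=> w; rewrite /low; set m := Num.max (M w) _.
  have m0 : 0 <= m by rewrite le_max M0.
  have gm := gap _ m0.
  have h1 : Num.min (Num.max (b - V w) 0) y0 <= Num.min m y0.
    have hh : Num.max (b - V w) 0 <= m.
      by rewrite ge_max m0 andbT le_max lexx orbT.
    by rewrite le_min !ge_min lexx hh orbT.
  have h2 : eta * Num.min (Num.max (b - V w) 0) y0 <= eta * Num.min m y0.
    by rewrite ler_pM2l.
  have h3 : m <= b - V w + (4 * b)^-1 * (V w + M w) ^+ 2.
    rewrite ge_max; apply/andP; split; last first.
      by rewrite lerDl mulr_ge0 ?sqr_ge0// invr_ge0 mulr_ge0// ltW.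
    rewrite -subr_ge0.
    have -> : b - V w + (4 * b)^-1 * (V w + M w) ^+ 2 - M w =
      (4 * b)^-1 * (V w + M w - 2 * b) ^+ 2 by field; rewrite gt_eqF.
    by rewrite mulr_ge0 ?sqr_ge0// invr_ge0 mulr_ge0// ltW.
  lra.
have Db : - D <= b by rewrite (le_trans _ (ltW b0))// oppr_le0.
pose Phi x := x - F x.
have cPhi : continuous Phi.
  by move=> x; apply: cvgB; [exact: cvg_id|exact: cF].
have [] := @IVT R Phi (- D) b 0 Db.
- exact: continuous_subspaceT.
- have FD : Phi (- D) <= 0.
    rewrite /Phi; have := HD (- D); rewrite oppr_le0 => /(_ D0).
    by rewrite ler_norml => /andP[+ _]; lra.
  have Fb' : 0 <= Phi b by rewrite /Phi subr_ge0.
  by rewrite ge_min le_max FD Fb' orbT.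
move=> a _ Pa; exists a; rewrite -/(F a); apply/eqP; rewrite -subr_eq0.
exact/eqP.
Qed.

(* Implicit time stepping: [step_level V i.+1] solves the fixed point equation
   [step_level_eq] at the next grid point, without any delay. *)
Fixpoint scheme (V : nat -> T -> R) (i : nat) : R * (T -> R) :=
  if i is j.+1 then
    let M := (scheme V j).2 in
    let a := xget 0 [set a | a =
      mean (fun w => g (Num.max (M w) (a - V i w)))] in
    (a, fun w => Num.max (M w) (a - V i w))
  else (0, fun=> 0).

Definition step_level V i := (scheme V i).1.
Definition step_max V i := (scheme V i).2.

Section scheme_theory.
Variable V : nat -> T -> R.
Hypothesis lV : forall i, lin_dominated (V i).
Hypothesis V0 : forall w, V 0%N w = 0.
Hypothesis EV : forall i, mean (V i) = 0.
Hypothesis HV : forall i (A c : R), 0 <= A -> 0 < c ->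
    Num.min A c / 2 <= mean (fun w => Num.min (Num.max (A - V i w) 0) c).

Let a := step_level V.
Let M := step_max V.

Lemma step_maxS i w : M i.+1 w = Num.max (M i w) (a i.+1 - V i.+1 w).
Proof. by []. Qed.

Lemma step_max_ge0 i w : 0 <= M i w.
Proof. by elim: i => [|i ih] //; rewrite step_maxS le_max ih. Qed.

Lemma step_max_mono i j w : (i <= j)%N -> M i w <= M j w.
Proof.
elim: j => [|j ih]; first by rewrite leqn0 => /eqP ->.
rewrite leq_eqVlt => /predU1P[->//|]; rewrite ltnS => /ih h.
by rewrite step_maxS le_max h.
Qed.

Lemma step_max_ge j i w : (j <= i)%N -> a j - V j w <= M i w.
Proof.
move=> ji; apply: le_trans (step_max_mono w ji).
case: j {ji} => [|j]; first by rewrite V0 subrr.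
by rewrite step_maxS le_max lexx orbT.
Qed.

Lemma step_max_le i j w b : (i <= j)%N -> M i w <= b ->
  (forall l, (i < l)%N -> (l <= j)%N -> a l - V l w <= b) -> M j w <= b.
Proof.
elim: j => [|j ih]; first by rewrite leqn0 => /eqP ->.
rewrite leq_eqVlt => /predU1P[->//|]; rewrite ltnS => ij Mb H.
rewrite step_maxS ge_max H//= andbT; apply: ih => // l il lj; apply: H => //.
exact: leqW.
Qed.

Lemma step_max_lin i : lin_dominated (M i).
Proof.
elim: i => [|i ih]; first exact: lin_cst.
by apply: lin_max => //; apply: linB => //; exact: lin_cst.
Qed.

Lemma step_level_eq i : a i = mean (fun w => g (M i w)).
Proof.
case: i => [|i].
  rewrite /M /step_max/=; rewrite (@eq_mean _ _ _ _ _ (fun=> 0))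
    ?mean_cst// => w.
  by rewrite (adm_le0 adm).
(* A solution exists, so [xget] does not return its default 0. *)
have [b Hb] := solve_step (step_max_lin i) (lV i.+1) (step_max_ge0 i) (EV i.+1)
  (HV i.+1).
rewrite {1}/a /step_level/=.
exact: (@xgetPex _ 0 [set a | a =
  mean (fun w => g (Num.max (M i w) (a - V i.+1 w)))]
  (ex_intro _ b Hb)).
Qed.

(** The reflected path started from 0: [V i - a i] plus its pushing term, which is [M i] for the
    starting point 0. *)
Definition step_slack i w := M i w - a i + V i w.

Lemma step_slack_ge0 i w : 0 <= step_slack i w.
Proof. by have := step_max_ge w (leqnn i); rewrite /step_slack; lra. Qed.

Lemma step_slack_geV i w : V i w - a i <= step_slack i w.
Proof. by have := step_max_ge0 i w; rewrite /step_slack; lra. Qed.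

Lemma step_slack_lin i : lin_dominated (step_slack i).
Proof.
apply: linD => //; apply: linB; [exact: step_max_lin|exact: lin_cst].
Qed.

Definition step_gap i w := M i w - g (M i w).

Lemma step_gap_dom i : dominated (step_gap i).
Proof. by apply: adm_gap_dom; exact: step_max_lin. Qed.

Lemma step_gap_mono i j w : (i <= j)%N -> step_gap i w <= step_gap j w.
Proof. by move=> ij; apply: adm_mono => //;
  [exact: step_max_ge0|exact: step_max_mono]. Qed.

Lemma mean_step_slack i : mean (step_slack i) = mean (step_gap i).
Proof.
rewrite /step_slack (meanD iZ)//; [|apply: lin_dom => //|exact: lin_dom];
  last first.
  by apply: linB; [exact: step_max_lin|exact: lin_cst].
rewrite EV addr0 /step_gap !(meanB iZ)//.
- by rewrite mean_cst step_level_eq.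
- by apply: lin_dom => //; exact: step_max_lin.
- by apply: adm_dom; exact: step_max_lin.
- by apply: lin_dom => //; exact: step_max_lin.
- exact: dom_cst.
Qed.

Lemma mean_step_slack_mono i j : (i <= j)%N -> mean (step_slack i) <=
  mean (step_slack j).
Proof.
move=> ij; rewrite !mean_step_slack; apply: (mean_le iZ);
  [exact: step_gap_dom..|move=> w].
exact: step_gap_mono.
Qed.

(* The running maximum increases by at most [A + U - X] when [a] increases by
   at most [A]; taking expectations, [A] cancels and only the part of [A] lost
   to the distance [X] from the boundary remains. *)
Lemma scheme_increment i j (U : T -> R) : (i <= j)%N -> lin_dominated U ->
  (forall w, 0 <= U w) ->
  (forall l w, (i <= l)%N -> (l <= j)%N -> V i w - V l w <= U w) ->
  (forall l, (i <= l)%N -> (l <= j)%N -> a l <= a j) ->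
  mean (fun w => Num.min (a j - a i) (step_slack i w)) +
    mean (fun w => step_gap j w - step_gap i w)
    <= mean U.
Proof.
move=> ij lU U0 VU amax.
have A0 : 0 <= a j - a i by rewrite subr_ge0 amax.
have dmin : dominated (fun w => Num.min (a j - a i) (step_slack i w)).
  by apply: lin_dom => //; apply: lin_min;
    [exact: lin_cst|exact: step_slack_lin].
have dM l : dominated (M l) by apply: lin_dom => //; exact: step_max_lin.
have dg l : dominated (fun w => g (M l w)) by apply: adm_dom;
  exact: step_max_lin.
have dU : dominated U by exact: lin_dom.
(* Write [A = a j - a i] and [X] for the slack at [i]. The new candidates satisfy
   [a l - V l <= M i - X + A + U], and [A - Num.min A X] is the positive part of [A - X]. *)
have key : mean (fun w => M j w - M i w) <=
    mean (fun w => U w + ((a j - a i) - Num.min (a j - a i) (step_slack i w))).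
  apply: (mean_le iZ).
  - exact: domB.
  - by apply: domD => //; apply: domB => //; exact: dom_cst.
  move=> w; rewrite lerBlDl; apply: (step_max_le ij).
    by have := U0 w; case: (leP (a j - a i) (step_slack i w)) => ?; lra.
  move=> l il lj; have := VU l w (ltnW il) lj; have := amax l (ltnW il) lj.
  by rewrite /step_slack; case: (leP (a j - a i)) => ?; lra.
rewrite (meanB iZ)// (meanD iZ)// in key; last by apply: domB => //;
  exact: dom_cst.
rewrite (meanB iZ)// ?mean_cst in key; last exact: dom_cst.
rewrite (meanB iZ); [|exact: step_gap_dom..].
rewrite /step_gap !(meanB iZ)// -!step_level_eq; lra.
Qed.

End scheme_theory.
End scheme.

(* The properties of Brownian motion which are used; [rp_lower] holds for every
   process with symmetric marginals. *)
Record regular_process {d} {T : measurableType d} {R : realType}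
    (P : probability T R) (Z : T -> R) (W : R -> T -> R) : Prop := {
  rp_start : forall w, W 0 w = 0 ;
  rp_measurable : forall t, measurable_fun setT (W t) ;
  rp_modulus : forall N : nat, exists rho : nat -> R,
    [/\ rho n @[n --> \oo] --> 0, forall n, 0 <= rho n &
     forall n u v w, 0 <= u <= N%:R -> 0 <= v <= N%:R ->
       `|u - v| <= (2 ^+ n)^-1 -> `|W u w - W v w| <= rho n * Z w] ;
  rp_mean : forall t, 0 <= t -> mean P (W t) = 0 ;
  rp_lower : forall t A c : R, 0 <= t -> 0 <= A -> 0 < c ->
    Num.min A c / 2 <= mean P (fun w => Num.min (Num.max (A - W t w) 0) c) ;
  rp_upper : forall (s0 C : R) (N : nat), 0 < s0 -> exists2 p : R, 0 < p &
    forall s, s0 <= s <= N%:R ->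
      p <= mean P (fun w => Num.min (Num.max (W s w - C) 0) 1) }.

(** Supplies the right endpoint that [scheme_increment] asks for: for a signed measure the levels
    need not be monotone, so an interval is first cut at a maximum of the level. *)
Lemma seq_argmax {R : realType} (a : nat -> R) i k : (i <= k)%N ->
  exists j, [/\ (i <= j)%N, (j <= k)%N &
    forall l, (i <= l)%N -> (l <= k)%N -> a l <= a j].
Proof.
elim: k => [|k ih].
  rewrite leqn0 => /eqP ->; exists 0%N; split => // l _.
  by rewrite leqn0 => /eqP ->.
rewrite leq_eqVlt => /predU1P[->|].
  by exists k.+1; split => // l h1 h2; rewrite (@anti_leq l k.+1)// h1 h2.
rewrite ltnS => /ih[j [ij jk aj]].
have [h|/ltW h] := leP (a k.+1) (a j).
  exists j; split => //; first exact: leqW.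
  move=> l il; rewrite leq_eqVlt => /predU1P[->//|]; rewrite ltnS; exact: aj.
exists k.+1; split => //; first by rewrite (leq_trans ij)// leqW.
move=> l il; rewrite leq_eqVlt => /predU1P[->//|]; rewrite ltnS => lk.
by rewrite (le_trans (aj _ il lk)).
Qed.

(** * Dyadic times *)

Section grid_time.
Context {R : realType}.

Definition dyadic (n i : nat) : R := i%:R / 2 ^+ n.

Lemma dyadic_ge0 n i : 0 <= dyadic n i.
Proof. by rewrite divr_ge0// exprn_ge0. Qed.

Lemma dyadic_le n i j : (dyadic n i <= dyadic n j) = (i <= j)%N.
Proof. by rewrite ler_pM2r ?ler_nat// invr_gt0 exprn_gt0. Qed.

Lemma dyadic0 n : dyadic n 0 = 0.
Proof. by rewrite /dyadic mul0r. Qed.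

Lemma dyadic_scale n m i : (m <= n)%N -> dyadic n (i * 2 ^ (n - m)) =
  dyadic m i.
Proof.
move=> mn; rewrite /dyadic natrM natrX -(subnK mn) exprD addnK invfM.
by rewrite -!mulrA (mulrA (2 ^+ _)) divff ?mul1r// expf_neq0.
Qed.

Lemma dyadicD n i j : dyadic n (i + j) = dyadic n i + dyadic n j.
Proof. by rewrite /dyadic natrD mulrDl. Qed.

Lemma dyadic1 n : dyadic n 1 = (2 ^+ n)^-1.
Proof. by rewrite /dyadic mul1r. Qed.

Lemma inv_exp2_gt0 n : 0 < (2 ^+ n : R)^-1.
Proof. by rewrite invr_gt0 exprn_gt0. Qed.

Lemma inv_exp2_le m n : (m <= n)%N -> (2 ^+ n : R)^-1 <= (2 ^+ m)^-1.
Proof.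
move=> mn; rewrite lef_pV2 ?posrE ?exprn_gt0//.
by rewrite ler_weXn2l// ler1n.
Qed.

Lemma inv_exp2S m : (2 ^+ m.+1 : R)^-1 + (2 ^+ m.+1)^-1 = (2 ^+ m)^-1.
Proof.
by rewrite exprS; field; rewrite expf_neq0.
Qed.

Lemma cvg0_small (rho : nat -> R) (c e : R) : rho n @[n --> \oo] --> 0 ->
  0 <= c -> 0 < e -> exists N, forall n, (N <= n)%N -> rho n * c < e.
Proof.
move=> r0 c0 e0; have c1 : 0 < c + 1 by rewrite ltr_wpDl.
have /cvgrPdist_lt /(_ (e / (c + 1))) := r0.
rewrite divr_gt0// => /(_ isT) [N _ HN]; exists N => n Nn.
have := HN n Nn; rewrite /= sub0r normrN => h.
apply: (@le_lt_trans _ _ (`|rho n| * (c + 1))); last by rewrite -ltr_pdivlMr.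
apply: (@le_trans _ _ (`|rho n| * c)); first by rewrite ler_wpM2r// ler_norm.
by rewrite ler_wpM2l// lerDl.
Qed.

End grid_time.

Lemma modulus_bound {R : realType} (f : R -> R) (N : nat) (b : R) :
  f 0 = 0 -> 0 <= b ->
  (forall u v, 0 <= u <= N%:R -> 0 <= v <= N%:R -> `|u - v| <= 1 ->
     `|f u - f v| <= b) ->
  forall u, 0 <= u <= N%:R -> `|f u| <= N%:R * b.
Proof.
move=> f0 b0 Hf.
suff key k : (k <= N)%N -> forall u, 0 <= u <= k%:R -> `|f u| <= k%:R * b.
  exact: key.
elim: k => [_ v|k ih kN v /andP[v0 vk]].
  by rewrite -eq_le => /eqP <-; rewrite f0 normr0 mul0r.
have vN : 0 <= v <= N%:R by rewrite v0 (le_trans vk)// ler_nat.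
have [v1|v1] := leP v 1.
  have := Hf v 0 vN; rewrite f0 !subr0 lexx ler0n ger0_norm// => /(_ isT v1) H.
  by apply: (le_trans H); rewrite -natr1 mulrDl mul1r lerDr mulr_ge0.
have vN' : 0 <= v - 1 <= N%:R by case/andP: vN => ? ?; apply/andP; split; lra.
have := Hf v (v - 1) vN vN'.
rewrite opprB addrC subrK normr1 => /(_ (lexx 1)) H.
have {}ih : `|f (v - 1)| <= k%:R * b.
  apply: ih; first exact: ltnW.
  by move: vk; rewrite -natr1 => ?; apply/andP; split; lra.
rewrite -natr1 mulrDl mul1r.
have := ler_normD (f v - f (v - 1)) (f (v - 1)).
by rewrite subrK; lra.
Qed.

(** * Uniform estimates for the grid solutions *)

Section estimates.
Context {d : measure_display} {T : measurableType d} {R : realType}.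
Variables (P : probability T R) (Z : T -> R) (g : R -> R) (W : R -> T -> R).
Hypothesis mZ : measurable_fun setT Z.
Hypothesis Z1 : forall w, 1 <= Z w.
Hypothesis iZ : P.-integrable setT (fun w => (expR (Z w ^+ 2))%:E).
Hypothesis adm : admissible g.
Hypothesis reg : regular_process P Z W.

Local Notation dyadic := (@dyadic R).
Local Notation mean := (mean P).
Local Notation dominated := (dominated Z).
Local Notation lin_dominated := (lin_dominated Z).

Let Z0 w : 0 <= Z w. Proof. by rewrite (le_trans _ (Z1 w)). Qed.

Let ez := mean Z.
Let lZ : lin_dominated Z. Proof. exact: lin_Z. Qed.
Let dZ : dominated Z. Proof. exact: lin_dom. Qed.
Let ez0 : 0 <= ez. Proof. exact: mean_ge0. Qed.

Lemma process_bound (N : nat) : exists2 B : R, 0 <= B &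
  forall u w, 0 <= u <= N%:R -> `|W u w| <= B * Z w.
Proof.
have [rho [_ rho0 Hr]] := rp_modulus reg N.
exists (N%:R * rho 0%N) => [|u w uN]; first by rewrite mulr_ge0.
rewrite -mulrA; apply: (@modulus_bound _ (W ^~ w)) => //.
- exact: (rp_start reg).
- by rewrite mulr_ge0.
- by move=> s t sN tN st; apply: Hr => //; rewrite expr0 invr1.
Qed.

Lemma process_lin t : 0 <= t -> lin_dominated (W t).
Proof.
move=> t0; split; first exact: rp_measurable reg t.
have [B _ HB] := process_bound (Num.truncn t).+1.
exists B => w; apply: HB; rewrite t0/= ltW//; exact: truncnS_gt.
Qed.

Definition grid_process (n i : nat) : T -> R := W (dyadic n i).

Let V0 n w : grid_process n 0 w = 0.
Proof. by rewrite /grid_process dyadic0 (rp_start reg). Qed.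
Let lV n i : lin_dominated (grid_process n i).
Proof. by apply: process_lin; exact: dyadic_ge0. Qed.
Let EV n i : mean (grid_process n i) = 0.
Proof. by apply: (rp_mean reg); exact: dyadic_ge0. Qed.
Let HV n i (A c : R) : 0 <= A -> 0 < c ->
    Num.min A c / 2 <= mean (fun w => Num.min
      (Num.max (A - grid_process n i w) 0) c).
Proof. by apply: (rp_lower reg); exact: dyadic_ge0. Qed.

Definition grid_level (n : nat) := step_level P g (grid_process n).
Definition grid_max (n : nat) := step_max P g (grid_process n).
Let grid_slack (n : nat) := step_slack P g (grid_process n).

Lemma grid_level0 n : grid_level n 0 = 0. Proof. by []. Qed.

Let incr n i j (U : T -> R) : (i <= j)%N -> lin_dominated U ->
  (forall w, 0 <= U w) ->
  (forall l w, (i <= l)%N -> (l <= j)%N -> grid_process n i w - grid_process n l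
    w <= U w) ->
  (forall l, (i <= l)%N -> (l <= j)%N -> grid_level n l <= grid_level n j) ->
  mean (fun w => Num.min (grid_level n j - grid_level n i) (grid_slack n i w)) +
  mean (fun w => step_gap P g (grid_process n) j w - step_gap P g
    (grid_process n) i w) <= mean U.
Proof. exact: (@scheme_increment _ _ _ P Z g mZ Z1 iZ adm _ (lV n) (EV n)
  (@HV n) i j U). Qed.

Let min_dom n i A : dominated (fun w => Num.min A (grid_slack n i w)).
Proof.
apply: lin_dom => //; apply: lin_min; first exact: lin_cst.
exact: step_slack_lin.
Qed.

Let step_gapB_ge0 n i j : (i <= j)%N ->
  0 <= mean (fun w => step_gap P g (grid_process n) j w - step_gap P g
    (grid_process n) i w).
Proof. by move=> ij; apply: mean_ge0 => w; rewrite subr_ge0;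
  exact: step_gap_mono. Qed.

(** The slack at time 0 is 0, so [scheme_increment] only bounds the mean of [step_gap]. The running
    maximum at [j] is at least the positive part of [a_j - W], so by the gap condition and
    [rp_lower] this mean is at least [eta * Num.min a_j y0 / 2]. *)
Lemma start_bound (e : R) : 0 < e -> exists m0, forall m n i, (m0 <= m)%N ->
  dyadic n i <= (2 ^+ m : R)^-1 -> grid_level n i <= e.
Proof.
move=> e0; have [eta [y0 [eta0 y00 gap]]] := adm_gap adm.
have [rho [rc rho0 Hr]] := rp_modulus reg 1.
have [|m0 Hm] := @cvg0_small _ rho ez (eta * Num.min e y0 / 2) rc ez0.
  by rewrite divr_gt0// mulr_gt0// lt_min e0.
exists m0 => m n i mm ti.
have [j [_ ji aj]] := @seq_argmax _ (grid_level n) 0 i (leq0n _).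
apply: (le_trans (aj i _ _)) => //.
have aj0 : 0 <= grid_level n j by rewrite -(grid_level0 n) aj.
have dyadic_itv l : (l <= j)%N -> 0 <= dyadic n l <= (2 ^+ m : R)^-1.
  move=> lj; rewrite dyadic_ge0/= (le_trans _ ti)// dyadic_le (leq_trans lj)//.
have m1 : (2 ^+ m : R)^-1 <= 1 by rewrite -[leRHS](@invr1 R) (@inv_exp2_le _ 0).
have := @incr n 0 j (fun w => rho m * Z w) (leq0n _).
rewrite (meanZ iZ)//.
have -> : mean (fun w => Num.min (grid_level n j - grid_level n 0)
  (grid_slack n 0 w)) = 0.
  rewrite (@eq_mean _ _ _ _ _ (fun=> 0)) ?mean_cst// => w.
  by rewrite grid_level0 subr0 /grid_slack /step_slack V0 subrr addr0;
    apply/min_idPr.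
rewrite add0r => /(_ _ _ _ _) H.
have {}H : mean (fun w => step_gap P g (grid_process n) j w - step_gap P g
  (grid_process n) 0 w) <= rho m * ez.
  apply: H.
  - exact: linZ.
  - by move=> w; rewrite mulr_ge0.
  - move=> l w _ lj; rewrite V0; have /andP[t1 t2] := dyadic_itv _ lj.
    have := @Hr m 0 (dyadic n l) w; rewrite lexx ler01 t1 (le_trans t2)//=
      (rp_start reg).
    by rewrite sub0r normrN ger0_norm// => /(_ isT isT t2); rewrite sub0r;
      apply: le_trans; rewrite /grid_process ler_norm.
  - by move=> l _ lj; apply: aj => //; rewrite (leq_trans lj).
have low : eta * (Num.min (grid_level n j) y0 / 2) <=
    mean (fun w => step_gap P g (grid_process n) j w - step_gap P g
      (grid_process n) 0 w).
  apply: (@le_trans _ _ (mean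
    (fun w => eta * Num.min (Num.max (grid_level n j - grid_process n j w) 0)
      y0))).
    rewrite (meanZ iZ); first by rewrite ler_wpM2l ?(ltW eta0)// HV.
    apply: lin_dom => //; apply: lin_min; last exact: lin_cst.
    by apply: lin_max; [apply: linB => //; exact: lin_cst|exact: lin_cst].
  apply: (mean_le iZ).
  - apply: domZ; apply: lin_dom => //; apply: lin_min; last exact: lin_cst.
    by apply: lin_max; [apply: linB => //; exact: lin_cst|exact: lin_cst].
  - by apply: domB; exact: step_gap_dom.
  move=> w; have Mj0 : 0 <= grid_max n j w by exact: step_max_ge0.
  have Mj : grid_level n j - grid_process n j w <= grid_max n j w
    by exact: step_max_ge.
  have -> : step_gap P g (grid_process n) 0 w = 0.
    by rewrite /step_gap /step_max/= (adm_le0 adm (lexx 0)) subr0.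
  have := gap _ Mj0; rewrite subr0 /step_gap.
  apply: le_trans; rewrite ler_wpM2l ?(ltW eta0)//.
  by rewrite le_min !ge_min lexx orbT andbT ge_max Mj Mj0.
(* After division by [eta / 2] this reads [Num.min a_j y0 < Num.min e y0], which excludes the value
   [y0] on the left and gives [a_j < e]. *)
have := le_lt_trans (le_trans low H) (Hm _ mm).
rewrite -mulrA ltr_pM2l// ltr_pM2r// lt_min !gt_min ltxx orbF => /andP[].
by case/orP => h1 h2; lra.
Qed.

(** From a fixed time [s0] on the mean slack is at least [p]: this holds at [s0], where the level is
    at most 1, and the mean slack is nondecreasing. Over a window so short that the bound on the
    oscillation of [W] has mean at most [p / 2], the maximal level rises by at most a constant [Bs];
    finitely many windows cover [[0, N]]. *)
Lemma upper_bound (N : nat) : exists C n0, 0 <= C /\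
  forall n i, (n0 <= n)%N -> dyadic n i <= N%:R :> R -> grid_level n i <= C.
Proof.
have [m Hm] := start_bound ltr01.
pose s0 : R := (2 ^+ m)^-1.
have s00 : 0 < s0 by exact: inv_exp2_gt0.
have s01 : s0 <= 1 by rewrite -[leRHS](@invr1 R) (@inv_exp2_le _ 0).
have [p p0 Hp] := rp_upper reg 1 1 s00.
have EX n i : (m <= n)%N -> s0 <= dyadic n i -> p <= mean (grid_slack n i).
  move=> mn si; pose i0 := (1 * 2 ^ (n - m))%N.
  have ti0 : dyadic n i0 = s0 by rewrite /i0 dyadic_scale// dyadic1.
  have i0i : (i0 <= i)%N by rewrite -(@dyadic_le R n) ti0.
  apply: (@le_trans _ _ (mean (grid_slack n i0)));
    last exact: (mean_step_slack_mono mZ Z1 iZ adm (lV n) (EV n) (@HV n)).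
  apply: (le_trans (Hp s0 _)); first by rewrite lexx.
  apply: (mean_le iZ).
  - apply: lin_dom => //; apply: lin_min; last exact: lin_cst.
    apply: lin_max; last exact: lin_cst.
    by apply: linB; [exact: process_lin (ltW s00)|exact: lin_cst].
  - by apply: lin_dom => //; exact: step_slack_lin.
  move=> w; rewrite ge_min ge_max; apply/orP; left; apply/andP; split.
    have : grid_process n i0 w - grid_level n i0 <= grid_slack n i0 w
      by exact: step_slack_geV.
    rewrite /grid_process ti0; apply: le_trans; rewrite lerD2l lerN2.
    by apply: (Hm m) => //; rewrite ti0.
  exact: (@step_slack_ge0 _ _ _ P g (grid_process n) (V0 n)).
have [rho [rc rho0 Hr]] := rp_modulus reg N.
have [m1 Hm1] := cvg0_small rc ez0 (divr_gt0 p0 (ltr0Sn R 1)).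
have [B B0 HB] := process_bound N.
pose Q := mean (fun w => (2 * B * Z w) ^+ 2).
have lY : lin_dominated (fun w => 2 * B * Z w) by exact: linZ.
have Q0 : 0 <= Q by apply: mean_ge0 => w; exact: sqr_ge0.
(* If the maximal level rises by [b], then [p <= E X <= p / 2 + Q / (4 * b)] for the slack [X],
   hence [b <= Q / (2 * p)]. *)
pose Bs := Q / (2 * p).
have Bs0 : 0 <= Bs by rewrite divr_ge0// mulr_ge0// ltW.
have step n i k C0 : (m <= n)%N -> s0 <= dyadic n i -> (i <= k)%N ->
    dyadic n k <= N%:R -> dyadic n k - dyadic n i <= (2 ^+ m1)^-1 ->
    (forall l, (l <= i)%N -> grid_level n l <= C0) ->
    forall l, (l <= k)%N -> grid_level n l <= C0 + Bs.
  move=> mn si ik kN gap HC l lk.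
  have [j [_ jk aj]] := @seq_argmax _ (grid_level n) 0 k (leq0n _).
  apply: (le_trans (aj l _ _)) => //.
  have [ji|ij] := leqP j i; first by rewrite (le_trans (HC _ ji))// lerDl.
  (* [r] is a maximum before the window, [j] one up to its end, and [b] is the rise. The slack at
     [i] is at most [a_r - a_i + 2 * B * Z], so its part beyond [a_j - a_i] is at most
     [2 * B * Z - b], hence at most [(2 * B * Z) ^+ 2 / (4 * b)]. *)
  have [r [_ ri ar]] := @seq_argmax _ (grid_level n) 0 i (leq0n _).
  apply: (@le_trans _ _ (grid_level n r + Bs)); last by rewrite lerD2r HC.
  rewrite -lerBlDl; set b := _ - _.
  have [b0|b0] := leP b 0; first exact: le_trans b0 Bs0.
  have tmN q : (q <= j)%N -> 0 <= dyadic n q <= N%:R.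
    by move=> qj; rewrite dyadic_ge0/= (le_trans _ kN)// dyadic_le
      (leq_trans qj).
  have := @incr n i j (fun w => rho m1 * Z w) (ltnW ij).
  move=> /(_ _ _ _ _) H.
  have {}H : mean (fun w => Num.min (grid_level n j - grid_level n i)
    (grid_slack n i w)) <= p / 2.
    apply: (@le_trans _ _ (mean (fun w => rho m1 * Z w))); last first.
      by rewrite (meanZ iZ)// ltW// Hm1.
    apply: le_trans (H _ _ _ _).
    - by rewrite lerDl step_gapB_ge0// ltnW.
    - exact: linZ.
    - by move=> w; rewrite mulr_ge0.
    - move=> q w iq qj; rewrite (le_trans (ler_norm _))//; apply: Hr.
      + by apply: tmN; exact: ltnW.
      + exact: tmN.
      + rewrite distrC ger0_norm ?subr_ge0 ?dyadic_le// (le_trans _ gap)//.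
        by rewrite lerD2r dyadic_le (leq_trans qj).
    - by move=> q _ qj; apply: aj => //; rewrite (leq_trans qj).
  have Y2 : mean (grid_slack n i) <=
    mean (fun w => Num.min (grid_level n j - grid_level n i)
      (grid_slack n i w) +
      (4 * b)^-1 * (2 * B * Z w) ^+ 2).
    apply: (mean_le iZ).
    - by apply: lin_dom => //; exact: step_slack_lin.
    - by apply: domD => //; apply: domZ; exact: lin_sqr_dom.
    move=> w.
    have Xb : grid_slack n i w <= grid_level n r - grid_level n i + 2 * B * Z w.
      have Mb : grid_max n i w <= grid_level n r + B * Z w.
        apply: (@step_max_le _ _ _ P g (grid_process n) 0 i w) => //.
          by rewrite addr_ge0 ?mulr_ge0// -(grid_level0 n) ar.
        move=> q _ qi; apply: lerD; first exact: ar.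
        rewrite (le_trans (ler_norm _))// normrN; apply: HB; apply: tmN.
        by rewrite (leq_trans qi)// ltnW.
      have := HB (dyadic n i) w (tmN _ (ltnW ij)).
      have := ler_norm (W (dyadic n i) w).
      by move: Mb; rewrite /grid_slack /step_slack /grid_max /grid_process
        -/(grid_level n); lra.
    have sq : grid_slack n i w - (grid_level n j - grid_level n i) <=
      (4 * b)^-1 * (2 * B * Z w) ^+ 2.
      apply: (@le_trans _ _ (2 * B * Z w - b)); first by rewrite /b; lra.
      rewrite -subr_ge0 (_ : _ - _ = (4 * b)^-1 * (2 * B * Z w - 2 * b) ^+ 2).
        by rewrite mulr_ge0 ?sqr_ge0// invr_ge0 mulr_ge0// ltW.
      by field; rewrite gt_eqF.
    have : 0 <= (4 * b)^-1 * (2 * B * Z w) ^+ 2.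
      by rewrite mulr_ge0 ?sqr_ge0// invr_ge0 mulr_ge0// ltW.
    by case: (leP (grid_level n j - grid_level n i)) => _ ?; lra.
  have EQ : mean (fun w => (4 * b)^-1 * (2 * B * Z w) ^+ 2) = (4 * b)^-1 * Q.
    by apply: (@meanZ _ _ _ P Z iZ _ (fun w => (2 * B * Z w) ^+ 2));
      exact: lin_sqr_dom.
  have dQ : dominated (fun w => (4 * b)^-1 * (2 * B * Z w) ^+ 2).
    by apply: domZ; exact: lin_sqr_dom.
  have := meanD iZ (@min_dom n i (grid_level n j - grid_level n i)) dQ;
    rewrite EQ => Y3.
  have pQ : p / 2 <= (4 * b)^-1 * Q.
    by have := EX n i mn si; move: Y2; rewrite Y3; lra.
  rewrite /Bs ler_pdivlMr; last by rewrite mulr_gt0.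
  move: pQ; rewrite (mulrC (4 * b)^-1) ler_pdivlMr; last by rewrite mulr_gt0.
  lra.
have iter q n i : (m <= n)%N -> (m1 <= n)%N ->
  dyadic n i <= s0 + q%:R * (2 ^+ m1)^-1 ->
    dyadic n i <= N%:R -> grid_level n i <= 1 + q%:R * Bs.
  move=> mn m1n; elim: q i => [|q ih] i.
    by rewrite !mul0r !addr0 => iS _; exact: (Hm m).
  (* [i'] is the index of the time at which [q] windows after [s0] have passed; this is a grid time
     because [n] is at least [m] and [m1]. *)
  move=> iq iN; pose i' := (1 * 2 ^ (n - m) + q * 2 ^ (n - m1))%N.
  have ti' : dyadic n i' = s0 + q%:R * (2 ^+ m1)^-1.
    by rewrite dyadicD !dyadic_scale// dyadic1.
  have [ii'|i'i] := leqP i i'.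
    rewrite (le_trans (ih i _ _))// -?ti' ?dyadic_le//.
    by rewrite lerD2l ler_wpM2r// ler_nat.
  rewrite -natr1 mulrDl mul1r addrA.
  apply: (step n i' i) => //.
  - by rewrite ti' lerDl mulr_ge0// ltW// inv_exp2_gt0.
  - exact: ltnW.
  - by rewrite ti'; move: iq; rewrite -natr1 mulrDl mul1r; lra.
  - move=> l li'; apply: ih; first by rewrite -ti' dyadic_le.
    by rewrite (le_trans _ iN)// dyadic_le (leq_trans li')// ltnW.
exists (1 + (N * 2 ^ m1)%:R * Bs), (maxn m m1); split.
  by rewrite addr_ge0// mulr_ge0.
move=> n i; rewrite geq_max => /andP[mn m1n] iN; apply: iter => //.
rewrite (le_trans iN)// natrM natrX mulfK ?expf_neq0// lerDr ltW//.
Qed.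

(** Turns one-sided information into a two-sided estimate: upper bounds on the levels bound the
    increments of the nondecreasing [M], and [a = E g(M)] with the growth of [g] then bounds the
    change of level in absolute value. *)
Lemma diff_bound (C : R) : exists2 K : R, 0 <= K &
  forall n i i' c, (i <= i')%N -> (forall w, grid_max n i' w <= C * Z w) ->
    (forall w, grid_max n i' w - grid_max n i w <= c * Z w) ->
    `|grid_level n i' - grid_level n i| <= K * c.
Proof.
have [D HD] := adm_growth adm C.
have dE : dominated (fun w => expR (Z w ^+ 2)).
  split; last by exists 1 => w; rewrite mul1r ger0_norm ?expR_ge0.
  by apply: measurableT_comp => //; exact: measurable_funX.
exists (`|D| * mean (fun w => expR (Z w ^+ 2))).
  by rewrite mulr_ge0// mean_ge0// => w; exact: expR_ge0.
move=> n i i' c ii' MC Mc.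
have dg l : dominated (fun w => g (grid_max n l w)) by apply: adm_dom => //;
  exact: step_max_lin.
have -> : grid_level n i' - grid_level n i =
  mean (fun w => g (grid_max n i' w) - g (grid_max n i w)).
  by rewrite (meanB iZ (dg i') (dg i)) /grid_level
    !(step_level_eq mZ Z1 iZ adm (lV n) (EV n) (@HV n)).
apply: (le_trans (mean_norm iZ (domB (dg i') (dg i)))).
rewrite mulrAC -(meanZ iZ)//.
have K1 w : `|g (grid_max n i' w) - g (grid_max n i w)| <= `|D| * c * expR
  (Z w ^+ 2).
  have MM : grid_max n i w <= grid_max n i' w by exact: step_max_mono.
  have M0 : 0 <= grid_max n i w by exact: step_max_ge0.
  apply: (le_trans (HD _ _ _ M0 MM (Z1 w) (MC w))).
  have c0 : 0 <= c * Z w by apply: le_trans (Mc w); rewrite subr_ge0.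
  have c0' : 0 <= c by move: c0; rewrite pmulr_lge0// (lt_le_trans ltr01).
  apply: (@le_trans _ _ (`|D| * expR (Z w ^+ 2 / 2) * (grid_max n i'
    w - grid_max n i w))).
    by rewrite ler_wpM2r ?subr_ge0// ler_wpM2r ?expR_ge0// ler_norm.
  apply: (@le_trans _ _ (`|D| * expR
    (Z w ^+ 2 / 2) * (c * expR (Z w ^+ 2 / 2)))).
    rewrite ler_wpM2l ?mulr_ge0 ?expR_ge0//.
    by rewrite (le_trans (Mc w))// ler_wpM2l// Z_le_exp_half.
  by rewrite -(exp_halfM Z w) le_eqVlt; apply/orP; left; apply/eqP; ring.
have dd : dominated (fun w => `|D| * c * expR (Z w ^+ 2)) by exact: domZ.
apply: (mean_le iZ) => //.
apply: (dom_le _ dd) => [|w]; last by rewrite normr_id.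
by apply: measurableT_comp => //; case: (domB (dg i') (dg i)).
Qed.

Lemma grid_process0 n w : grid_process n 0 w = 0. Proof. exact: V0. Qed.

Lemma grid_level_eq n i : grid_level n i = mean (fun w => g (grid_max n i w)).
Proof. exact: (step_level_eq mZ Z1 iZ adm (lV n) (EV n) (@HV n)). Qed.

Lemma grid_max_measurable n i : measurable_fun setT (grid_max n i).
Proof. by have [] := step_max_lin P g Z1 (lV n) i. Qed.

Lemma grid_max_bound (N : nat) (C B : R) n i w : 0 <= C -> 0 <= B ->
  (forall u w, 0 <= u <= N%:R -> `|W u w| <= B * Z w) ->
    dyadic n i <= N%:R :> R ->
  (forall l, (l <= i)%N -> grid_level n l <= C) -> grid_max n i w <= C +
    B * Z w.
Proof.
move=> C0 B0 HB iN HC; apply: (@step_max_le _ _ _ P g (grid_process n) 0 i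
  w) => //.
  by rewrite addr_ge0// mulr_ge0.
move=> q _ qi; apply: lerD; first exact: HC.
rewrite (le_trans (ler_norm _))// normrN; apply: HB.
by rewrite dyadic_ge0/= (le_trans _ iN)// dyadic_le.
Qed.

(** Comparison with index 0, where both the maximum and the level vanish. *)
Lemma scheme_bounded (N : nat) : exists C n0, 0 <= C /\
  forall n i, (n0 <= n)%N -> dyadic n i <= N%:R :> R -> `|grid_level n i| <= C.
Proof.
have [C [n0 [C0 HC]]] := upper_bound N.
have [B B0 HB] := process_bound N.
have [K K0 HK] := diff_bound (C + B).
exists (K * (C + B)), n0; split; first by rewrite mulr_ge0// addr_ge0.
move=> n i nn iN; rewrite -[grid_level n i]subr0 -(grid_level0 n).
have MC w : grid_max n i w <= (C + B) * Z w.
  rewrite (le_trans (grid_max_bound w C0 B0 HB iN _))//.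
    move=> l li; apply: HC => //; by rewrite (le_trans _ iN)// dyadic_le.
  by rewrite mulrDl lerD2r ler_peMr.
by apply: HK => // w; rewrite subr0.
Qed.

(** Two regimes. Close to time 0 both levels are small, by [start_bound] and [diff_bound]. Later the
    slack is at least [W - C], whose clipping to [[0, 1]] has mean at least [p]; so
    [p * Num.min A 1] is at most the mean of [Num.min A X], and [scheme_increment] makes the rise
    [A] small. *)
Lemma scheme_equicontinuous (N : nat) (e : R) : 0 < e -> exists m n0,
  forall n i i', (n0 <= n)%N -> (i <= i')%N -> dyadic n i' <= N%:R :> R ->
    dyadic n i' - dyadic n i <= (2 ^+ m : R)^-1 ->
      `|grid_level n i' - grid_level n i| <= e.
Proof.
move=> e0.
have [C [n0 [C0 HC]]] := upper_bound N.
have [B B0 HB] := process_bound N.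
have [K K0 HK] := diff_bound (C + B).
have [rho [rc rho0 Hr]] := rp_modulus reg N.
have MC n i w : (n0 <= n)%N -> dyadic n i <= N%:R :> R ->
  grid_max n i w <= (C + B) * Z w.
  move=> nn iN; rewrite (le_trans (grid_max_bound w C0 B0 HB iN _))//.
    by move=> l li; apply: HC => //; rewrite (le_trans _ iN)// dyadic_le.
  by rewrite mulrDl lerD2r ler_peMr.
(* The cap [1 / 2] makes [Num.min A 1 < e1] imply [A < e1]; the other term gives [K * e1 <= e / 4],
   with [K + 1] because [K] may be 0. *)
pose e1 := Num.min (1 / 2) (e / (4 * (K + 1))).
have K1 : 0 < K + 1 by rewrite ltr_wpDl.
have e10 : 0 < e1 by rewrite lt_min !divr_gt0// mulr_gt0.
have e1h : e1 <= 1 / 2 by rewrite ge_min lexx.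
have Ke1 : K * e1 <= e / 4.
  apply: (@le_trans _ _ ((K + 1) * (e / (4 * (K + 1))))).
    by apply: ler_pM => //; rewrite ?(ltW e10) ?lerDl// ge_min lexx orbT.
  by rewrite le_eqVlt; apply/orP; left; apply/eqP; field; rewrite gt_eqF.
have [k1 Hk1] := start_bound e10.
have e4 : 0 < e / 4 by rewrite divr_gt0.
have [k2 Hk2] := cvg0_small rc K0 e4.
pose m2 := maxn k1 k2.
have start n i : (n0 <= n)%N -> dyadic n i <= N%:R :> R ->
  dyadic n i <= (2 ^+ m2)^-1 ->
    `|grid_level n i| <= e / 2.
  move=> nn iN im; rewrite -[grid_level n i]subr0 -(grid_level0 n).
  have h : K * (e1 + rho m2) <= e / 2.
    rewrite mulrDr (mulrC K (rho _)).
    by have := Hk2 m2 (leq_maxr _ _); lra.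
  apply: (le_trans _ h); apply: HK => // w; first exact: MC.
  rewrite subr0 mulrDl.
  apply: (@step_max_le _ _ _ P g (grid_process n) 0 i w) => //.
    by rewrite addr_ge0 ?mulr_ge0// ltW.
  move=> q _ qi; have qm : dyadic n q <= (2 ^+ m2 : R)^-1.
    by rewrite (le_trans _ im)// dyadic_le.
  apply: lerD.
    apply: (@le_trans _ _ e1); last by rewrite ler_peMr// ltW.
    by apply: (Hk1 m2) => //; exact: leq_maxl.
  have := @Hr m2 (dyadic n q) 0 w; rewrite (rp_start reg) !subr0 dyadic_ge0/=
    lexx/=.
  rewrite ler0n (le_trans _ iN) ?dyadic_le// ger0_norm ?dyadic_ge0//.
  move=> /(_ isT isT qm); apply: le_trans.
  by rewrite -normrN ler_norm.
(* The scale is [m2.+1] rather than [m2], so that an interval of at most this length which starts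
   before [(2 ^+ m2.+1)^-1] ends before [(2 ^+ m2)^-1], where [start] applies. *)
have [p p0 Hp] := rp_upper reg C N (@inv_exp2_gt0 R m2.+1).
have [k3 Hk3] := cvg0_small rc ez0 (mulr_gt0 p0 e10).
pose m3 := maxn m2.+1 (maxn k3 k2).
have m3K : rho m3 * K < e / 4.
  by apply: Hk2; rewrite /m3 !leq_max leqnn !orbT.
have m3p : rho m3 * ez < p * e1.
  by apply: Hk3; rewrite /m3 !leq_max leqnn !orbT.
have m23 : (m2.+1 <= m3)%N by exact: leq_maxl.
exists m3, n0 => n i i' nn ii' iN gap.
have tii : dyadic n i <= dyadic n i' :> R by rewrite dyadic_le.
have [is1|is1] := leP (dyadic n i) ((2 ^+ m2.+1)^-1 : R).
  have h1 : dyadic n i' <= (2 ^+ m2 : R)^-1.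
    by have := @inv_exp2_le R _ _ m23; have := @inv_exp2S R m2; lra.
  have := start n i' nn iN h1; have := start n i nn (le_trans tii iN)
    (le_trans tii h1).
  by have := ler_normB (grid_level n i') (grid_level n i); lra.
have [j [ij ji' aj]] := seq_argmax (grid_level n) ii'.
have A0 : 0 <= grid_level n j - grid_level n i by rewrite subr_ge0 aj.
have tmN q : (q <= i')%N -> 0 <= dyadic n q <= N%:R.
  by move=> qj; rewrite dyadic_ge0/= (le_trans _ iN)// dyadic_le.
have Wi q w : (i <= q)%N -> (q <= i')%N -> grid_process n i w - grid_process n q
  w <= rho m3 * Z w.
  move=> iq qi'; rewrite (le_trans (ler_norm _))//; apply: Hr.
  - exact: tmN.
  - exact: tmN.
  - rewrite distrC ger0_norm ?subr_ge0 ?dyadic_le// (le_trans _ gap)//.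
    by rewrite lerD2r dyadic_le.
have H : mean (fun w => Num.min (grid_level n j - grid_level n i)
  (grid_slack n i w)) <= rho m3 * ez.
  rewrite -(meanZ iZ)//; apply: le_trans (@incr n i j _ ij _ _ _ _).
  - by rewrite lerDl step_gapB_ge0.
  - exact: linZ.
  - by move=> w; rewrite mulr_ge0.
  - by move=> q w iq qj; apply: Wi => //; rewrite (leq_trans qj).
  - by move=> q iq qj; apply: aj => //; rewrite (leq_trans qj).
have low : Num.min (grid_level n j - grid_level n i) 1 * p <=
    mean (fun w => Num.min (grid_level n j - grid_level n i)
      (grid_slack n i w)).
  set A := grid_level n j - grid_level n i.
  pose x w := Num.min (Num.max (grid_process n i w - C) 0) 1.
  have dx : dominated x.
    apply: lin_dom => //; apply: lin_min; last exact: lin_cst.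
    apply: lin_max; last exact: lin_cst.
    by apply: linB => //; exact: lin_cst.
  have A1 : 0 <= Num.min A 1 by rewrite le_min A0 ler01.
  apply: (@le_trans _ _ (mean (fun w => Num.min A 1 * x w))).
    rewrite (meanZ iZ)// ler_wpM2l//; apply: Hp.
    by rewrite (ltW is1)/= (le_trans tii).
  apply: (mean_le iZ) => //; first exact: domZ.
  move=> w.
  have x0 : 0 <= x w by rewrite le_min le_max lexx orbT ler01.
  have x1 : x w <= 1 by rewrite ge_min lexx orbT.
  have xX : x w <= grid_slack n i w.
    rewrite ge_min; apply/orP; left; rewrite ge_max; apply/andP; split.
      apply: le_trans (@step_slack_geV _ _ _ P g (grid_process n) i w);
        rewrite lerD2l lerN2.
      by apply: HC => //; rewrite (le_trans tii).
    exact: (@step_slack_ge0 _ _ _ P g (grid_process n) (V0 n)).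
  rewrite le_min; apply/andP; split.
    apply: (@le_trans _ _ (Num.min A 1)); first by rewrite ler_piMr.
    by rewrite ge_min lexx.
  apply: (le_trans _ xX); rewrite ler_piMl//.
  by rewrite ge_min lexx orbT.
have Ae : grid_level n j - grid_level n i <= e1.
  have := le_lt_trans (le_trans low H) m3p.
  rewrite [X in X < _]mulrC ltr_pM2l// gt_min => /orP[/ltW//|].
  by move=> h; lra.
have h : K * (e1 + rho m3) <= e.
  by rewrite mulrDr (mulrC K (rho _)); lra.
apply: (le_trans _ h); apply: HK => // w; first exact: MC.
rewrite lerBlDl; apply: (@step_max_le _ _ _ P g (grid_process n) i i' w) => //.
  by rewrite lerDl mulr_ge0// addr_ge0// ltW.
move=> q iq qi'.
have : grid_level n i - grid_process n i w <= grid_max n i w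
  by exact: step_max_ge.
have := Wi q w (ltnW iq) qi'; have := aj q (ltnW iq) qi'.
have : e1 <= e1 * Z w by rewrite ler_peMr// ltW.
by rewrite mulrDl; lra.
Qed.

End estimates.

(** * Passage to the limit *)

Definition rmax {R : realType} (h : R -> R) (t : R) : R :=
  sup [set h s | s in `[0, t]].

(** Compactness of the segment gives a cluster point, and an ultrafilter converges to each of its
    cluster points since it contains every set or its complement. *)
Lemma ultra_bounded_cvg {R : realType} {I : Type} (U : set_system I) (u : I ->
  R)
    (C : R) : UltraFilter U -> (\forall n \near U, `|u n| <= C) ->
  exists p : R, u n @[n --> U] --> p.
Proof.
move=> UU uC; have PU : ProperFilter U by exact: ultra_proper.
have [|p [_ clp]] := @segment_compact R (- C) C (u @ U) _.
  by apply: filterS uC => n /=; rewrite in_itv/= ler_norml.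
exists p => V Vp; have [//|UC] := in_ultra_setVsetC (u @^-1` V) UU.
have [|x [/= nVx Vx]] := clp (~` V) V _ Vp; first exact: UC.
by [].
Qed.

Section limit.
Context {d : measure_display} {T : measurableType d} {R : realType}.
Variables (P : probability T R) (Z : T -> R) (g : R -> R) (W : R -> T -> R).
Hypothesis mZ : measurable_fun setT Z.
Hypothesis Z1 : forall w, 1 <= Z w.
Hypothesis iZ : P.-integrable setT (fun w => (expR (Z w ^+ 2))%:E).
Hypothesis adm : admissible g.
Hypothesis reg : regular_process P Z W.

Local Notation dyadic := (@dyadic R).
Local Notation mean := (mean P).

(** [Num.truncn] is 0 on negative reals, so [A n] vanishes at negative times and the limit can be
    continuous on the whole line. *)
Let idx (n : nat) (t : R) : nat := Num.truncn (t * 2 ^+ n).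
Let A n t := grid_level P g W n (idx n t).

Let e2 n : 0 < (2 ^+ n : R). Proof. exact: exprn_gt0. Qed.

Let idx_le n (t : R) (N : nat) : t <= N%:R -> dyadic n (idx n t) <= N%:R.
Proof.
move=> tN; have [t0|t0] := leP 0 t.
  apply: le_trans tN; rewrite /dyadic ler_pdivrMr//.
  by rewrite truncn_le mulr_ge0// ltW.
rewrite /idx (_ : Num.truncn _ = 0%N) ?dyadic0//.
by apply/truncn0Pn; rewrite -ltNge (lt_trans _ ltr01)// nmulr_rlt0.
Qed.

Let idx_ge n (t : R) : t - (2 ^+ n)^-1 <= dyadic n (idx n t).
Proof.
rewrite /dyadic lerBlDr -[X in _ <= _ + X]div1r -mulrDl natr1 ler_pdivlMr//.
by rewrite ltW// truncnS_gt.
Qed.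

Let idx_le_id n (t : R) : 0 <= t -> dyadic n (idx n t) <= t.
Proof.
by move=> t0; rewrite /dyadic ler_pdivrMr// truncn_le mulr_ge0// ltW.
Qed.

Let idx_mono n (s t : R) : s <= t -> (idx n s <= idx n t)%N.
Proof. by move=> st; apply: le_truncn; rewrite ler_pM2r. Qed.

Let idx_dyadic n i : idx n (dyadic n i) = i.
Proof. by rewrite /idx /dyadic divfK ?gt_eqF// natrK. Qed.

Let A_equi (N : nat) (e : R) : 0 < e -> exists m n0, forall n s t,
  (n0 <= n)%N -> s <= t -> t <= N%:R -> t - s <= (2 ^+ m)^-1 ->
  `|A n t - A n s| <= e.
Proof.
move=> e0.
have [m [n0 H]] := scheme_equicontinuous mZ Z1 iZ adm reg N e0.
(* One level finer than [m]: rounding both times down can enlarge the gap by one cell of size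
   [(2 ^+ n)^-1]. *)
exists m.+1, (maxn n0 m.+1) => n s t; rewrite geq_max => /andP[nn nm] st tN gap.
apply: H => //; [exact: idx_mono|exact: idx_le|].
have [t0|t0] := leP 0 t.
  have := idx_ge n s; have := idx_le_id n t0.
  have := @inv_exp2S R m; have := @inv_exp2_le R _ _ nm; lra.
rewrite (_ : idx n t = 0%N); last first.
  by apply/truncn0Pn; rewrite -ltNge (lt_trans _ ltr01)// nmulr_rlt0.
by rewrite dyadic0 sub0r (@le_trans _ _ 0)// oppr_le0 dyadic_ge0.
Qed.

(** The ultrafilter yields limits at all real times at once. Equicontinuity makes the convergence
    uniform on bounded intervals, and then an ordinary sequence of indices can be picked, as
    dominated convergence requires. *)
Let limit_extraction : exists a : R -> R, exists nq : nat -> nat,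
  continuous a /\ forall q, (q <= nq q)%N /\
    forall t, 0 <= t <= q%:R -> `|A (nq q) t - a t| <= q.+1%:R^-1.
Proof.
have [U [UU sU]] := ultraFilterLemma eventually_filter.
have PU : ProperFilter U by exact: ultra_proper.
have Uge n0 : U [set n | (n0 <= n)%N] by apply: sU; exists n0.
have [a Ha] : {a : R -> R & forall t, A n t @[n --> U] --> a t}.
  apply: (@choice _ _ (fun t p => A n t @[n --> U] --> p)) => t.
  have [C [n0 [C0 HC]]] := scheme_bounded mZ Z1 iZ adm reg (Num.truncn t).+1.
  apply: (@ultra_bounded_cvg _ _ U _ C) => //.
  apply: filterS (Uge n0) => n /= nn; apply: HC => //.
  by apply: idx_le; rewrite ltW// truncnS_gt.
have a_equi (N : nat) (e : R) : 0 < e -> exists m, forall s t,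
    s <= t -> t <= N%:R -> t - s <= (2 ^+ m)^-1 -> `|a t - a s| <= e.
  move=> e0; have [m [n0 H]] := A_equi N e0; exists m => s t st tN gap.
  apply: (@cvgr_to_le _ U _ _ (fun n => `|A n t - A n s|)).
    by apply: cvg_norm; apply: cvgB; exact: Ha.
  by apply: filterS (Uge n0) => n /= nn; exact: H.
have unif (N : nat) (e : R) : 0 < e ->
    \forall n \near U, forall t, 0 <= t <= N%:R -> `|A n t - a t| <= e.
  move=> e0; have e3 : 0 < e / 3 by rewrite divr_gt0.
  have [m1 [n0 H1]] := A_equi N e3; have [m2 H2] := a_equi N _ e3.
  pose m := maxn m1 m2.
  (* Finitely many grid points are controlled simultaneously; one third of [e] is spent on them and
     one on each of the two moduli. *)
  have grid K : \forall n \near U, forall k, (k < K)%N ->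
      `|a (dyadic m k) - A n (dyadic m k)| <= e / 3.
    elim: K => [|K ih]; first exact: nearW.
    apply: filterS2 ih (cvgr_dist_le _ _ (Ha (dyadic m K)) _ e3) => n h1 h2 k.
    by rewrite ltnS leq_eqVlt => /predU1P[->//|]; exact: h1.
  apply: filterS2 (grid (N * 2 ^ m).+1) (Uge n0) => n h nn t /andP[t0 tN].
  pose k := idx m t.
  have kt : dyadic m k <= t by exact: idx_le_id.
  have gap : t - dyadic m k <= (2 ^+ m)^-1 by have := idx_ge m t; rewrite -/k;
    lra.
  have kK : (k < (N * 2 ^ m).+1)%N.
    rewrite ltnS -(ler_nat R) natrM natrX -ler_pdivrMr//.
    exact: le_trans kt tN.
  have := h k kK.
  have := H1 n (dyadic m k) t nn kt tN
    (le_trans gap (@inv_exp2_le R _ _ (leq_maxl _ _))).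
  have := H2 (dyadic m k) t kt tN
    (le_trans gap (@inv_exp2_le R _ _ (leq_maxr _ _))).
  have := ler_normD (A n t - A n (dyadic m k))
    (A n (dyadic m k) - a (dyadic m k)).
  have := ler_normD (A n t - A n (dyadic m k) +
    (A n (dyadic m k) - a (dyadic m k)))
    (a (dyadic m k) - a t).
  rewrite (distrC (a (dyadic m k)) (a t)) (distrC (a (dyadic m k)) (A n _)).
  by rewrite (_ : _ + (a (dyadic m k) - a t) = A n t - a t); [lra|ring].
exists a.
have [nq Hnq] : {nq : nat -> nat & forall q, (q <= nq q)%N /\
    forall t, 0 <= t <= q%:R -> `|A (nq q) t - a t| <= q.+1%:R^-1}.
  apply: (@choice _ _ (fun q n => (q <= n)%N /\
    forall t, 0 <= t <= q%:R -> `|A n t - a t| <= q.+1%:R^-1)) => q.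
  have q0 : 0 < (q.+1%:R^-1 : R) by rewrite invr_gt0.
  by have [n [h1 h2]] := filter_ex (filterI (Uge q) (unif q _ q0)); exists n.
exists nq; split => // t.
apply/cvgrPdist_le => e e0.
have [m Hm] := a_equi (Num.truncn t).+2 e e0.
have tN : t + 1 <= (Num.truncn t).+2%:R.
  by rewrite -[X in _ <= X]natr1 lerD2r ltW// truncnS_gt.
near=> s.
have : `|t - s| <= Num.min 1 (2 ^+ m)^-1.
  near: s; apply: cvgr_dist_le; first exact: cvg_id.
  by rewrite lt_min ltr01 inv_exp2_gt0.
rewrite le_min ler_norml => /andP[/andP[h1 h2] h3].
have [st|/ltW ts] := leP s t.
  by apply: Hm => //; [lra|rewrite -(ger0_norm (x := t - s)) ?subr_ge0].
rewrite distrC; apply: Hm => //; first by lra.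
by rewrite -(ger0_norm (x := s - t)) ?subr_ge0// distrC.
Unshelve. all: by end_near. Qed.

(** Above, grid times are times in [[0, t]] at which the level is close to [a]. Below, a
    near-maximiser [s] of [h] is rounded down to the grid; [A n s] is already the level at the
    rounded time, so only [W] moves, by at most [rho n * Z w]. *)
Let grid_max_cvg (a : R -> R) (nq : nat -> nat) (t : R) (w : T) : continuous
  a ->
  (forall q, (q <= nq q)%N /\
    forall t, 0 <= t <= q%:R -> `|A (nq q) t - a t| <= q.+1%:R^-1) ->
  0 <= t ->
  let h := fun s => a s - W s w in
  grid_max P g W (nq q) (idx (nq q) t) w @[q --> \oo] --> rmax h t.
Proof.
move=> ca Hnq t0 h.
pose N := (Num.truncn t).+1.
have tN : t <= N%:R by rewrite ltW// truncnS_gt.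
have [B B0 HB] := process_bound Z1 reg N.
have [Ca HCa] : exists Ca : R, forall s, 0 <= s <= t -> `|a s| <= Ca.
  have : compact (a @` `[0, t]).
    apply: continuous_compact; last exact: segment_compact.
    exact: continuous_subspaceT.
  move=> /compact_bounded [M [_ HM]]; exists (`|M| + 1) => s st.
  apply: (HM (`|M| + 1)); first by have := ler_norm M; lra.
  by exists s => //=; rewrite in_itv.
have hs s : 0 <= s <= t -> h s <= rmax h t.
  move=> st; apply: ub_le_sup; last by exists s => //=; rewrite in_itv.
  exists (Ca + B * Z w) => _ [r /= + <-]; rewrite in_itv/= => rt.
  rewrite lerD// ?(le_trans (ler_norm _) (HCa _ rt))//.
  rewrite (le_trans (ler_norm _))// normrN; apply: HB.
  by case/andP: rt => -> /= /le_trans ->.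
have hsup : has_sup [set h s | s in `[0, t]].
  split; first by exists (h 0), 0 => //=; rewrite in_itv/= lexx.
  by exists (rmax h t) => _ [r /= + <-]; rewrite in_itv/= => /hs.
have [rho [rc rho0 Hr]] := rp_modulus reg N.
have Zw0 : 0 <= Z w by rewrite (le_trans _ (Z1 w)).
have grid_max0 n : grid_max P g W n 0 w = 0 by [].
(* The grid maximum starts from 0, while [rmax h t] is only known to be at least [h 0 = a 0]. Every
   grid level at time 0 is 0, so [a 0] is nonnegative up to the error. *)
have a0 q : - q.+1%:R^-1 <= a 0.
  have [_ /(_ 0)] := Hnq q; rewrite lexx ler0n => /(_ isT).
  rewrite /A /idx mul0r truncn0 grid_level0 sub0r normrN.
  by rewrite ler_norml => /andP[].
apply/cvgrPdist_le => e e0.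
have e3 : 0 < e / 3 by rewrite divr_gt0.
have [k Hk] := cvg0_small rc Zw0 e3.
near=> q.
have qe : q.+1%:R^-1 <= e / 3.
  near: q; have := @near_infty_natSinv_lt R (PosNum e3).
  by apply: filterS => q /= /ltW.
have qN : (N <= q)%N by near: q; exact: nbhs_infty_ge.
have qk : (k <= q)%N by near: q; exact: nbhs_infty_ge.
have [nqq HA] := Hnq q.
set n := nq q in nqq HA *.
have Aq s : 0 <= s <= t -> `|A n s - a s| <= e / 3.
  move=> /andP[s0 st]; apply: le_trans qe; apply: HA.
  by rewrite s0 (le_trans st)// (le_trans tN)// ler_nat.
have rn : rho n * Z w < e / 3 by apply: Hk; rewrite (leq_trans qk).
have up : grid_max P g W n (idx n t) w <= rmax h t + e / 3.
  apply: (@step_max_le _ _ _ P g (grid_process W n) 0 _ w) => //.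
    apply: (@le_trans _ _ (h 0 + e / 3)); last by rewrite lerD2r hs// lexx.
    change (0 <= a 0 - W 0 w + e / 3).
    by rewrite (rp_start reg) subr0; have := a0 q; move: qe;
      move: (q.+1%:R^-1 : R) => x; lra.
  move=> l _ li.
  have lt : 0 <= dyadic n l <= t.
    by rewrite dyadic_ge0/= (le_trans _ (idx_le_id n t0))// dyadic_le.
  have := hs _ lt; have := Aq _ lt; rewrite /A idx_dyadic ler_norml => /andP[_].
  by rewrite /grid_level /h /grid_process; lra.
have lo : rmax h t - e <= grid_max P g W n (idx n t) w.
  have [_ [s /= + <-]] := sup_adherent e3 hsup; rewrite -/(rmax h t) in_itv/=.
  move=> st hse; have /andP[s0 s1] := st.
  have := Aq _ st.
  have := @step_max_ge _ _ _ P g (grid_process W n) (grid_process0 reg n)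
    (idx n s) (idx n t) w (idx_mono n s1).
  have := Hr n s (dyadic n (idx n s)) w.
  rewrite s0 (le_trans s1 tN)/= dyadic_ge0/=
    (le_trans (idx_le_id n s0) (le_trans s1 tN))/=.
  rewrite ger0_norm ?subr_ge0 ?idx_le_id// => /(_ isT isT).
  have := idx_ge n s => gg /(_ _)/wrap[|]; first by lra.
  rewrite ler_norml => /andP[w1 w2].
  rewrite ler_norml => + /andP[A1 A2].
  by move: hse; rewrite /grid_max /A /grid_level /h /grid_process in A1 A2 *;
    lra.
by rewrite ler_norml; apply/andP; split; lra.
Unshelve. all: by end_near. Qed.

Theorem fixed_point : exists a : R -> R, continuous a /\
  forall t, 0 <= t -> a t = mean (fun w => g (rmax (fun s => a s - W s w) t)).
Proof.
have [a [nq [ca Hnq]]] := limit_extraction; exists a; split => // t t0.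
pose N := (Num.truncn t).+1.
have tN : t <= N%:R by rewrite ltW// truncnS_gt.
have [C [n0 [C0 HC]]] := upper_bound mZ Z1 iZ adm reg N.
have [B B0 HB] := process_bound Z1 reg N.
(* The shift by [q0] puts the grid index beyond [n0] and the horizon of uniform convergence beyond
   [t]. *)
pose q0 := maxn n0 N.
pose n q := nq (q + q0)%N.
have nn0 q : (n0 <= n q)%N.
  have [+ _] := Hnq (q + q0)%N; apply: leq_trans.
  by rewrite (leq_trans (leq_maxl n0 N))// leq_addl.
have cA : A (n q) t @[q --> \oo] --> a t.
  apply/cvgrPdist_le => e e0; near=> q.
  have [_ /(_ t)] := Hnq (q + q0)%N.
  rewrite t0 (le_trans tN)/=; last first.
    by rewrite ler_nat (leq_trans (leq_maxr n0 N))// leq_addl.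
  rewrite distrC => /(_ isT) /le_trans; apply.
  apply: (@le_trans _ _ q.+1%:R^-1).
    by rewrite lef_pV2 ?posrE// ler_nat ltnS leq_addr.
  near: q; have := @near_infty_natSinv_lt R (PosNum e0).
  by apply: filterS => q /= /ltW.
have [D HD] := adm_dom_bound Z1 adm (C + B).
have cE : A (n q) t @[q --> \oo] --> mean
  (fun w => g (rmax (fun s => a s - W s w) t)).
  rewrite (_ : (fun q => A (n q) t) =
    fun q => mean (fun w => g (grid_max P g W (n q) (idx (n q) t) w)));
      last first.
    apply/funext => q; rewrite /A /grid_level.
    exact: (grid_level_eq mZ Z1 iZ adm reg).
  apply: (@mean_cvg _ _ _ P Z iZ _ _ D).
  - move=> q; apply: adm_measurable => //.
    exact: (grid_max_measurable g Z1 reg).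
  - move=> q w; apply: HD.
    apply: (@le_trans _ _ (C + B * Z w)); last first.
      by rewrite mulrDl lerD2r ler_peMr.
    apply: (grid_max_bound Z1 _ C0 B0 HB); first exact: idx_le.
    move=> l li; apply: HC => //.
    by apply: le_trans (idx_le (n q) tN); rewrite dyadic_le.
  - move=> w; have cg := adm_continuous adm.
    apply: (@cvg_comp _ _ _ (fun q => grid_max P g W (n q) (idx (n q) t) w) g);
      last exact: cg.
    have := @grid_max_cvg a nq t w ca Hnq t0.
    by move=> /(cvg_comp _ _ (@cvg_addnr q0)); apply.
exact: cvg_unique cA cE.
Unshelve. all: by end_near. Qed.

End limit.

(** * The function y |-> \int (y - x)_+ dm(x) *)

Section call_function.
Context {R : realType}.
Variable mu : {measure set R -> \bar R}.

Local Notation I := (`[0%R, +oo[%classic : set R).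

Definition gauss_finite : Prop := forall c : R, 0 < c ->
  (\int[mu]_(x in I) (expR (- c * x ^+ 2))%:E < +oo)%E.

Hypothesis mufin : gauss_finite.

Definition call (y x : R) : R := Num.max (y - x) 0.
Definition callint (y : R) : R := \int[mu]_(x in I) call y x.
Definition mass_upto (x : R) : R := fine (mu `[0%R, x]%classic).
Definition gauss_mass (c : R) : R := \int[mu]_(x in I) expR (- c * x ^+ 2).

Lemma call_ge0 y x : 0 <= call y x.
Proof. by rewrite le_max lexx orbT. Qed.

Let mI : measurable I. Proof. exact: measurable_itv. Qed.

Lemma measurable_call y : measurable_fun setT (call y).
Proof. by apply: measurable_maxr => //; exact: measurable_funB. Qed.

Let mgauss c : measurable_fun setT (fun x : R => expR (- c * x ^+ 2)).
Proof.
apply: measurableT_comp => //; apply: measurable_funM => //.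
Qed.

Lemma gauss_integrable c : 0 < c ->
  mu.-integrable I (fun x => (expR (- c * x ^+ 2))%:E).
Proof.
move=> c0; apply/integrableP; split.
  by apply/measurable_EFinP; apply: measurable_funTS.
under eq_integral do rewrite /= ger0_norm ?expR_ge0//.
exact: mufin.
Qed.

Lemma gauss_mass_ge0 c : 0 <= gauss_mass c.
Proof. by apply: Rintegral_ge0 => x _; exact: expR_ge0. Qed.

Lemma call_integrable y : mu.-integrable I (EFin \o call y).
Proof.
(* The integrand is at most [y], and for [0 <= x <= y] the factor [expR (y ^+ 2)] compensates the
   Gaussian weight at [x]. *)
apply: (le_integrable _ _ _ (integrableZl _ (`|y| * expR (y ^+ 2))
  (gauss_integrable ltr01))) => //.
  by apply/measurable_EFinP; apply: measurable_funTS; exact: measurable_call.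
move=> x; rewrite /= in_itv/= andbT => x0.
rewrite lee_fin (ger0_norm (call_ge0 y x)) ger0_norm; last first.
  by rewrite !mulr_ge0 ?expR_ge0.
have [yx|xy] := leP (y - x) 0.
  by rewrite /call (max_r yx) !mulr_ge0 ?expR_ge0.
have xy' : x <= y by rewrite -subr_ge0 ltW.
have y0 : 0 <= y by exact: le_trans xy'.
rewrite /call (max_l (ltW xy)) (ger0_norm y0) -mulrA -expRD.
apply: (@le_trans _ _ y); first by rewrite gerBl.
rewrite ler_peMr// -[leLHS]expR0 ler_expR mulN1r subr_ge0.
by rewrite ler_pXn2r.
Qed.

(** Markov's inequality with the weight [expR (c * (y ^+ 2 - x ^+ 2))], which is at least 1 on
    [[0, y]]. The freedom in [c] later beats an arbitrary multiple of [Z]. *)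
Lemma mass_indicator_le (c y : R) : 0 < c -> 0 <= y ->
  (mu `[0%R, y]%classic <= (expR (c * y ^+ 2) * gauss_mass c)%:E)%E.
Proof.
move=> c0 y0.
have sI : `[0%R, y]%classic `<=` I.
  by move=> x; rewrite /= !in_itv/= => /andP[->].
have -> : mu `[0%R, y]%classic =
  (\int[mu]_(x in I) (\1_(`[0%R, y]%classic) x)%:E)%E.
  by rewrite integral_indic// setIidl.
rewrite EFinM /gauss_mass /Rintegral fineK; last first.
  by apply: integrable_fin_num => //; exact: gauss_integrable.
rewrite -integralZl//; last exact: gauss_integrable.
apply: ge0_le_integral => //.
- by apply/measurable_EFinP; apply: measurable_funTS; exact: measurable_indic.
- apply/measurable_EFinP; apply: measurable_funTS; exact: measurable_funM.
move=> x _; rewrite -EFinM lee_fin -expRD indicE.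
have [|] := boolP (x \in _); last by rewrite expR_ge0.
rewrite inE /= in_itv/= => /andP[x0 xy] /=.
rewrite -[leLHS]expR0 ler_expR mulNr -mulrBr mulr_ge0 ?(ltW c0)// subr_ge0.
by rewrite ler_pXn2r// nnegrE (le_trans x0).
Qed.

Lemma mass_fin (y : R) : mu `[0%R, y]%classic \is a fin_num.
Proof.
have [y0|y0] := leP 0 y; last first.
  by rewrite set_itv_ge ?measure0// bnd_simp -ltNge.
rewrite ge0_fin_numE ?measure_ge0//.
exact: le_lt_trans (mass_indicator_le ltr01 y0) (ltry _).
Qed.

Lemma mass_upto_le (c y : R) : 0 < c -> 0 <= y ->
  mass_upto y <= expR (c * y ^+ 2) * gauss_mass c.
Proof.
move=> c0 y0; rewrite -lee_fin /mass_upto fineK; last exact: mass_fin.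
exact: mass_indicator_le.
Qed.

Lemma mass_upto_ge0 y : 0 <= mass_upto y.
Proof. by rewrite fine_ge0// measure_ge0. Qed.

Lemma mass_upto_mono x y : x <= y -> mass_upto x <= mass_upto y.
Proof.
move=> xy; rewrite /mass_upto fine_le ?mass_fin//.
apply: le_measure; rewrite ?inE//; [exact: measurable_itv..|].
by move=> z; rewrite /= !in_itv/= => /andP[-> /le_trans]; exact.
Qed.

Let indic_integrable (y : R) :
  mu.-integrable I (EFin \o (\1_(`[0%R, y]%classic) : R -> R)).
Proof.
have sI : `[0%R, y]%classic `<=` I.
  by move=> x; rewrite /= !in_itv/= => /andP[->].
apply/integrableP; split.
  by apply/measurable_EFinP; apply: measurable_funTS; exact: measurable_indic.
under eq_integral do rewrite /= ger0_norm//.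
by rewrite integral_indic// setIidl// -ge0_fin_numE ?measure_ge0// mass_fin.
Qed.

Let indic_intE (c y : R) :
  \int[mu]_(x in I) (c * \1_(`[0%R, y]%classic) x) = c * mass_upto y.
Proof.
have sI : `[0%R, y]%classic `<=` I.
  by move=> x; rewrite /= !in_itv/= => /andP[->].
by rewrite RintegralZl// /Rintegral integral_indic// setIidl.
Qed.

Let callB x y : callint y - callint x = \int[mu]_(u in I) (call y u - call x u).
Proof. by rewrite /callint RintegralB//; exact: call_integrable. Qed.

Let callB_int x y :
  mu.-integrable I (EFin \o (fun u => call y u - call x u)).
Proof.
rewrite [X in integrable _ _ X](_ : _ = (EFin \o call y) \-
  (EFin \o call x))%E//.
by apply: integrableB => //; exact: call_integrable.
Qed.

(** Over [[x, y]] the function [call _ u] has full slope 1 when [u <= x] and slope 0 when [y <= u].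
    With [callint_upper] this is the convexity sandwich for the increment. *)
Lemma callint_lower x y : x <= y -> (y - x) * mass_upto x <= callint y - callint
  x.
Proof.
move=> xy; rewrite callB -indic_intE; apply: le_Rintegral => //.
- rewrite [X in integrable _ _ X](_ : _ = (fun u => (y - x)%:E *
    (EFin \o (\1_(`[0%R, x]%classic) : R -> R)) u)%E)//.
  exact: integrableZl.
move=> u _; rewrite indicE /call.
have [|_] := boolP (u \in _).
  rewrite inE /= in_itv/= mulr1 => /andP[_ ux].
  by rewrite !max_l ?subr_ge0// ?(le_trans ux)//; lra.
rewrite mulr0 subr_ge0; case: (leP (y - u) 0) => ?; case: (leP (x - u) 0) => ?;
  lra.
Qed.

Lemma callint_upper x y : x <= y -> callint y - callint x <= (y - x) * mass_upto
  y.
Proof.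
move=> xy; rewrite callB -indic_intE; apply: le_Rintegral => //.
- rewrite [X in integrable _ _ X](_ : _ = (fun u => (y - x)%:E *
    (EFin \o (\1_(`[0%R, y]%classic) : R -> R)) u)%E)//.
  exact: integrableZl.
move=> u; rewrite /= in_itv/= andbT => u0; rewrite indicE /call.
have [_|] := boolP (u \in _).
  by case: (leP (y - u) 0) => ?; case: (leP (x - u) 0) => ?; rewrite mulr1; lra.
rewrite notin_setE/= in_itv/= u0/= => /negP; rewrite -ltNge => yu.
by rewrite !max_r ?subrr ?mulr0//; lra.
Qed.

Lemma callint_le0 y : y <= 0 -> callint y = 0.
Proof.
move=> y0; rewrite /callint.
rewrite (@eq_Rintegral _ _ _ _ _ (cst 0))/=.
  by rewrite Rintegral_cst// mul0r.
move=> x; rewrite inE /= in_itv/= andbT => x0.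
by rewrite /call max_r//; lra.
Qed.

End call_function.

Section signed_call_function.
Context {R : realType}.
Variables mp mn : {measure set R -> \bar R}.
Hypothesis fp : gauss_finite mp.
Hypothesis fn : gauss_finite mn.

Definition signed_callint (y : R) : R := callint mp y - callint mn y.

(** The right slope of [signed_callint] at [u] is the signed mass of [[0, u]]. On each of [K] equal
    pieces the mass of [mp] is taken at the right end and that of [mn] at the left end; the mismatch
    telescopes to [Q / K], which vanishes as [K] grows. *)
Lemma signed_callint_increment (x y b : R) : x <= y ->
  (forall u, x <= u <= y -> mass_upto mp u - mass_upto mn u <= b) ->
  signed_callint y - signed_callint x <= b * (y - x).
Proof.
move=> xy Hb.
pose Q := (y - x) * (mass_upto mp y - mass_upto mp x).
have Q0 : 0 <= Q by rewrite mulr_ge0 ?subr_ge0// mass_upto_mono.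
have key (K : nat) : (0 < K)%N ->
  signed_callint y - signed_callint x - b * (y - x) <= Q / K%:R.
  move=> K0; have K0' : 0 < K%:R :> R by rewrite ltr0n.
  pose D := (y - x) / K%:R.
  have D0 : 0 <= D by rewrite divr_ge0 ?subr_ge0.
  pose u (i : nat) := x + i%:R * D.
  have uS i : u i.+1 = u i + D by rewrite /u -natr1 mulrDl mul1r addrA.
  have uK : u K = y by rewrite /u /D mulrC divfK ?gt_eqF// addrC subrK.
  have u0 : u 0%N = x by rewrite /u mul0r addr0.
  have ux i : x <= u i by rewrite lerDl mulr_ge0.
  have uy i : (i <= K)%N -> u i <= y.
    by move=> iK; rewrite -uK /u lerD2l ler_wpM2r// ler_nat.
  have ind i : (i <= K)%N -> signed_callint (u i) - signed_callint x <=
      b * (u i - x) + D * (mass_upto mp (u i) - mass_upto mp x).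
    elim: i => [_|i ih iK]; first by rewrite u0 !subrr !mulr0 addr0.
    have uu : u i <= u i.+1 by rewrite uS lerDl.
    have := ih (ltnW iK); have := callint_upper fp uu.
    have := callint_lower fn uu.
    have bi : mass_upto mp (u i) - mass_upto mn (u i) <= b.
      by apply: Hb; rewrite ux uy// ltnW.
    have := ler_wpM2l D0 bi.
    rewrite /signed_callint uS (_ : u i + D - u i = D); last by ring.
    by rewrite !mulrDr !mulrN; lra.
  have := ind K (leqnn K); rewrite uK /Q /D.
  rewrite (_ : (y - x) / K%:R * _ =
    (y - x) * (mass_upto mp y - mass_upto mp x) / K%:R).
    by lra.
  by field; rewrite gt_eqF.
rewrite -subr_le0 leNgt; apply/negP; set H := _ - _ => H0.
have HQ : 0 < H / (Q + 1) by rewrite divr_gt0// ltr_wpDl.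
pose K := (Num.truncn ((Q + 1) / H)).+1.
have := key K isT; rewrite -/H leNgt => /negP; apply.
rewrite ltr_pdivrMr ?ltr0n//.
have : (Q + 1) / H < K%:R by exact: truncnS_gt.
by rewrite ltr_pdivrMr// mulrC; lra.
Qed.

(** Continuity from above along [[0, 1 / (n + 1)]]. It carries the strict bound on the mass at 0
    over to a neighbourhood. *)
Lemma mass_upto_right_cont (e : R) : 0 < e -> exists2 y : R, 0 < y &
  mass_upto mp y <= mass_upto mp 0 + e.
Proof.
move=> e0.
pose F (n : nat) : set R := `[0%R, n.+1%:R^-1]%classic.
have FE : \bigcap_n F n = `[0%R, 0%R]%classic.
  apply/seteqP; split => x /=; last first.
    move=> x01. move=> n _. rewrite /F /=. move: x01.
    by rewrite !in_itv/= => /andP[-> /le_trans]; apply.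
  move=> H; have := H 0%N I; rewrite /F /= !in_itv/= => /andP[x0 _];
    rewrite x0/=.
  rewrite leNgt; apply/negP => xpos.
  have := H (Num.truncn x^-1) I; rewrite /F /= in_itv/= => /andP[_].
  rewrite leNgt => /negP; apply.
  rewrite -[X in _ < X]invrK ltf_pV2 ?posrE ?invr_gt0//; exact: truncnS_gt.
have cF : (mp \o F) n @[n --> \oo] --> mp `[0%R, 0%R]%classic.
  rewrite -FE; apply: nonincreasing_cvg_mu.
  - by rewrite -ge0_fin_numE ?measure_ge0// mass_fin.
  - by move=> i; exact: measurable_itv.
  - by rewrite FE; exact: measurable_itv.
  move=> n m nm; apply/subsetPset => x; rewrite /F /= !in_itv/=.
  by move=> /andP[-> /le_trans]; apply; rewrite lef_pV2 ?posrE// ler_nat.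
have {}cF : mass_upto mp n.+1%:R^-1 @[n --> \oo] --> mass_upto mp 0.
  by apply: fine_cvg; rewrite fineK ?mass_fin.
have /cvgrPdist_le /(_ e e0)[n _ Hn] := cF.
exists n.+1%:R^-1; first by rewrite invr_gt0.
by have := Hn n (leqnn n); rewrite /= ler_norml => /andP[+ _]; lra.
Qed.

Lemma signed_callint_admissible (alpha : R) : 0 < alpha ->
  (forall x, 0 <= x -> mass_upto mp x - mass_upto mn x <= alpha^-1) ->
  mass_upto mp 0 - mass_upto mn 0 < alpha^-1 ->
  admissible (fun y => alpha * signed_callint y).
Proof.
move=> a0 Hle Hlt.
have lip x y : 0 <= x -> x <= y ->
    alpha * signed_callint y - alpha * signed_callint x <= y - x.
  move=> x0 xy; rewrite -mulrBr -ler_pdivlMl//.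
  apply: signed_callint_increment => // u /andP[xu _]; apply: Hle.
  exact: le_trans xu.
have z0 y : y <= 0 -> alpha * signed_callint y = 0.
  by move=> y0; rewrite /signed_callint !callint_le0// subrr mulr0.
split => //.
(* [e] is half the room left by the mass at 0. The mass of [mn] only helps as [u] grows, so up to
   [y0] the signed mass is at most [alpha^-1 - e], and [y - g y] has slope at least [alpha * e]
   there; beyond [y0] it is nondecreasing. *)
- pose e := (alpha^-1 - (mass_upto mp 0 - mass_upto mn 0)) / 2.
  have e0 : 0 < e by rewrite divr_gt0// subr_gt0.
  have [y0 y00 Hy0] := mass_upto_right_cont e0.
  have small y : 0 <= y -> y <= y0 ->
    alpha * e * y <= y - alpha * signed_callint y.
    move=> yy0 yy1.
    have : signed_callint y - signed_callint 0 <= (alpha^-1 - e) * (y - 0).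
      apply: signed_callint_increment => // u /andP[u0 uy].
      have := mass_upto_mono fp (le_trans uy yy1); have := mass_upto_mono fn u0.
      by rewrite /e in Hy0 *; lra.
    rewrite subr0 {2}/signed_callint !callint_le0// subrr subr0.
    rewrite -(ler_pM2l a0).
    rewrite (_ : alpha * ((alpha^-1 - e) * y) = y - alpha * e * y);
      first by lra.
    by field; rewrite gt_eqF.
  exists (alpha * e), y0; split => //; first exact: mulr_gt0.
  move=> y yy0; have [yy1|/ltW yy1] := leP y y0; first exact: small.
  apply: (le_trans (small y0 (ltW y00) (lexx _))).
  by have := lip y0 y (ltW y00) yy1; lra.
(* Chosen so that [c * (C * z) ^+ 2 <= z ^+ 2 / 2]; the added 1 keeps the denominator positive for
   [C = 0]. *)
- move=> C; pose c : R := (2 * (C ^+ 2 + 1))^-1.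
  have C1 : 0 < C ^+ 2 + 1 by rewrite ltr_wpDl// sqr_ge0.
  have c0 : 0 < c by rewrite invr_gt0 mulr_gt0.
  exists (alpha * (gauss_mass mp c + gauss_mass mn c)) => x y z x0 xy z1 yC.
  have y0 : 0 <= y by exact: le_trans xy.
  have yz : c * y ^+ 2 <= z ^+ 2 / 2.
    apply: (@le_trans _ _ (c * (C * z) ^+ 2)).
      by rewrite ler_wpM2l ?(ltW c0)// ler_pXn2r// nnegrE// (le_trans y0).
    rewrite exprMn -subr_ge0 (_ : _ - _ = z ^+ 2 / 2 * (C ^+ 2 + 1)^-1).
      by rewrite mulr_ge0 ?divr_ge0 ?sqr_ge0// invr_ge0 ltW.
    by rewrite /c; field; rewrite gt_eqF.
  have ME : mass_upto mp y + mass_upto mn y <=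
      (gauss_mass mp c + gauss_mass mn c) * expR (z ^+ 2 / 2).
    have := mass_upto_le fp c0 y0; have := mass_upto_le fn c0 y0.
    have := @gauss_mass_ge0 _ mp c; have := @gauss_mass_ge0 _ mn c => n0 p0 h1
      h2.
    have : expR (c * y ^+ 2) <= expR (z ^+ 2 / 2) by rewrite ler_expR.
    move=> ee; have := ler_wpM2r p0 ee; have := ler_wpM2r n0 ee.
    by rewrite mulrDl (mulrC (gauss_mass mp c)) (mulrC (gauss_mass mn c)); lra.
  rewrite -mulrBr normrM (gtr0_norm a0) -!mulrA ler_pM2l// !mulrA.
  have key : `|signed_callint y - signed_callint x| <=
    (mass_upto mp y + mass_upto mn y) * (y - x).
    have := callint_upper fp xy; have := callint_lower fp xy.
    have := callint_upper fn xy; have := callint_lower fn xy.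
    have yx0 : 0 <= y - x by rewrite subr_ge0.
    have := mulr_ge0 yx0 (mass_upto_ge0 mp x);
      have := mulr_ge0 yx0 (mass_upto_ge0 mn x).
    have := mulr_ge0 yx0 (mass_upto_ge0 mp y);
      have := mulr_ge0 yx0 (mass_upto_ge0 mn y).
    rewrite /signed_callint ler_norml mulrDl !(mulrC _ (y - x)) => *.
    by apply/andP; split; lra.
  by apply: (le_trans key); rewrite ler_wpM2r// subr_ge0.
Qed.

End signed_call_function.

Section signed_measure.
Context {R : realType} (m : signed_measure R R).
Hypothesis mfin : forall c : R, 0 < c ->
  (\int[variation m]_(x in `[0%R, +oo[) (expR (- c * x ^+ 2))%:E < +oo)%E.

Let gauss_dom (mu nu : {measure set R -> \bar R}) : (nu setT < +oo)%E ->
  (forall A, measurable A -> (mu A <= variation m A + nu A)%E) ->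
  gauss_finite nu /\ gauss_finite mu.
Proof.
move=> nuT H.
have me c : measurable_fun setT (fun x : R => (expR (- c * x ^+ 2))%:E).
  apply/measurable_EFinP; apply: measurableT_comp => //.
  exact: measurable_funM.
have fnu : gauss_finite nu.
  move=> c c0; apply: (@le_lt_trans
    _ _ (\int[nu]_(x in `[0%R, +oo[) (cst 1%E x))%E).
    apply: ge0_le_integral => //=; first exact: measurable_funTS.
    move=> x _; rewrite lee_fin -[leRHS]expR0 ler_expR mulNr oppr_le0.
    by rewrite mulr_ge0 ?sqr_ge0// ltW.
  rewrite integral_cst//= mul1e; apply: le_lt_trans nuT.
  by apply: le_measure; rewrite ?inE.
split => // c c0.
apply: (@le_lt_trans _ _ (\int[measure_add (variation m) nu]_(x in `[0%R, +oo[)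
    (expR (- c * x ^+ 2))%:E)%E).
  apply: ge0_le_measure_integral => //= S mS.
  by rewrite /measure_add/= /msum !big_ord_recl big_ord0/= adde0; exact: H.
rewrite ge0_integral_measure_add//=; last exact: measurable_funTS.
by apply: lte_add_pinfty; [exact: mfin|exact: fnu].
Qed.

(** In an arbitrary decomposition neither part need be bounded by the variation, but their
    difference is. Hence the possibly infinite part is at most the variation plus the finite part,
    and a finite measure integrates the bounded Gaussian weight. *)
Lemma spos_sneg_gauss_finite : gauss_finite (spos m) /\ gauss_finite (sneg m).
Proof.
have le_m A : measurable A -> (`|spos m A - sneg m A| <= variation m A)%E.
  exact: abse_le_variation.
have fin (mu : {measure set R -> \bar R}) A : measurable A ->
  (mu setT < +oo)%E ->
    mu A \is a fin_num.
  move=> mA h; rewrite ge0_fin_numE ?measure_ge0//; apply: le_lt_trans h.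
  by apply: le_measure; rewrite ?inE.
case: (spos_or_sneg_finite m) => h.
- suff: gauss_finite (spos m) /\ gauss_finite (sneg m) by [].
  apply: gauss_dom => // A mA; have := le_m A mA.
  have := fin _ A mA h; have := measure_ge0 (sneg m) A.
  case: (spos m A) => [p||]//; case: (sneg m A) => [n||]//=;
    case: (variation m A) => [v||]//=; rewrite ?leey//.
  by rewrite !lee_fin => _ _; rewrite ler_norml => /andP[]; lra.
- suff: gauss_finite (sneg m) /\ gauss_finite (spos m) by case.
  apply: gauss_dom => // A mA; have := le_m A mA.
  have := fin _ A mA h; have := measure_ge0 (spos m) A.
  case: (sneg m A) => [p||]//; case: (spos m A) => [n||]//=;
    case: (variation m A) => [v||]//=; rewrite ?leey//.
  by rewrite !lee_fin => _ _; rewrite ler_norml => /andP[]; lra.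
Qed.

Lemma signed_measure_admissible (alpha : R) : 0 < alpha ->
  (m [set 0%R] < (alpha^-1)%:E)%E ->
  (forall x : R, 0 <= x -> (m `[0%R, x]%classic <= (alpha^-1)%:E)%E) ->
  admissible (fun y => alpha * signed_callint (spos m) (sneg m) y).
Proof.
move=> a0 m0 mx; have [fp fn] := spos_sneg_gauss_finite.
have E x : m `[0%R, x]%classic =
  (mass_upto (spos m) x - mass_upto (sneg m) x)%:E.
  by rewrite /signed_value EFinB /mass_upto !fineK// mass_fin.
apply: signed_callint_admissible => //.
- by move=> x x0; rewrite -lee_fin -E; exact: mx.
- by rewrite -lte_fin -E set_itv1.
Qed.

End signed_measure.

(** * Brownian paths *)

Section normal_law.
Context {R : realType} (s : R).
Hypothesis s0 : 0 < s.

Let mu := @lebesgue_measure R.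
Let sn0 : s != 0. Proof. by rewrite gt_eqF. Qed.

(** The Radon-Nikodym derivative and the density have the same integrals over measurable sets, so
    they agree almost everywhere. *)
Lemma ge0_integral_normal_prob (f : R -> \bar R) : (forall x, 0 <= f x)%E ->
  measurable_fun setT f ->
  (\int[normal_prob 0 s]_x f x =
   \int[mu]_x (f x * (normal_pdf 0 s x)%:E))%E.
Proof.
move=> f0 mf; have dominated := @normal_prob_dominates R 0 s.
have mpdf : measurable_fun setT (fun x => (normal_pdf 0 s x)%:E).
  by apply/measurable_EFinP; exact: measurable_normal_pdf.
rewrite -(Radon_Nikodym_SigmaFinite.change_of_variables dominated f0)//.
have fint := Radon_Nikodym_SigmaFinite.f_integrable dominated.
apply: ae_eq_integral => //.
- apply: emeasurable_funM => //; exact: measurable_int fint.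
- exact: emeasurable_funM.
apply: ae_eqe_mul2l; apply: integral_ae_eq => // E _ mE.
by rewrite -(Radon_Nikodym_SigmaFinite.f_integral dominated).
Qed.

(** The weight removes half of the Gaussian exponent; what remains is [Num.sqrt 2] times the density
    with standard deviation [Num.sqrt 2 * s]. *)
Lemma normal_prob_exp_sqr :
  (\int[normal_prob 0 s]_x (expR (x ^+ 2 / (4 * s ^+ 2)))%:E =
   (Num.sqrt 2)%:E)%E.
Proof.
rewrite ge0_integral_normal_prob; last 2 first.
- by move=> x; rewrite lee_fin expR_ge0.
- apply/measurable_EFinP; apply: measurableT_comp => //.
  exact: measurable_funM.
have r2 : 0 < Num.sqrt 2 :> R by rewrite sqrtr_gt0.
pose s' := Num.sqrt 2 * s.
have s'0 : 0 < s' by rewrite mulr_gt0.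
transitivity (\int[mu]_x ((Num.sqrt 2)%:E * (normal_pdf 0 s' x)%:E))%E.
  apply: eq_integral => x _; rewrite -!EFinM; congr EFin.
  rewrite !normal_pdfE ?gt_eqF// mulrCA mulrA.
  have -> : normal_peak s = Num.sqrt 2 * normal_peak s'.
    rewrite /normal_peak /s' exprMn sqr_sqrtr//.
    rewrite (_ : 2 * s ^+ 2 * pi *+ 2 = 2 * (s ^+ 2 * pi *+ 2)); last first.
      by rewrite -!mulrnAr mulrA.
    rewrite sqrtrM// invfM mulrA divff ?gt_eqF// mul1r//.
  rewrite -!mulrA; congr (_ * (_ * _)).
  rewrite /normal_fun !subr0 -expRD; congr expR.
  rewrite /s' exprMn sqr_sqrtr// -(mulr_natr (s ^+ 2))
    -(mulr_natr (2 * s ^+ 2)).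
  by field.
rewrite ge0_integralZl//.
- by rewrite integral_normal_pdf mule1.
- by apply/measurable_EFinP; exact: measurable_normal_pdf.
- by move=> x _; rewrite lee_fin normal_pdf_ge0.
Qed.

Lemma normal_prob_sym (A : set R) : measurable A ->
  pushforward (normal_prob 0 s) (-%R : R -> measurableTypeR R) A =
  normal_prob 0 s A.
Proof.
move=> mA; rewrite /pushforward /normal_prob.
have mN : measurable_fun setT (-%R : R -> measurableTypeR R) by [].
transitivity (\int[mu]_(x in (-%R : R -> measurableTypeR R) @^-1` A)
    (((fun x => (normal_pdf 0 s x)%:E) \o (-%R : R -> measurableTypeR R)) x))%E.
  apply: eq_integral => x _ /=; congr EFin; rewrite !normal_pdfE// /normal_fun.
  by rewrite !subr0 sqrrN.
rewrite -ge0_integral_pushforward//.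
- by apply: eq_measure_integral => B mB _; exact: lebesgue_measureN.
- by apply/measurable_EFinP; apply: measurable_funTS;
  exact: measurable_normal_pdf.
- by move=> x _; rewrite lee_fin normal_pdf_ge0.
Qed.

(** Width times a lower bound for the density. The peak is estimated with [hi] and the exponent with
    [lo], which makes the bound uniform over the variances in between. *)
Lemma normal_prob_itv_ge (a b lo hi : R) : 0 <= a -> a <= b -> 0 < lo ->
  lo <= s ^+ 2 <= hi ->
  (((b - a) * ((Num.sqrt (hi * pi *+ 2))^-1 * expR (- b ^+ 2 / (lo *+ 2))))%:E
    <= normal_prob 0 s `[a, b]%classic)%E.
Proof.
move=> a0 ab lo0 /andP[los shi]; rewrite /normal_prob.
set c := _^-1 * _.
have c0 : 0 <= c by rewrite mulr_ge0 ?expR_ge0// invr_ge0 sqrtr_ge0.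
apply: (@le_trans _ _ (\int[mu]_(x in `[a, b]) (cst c%:E x))%E).
  rewrite integral_cst//= lebesgue_measure_itv/= lte_fin.
  case: ltP => [_|ba]; first by rewrite -EFinD -EFinM mulrC.
  by rewrite mule0 (@le_anti _ _ a b) ?ab// subrr mul0r.
apply: ge0_le_integral => //=.
- apply/measurable_EFinP; apply: measurable_funTS; exact: measurable_normal_pdf.
move=> x; rewrite in_itv/= => /andP[ax xb]; rewrite lee_fin normal_pdfE//.
have x0 : 0 <= x by exact: le_trans ax.
rewrite /normal_peak /normal_fun subr0; apply: ler_pM.
- by rewrite invr_ge0 sqrtr_ge0.
- exact: expR_ge0.
- rewrite lef_pV2 ?posrE ?sqrtr_gt0.
  + by rewrite ler_sqrt ?lerMn2r ?ler_pM2r ?pi_gt0// pmulrn_lge0// mulr_ge0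
    ?pi_ge0// (le_trans _ shi)// sqr_ge0.
  + by rewrite pmulrn_lgt0// mulr_gt0 ?pi_gt0// (lt_le_trans lo0)//
    (le_trans los).
  + by rewrite pmulrn_lgt0// mulr_gt0 ?pi_gt0// exprn_gt0.
- rewrite ler_expR !mulNr lerN2; apply: ler_pM.
  + exact: sqr_ge0.
  + by rewrite invr_ge0 pmulrn_lge0// sqr_ge0.
  + by rewrite ler_pXn2r// ?nnegrE// (le_trans x0).
  + rewrite lef_pV2 ?posrE ?pmulrn_lgt0// ?exprn_gt0//.
    by rewrite lerMn2r los orbT.
Qed.

End normal_law.

(** * Chaining over dyadic points *)

Section continuity.
Context {R : realType}.

Lemma within_extend (f : R -> R) : {within `[0, +oo[, continuous f} ->
  continuous (fun t : R => f (Num.max 0 t)).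
Proof.
move=> /subspace_continuousP cf t.
have t0 : 0 <= Num.max 0 t by rewrite le_max lexx.
have := cf (Num.max 0 t); rewrite /= in_itv/= andbT => /(_ t0) {}cf.
apply/cvgrPdist_le => e e0.
move/cvgrPdist_le : cf => /(_ e e0).
rewrite /within /= => H.
have cm : Num.max 0 s @[s --> t] --> Num.max 0 t.
  by apply: (@continuous_max R R (fun=> 0) id t);
    [exact: cst_continuous|exact: cvg_id].
have Hm : \forall s \near t, `[0, +oo[%classic (Num.max 0 s) ->
  `|f (Num.max 0 t) - f (Num.max 0 s)| <= e by exact: (cm _ H).
apply: filterS Hm => s; apply.
by rewrite /= in_itv/= andbT le_max lexx.
Qed.

(* The dyadic approximations of [u] move by at most one cell per level. *)
Lemma chaining (f : R -> R) (N : nat) (b : R) :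
  {within `[0, +oo[, continuous f} -> 0 <= b ->
  (forall n k, (k < N * 2 ^ n)%N ->
     `|f (dyadic n k.+1) - f (dyadic n k)| <= b * (9 / 10) ^+ n) ->
  forall n u v, 0 <= u <= N%:R -> 0 <= v <= N%:R -> `|u - v| <= (2 ^+ n)^-1 ->
    `|f u - f v| <= 21 * b * (9 / 10) ^+ n.
Proof.
move=> /within_extend cf b0 Hf.
set th : R := 9 / 10 in Hf *.
(* [10] is the sum of the geometric series with ratio [9 / 10]; the [21] of the conclusion is two
   such tails plus one jump between neighbouring cells. *)
have thE : 10 * (1 - th) = 1 by rewrite /th; field.
have th1 : th <= 1 by lra.
have th0 n : 0 <= th ^+ n by rewrite exprn_ge0// /th divr_ge0.
clearbody th.
have e2 n : 0 < (2 ^+ n : R) by exact: exprn_gt0.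
pose idx n (u : R) := Num.truncn (u * 2 ^+ n).
have idxP n u : 0 <= u -> (idx n u)%:R <= u * 2 ^+ n < (idx n u).+1%:R.
  by move=> u0; rewrite truncn_itv// mulr_ge0// ltW.
have idxN n u : 0 <= u <= N%:R -> (idx n u <= N * 2 ^ n)%N.
  move=> /andP[u0 uN]; rewrite -(ler_nat R) natrM natrX.
  have /andP[h _] := idxP n u u0; rewrite (le_trans h)//.
  by rewrite ler_pM2r.
have tml n u : 0 <= u -> dyadic n (idx n u) <= u.
  by move=> u0; rewrite /dyadic ler_pdivrMr//; have /andP[] := idxP n u u0.
have tmg n u : 0 <= u -> u - (2 ^+ n)^-1 <= dyadic n (idx n u).
  move=> u0; rewrite lerBlDr /dyadic -[X in _ <= _ + X]div1r -mulrDl natr1.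
  by rewrite ler_pdivlMr// ltW//; have /andP[] := idxP n u u0.
have step n u : 0 <= u <= N%:R ->
    `|f (dyadic n.+1 (idx n.+1 u)) - f (dyadic n (idx n u))| <= b * th ^+ n.+1.
  move=> uN; have /andP[u0 _] := uN.
  have tmE : dyadic n (idx n u) = dyadic n.+1 (idx n u).*2 :> R.
    by rewrite /dyadic -muln2 natrM exprS; field; rewrite expf_neq0.
  have lo : ((idx n u).*2 <= idx n.+1 u)%N.
    rewrite truncn_ge_nat ?mulr_ge0 ?(ltW (e2 _))// -muln2 natrM exprSr mulrA.
    by rewrite ler_pM2r//; have /andP[] := idxP n u u0.
  have hi : (idx n.+1 u <= (idx n u).*2.+1)%N.
    rewrite -ltnS truncn_lt_nat ?mulr_ge0 ?(ltW (e2 _))//.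
    rewrite (_ : (idx n u).*2.+2 = ((idx n u).+1 * 2)%N); last by rewrite muln2.
    rewrite natrM exprSr mulrA ltr_pM2r//.
    by have /andP[] := idxP n u u0.
  rewrite tmE; move: lo; rewrite leq_eqVlt => /predU1P[->|lo].
    by rewrite subrr normr0 mulr_ge0.
  have E : idx n.+1 u = (idx n u).*2.+1 by apply/eqP; rewrite eqn_leq hi lo.
  by rewrite E; apply: Hf; rewrite -E idxN.
have tail n j u : 0 <= u <= N%:R ->
    `|f (dyadic (n + j) (idx (n + j)%N u)) - f (dyadic n (idx n u))| <=
    10 * b * (th ^+ n - th ^+ (n + j)).
  move=> uN; elim: j => [|j ih]; first by rewrite addn0 !subrr normr0 mulr0.
  rewrite addnS; have h := step (n + j)%N u uN.
  apply: le_trans (ler_distD (f (dyadic (n + j) (idx (n + j)%N u))) _ _) _.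
  apply: (le_trans (lerD h ih)); rewrite exprS.
  move: (th ^+ n) (th ^+ (n + j)) (th0 (n + j)%N) => y x x0.
  rewrite -subr_ge0 (_ : _ - _ = 10 * (1 - th) * (b * x) - b * th * x).
    rewrite thE mul1r (_ : _ - _ = b * x * (1 - th)); last by ring.
    by rewrite !mulr_ge0// subr_ge0.
  by ring.
have lim n u : 0 <= u <= N%:R -> `|f u - f (dyadic n (idx n u))| <=
  10 * b * th ^+ n.
  move=> uN; have /andP[u0 _] := uN.
  have cu : dyadic (n + j) (idx (n + j)%N u) @[j --> \oo] --> u.
    apply/cvgrPdist_le => e e0; near=> j.
    rewrite ger0_norm ?subr_ge0 ?tml//.
    apply: (@le_trans _ _ (2 ^+ j)^-1).
      rewrite lerBlDr -lerBlDl; apply: le_trans (tmg _ _ u0).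
      by rewrite lerD2l lerN2 inv_exp2_le// leq_addl.
    apply: (@le_trans _ _ j.+1%:R^-1).
      by rewrite lef_pV2 ?posrE// -natrX ler_nat ltn_expl.
    near: j; have := @near_infty_natSinv_lt R (PosNum e0).
    by apply: filterS => q /= /ltW.
  have := cvg_comp _ _ cu (cf u); rewrite (max_r u0) => cfu.
  apply: (@cvgr_to_le _ \oo _ _ (fun j => `|f
    (dyadic (n + j) (idx (n + j)%N u)) -
      f (dyadic n (idx n u))|)).
    apply: cvg_norm; apply: cvgB; last exact: cvg_cst.
    apply: cvg_trans cfu; apply: near_eq_cvg; apply: nearW => j /=.
    by rewrite max_r// dyadic_ge0.
  apply: nearW => j; apply: (le_trans (tail n j u uN)).
  by rewrite ler_wpM2l ?mulr_ge0// gerBl.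
move=> n u v.
wlog uv : u v / u <= v.
  move=> H; have [uv|/ltW vu] := leP u v; first exact: H.
  by move=> ? ? ?; rewrite distrC; apply: H => //; rewrite distrC.
move=> uN vN; rewrite distrC ger0_norm ?subr_ge0// => gap.
have /andP[u0 _] := uN; have /andP[v0 _] := vN.
have mid : `|f (dyadic n (idx n v)) - f (dyadic n (idx n u))| <= b * th ^+ n.
  have lo : (idx n u <= idx n v)%N by apply: le_truncn; rewrite ler_pM2r.
  have hi : (idx n v <= (idx n u).+1)%N.
    rewrite -ltnS truncn_lt_nat ?mulr_ge0 ?(ltW (e2 _))//.
    have /andP[_ h] := idxP n u u0.
    rewrite -[X in _ < X]natr1; apply: (@le_lt_trans _ _ (u * 2 ^+ n + 1));
      last by rewrite ltrD2r.
    rewrite -lerBlDl -mulrBl -ler_pdivlMr// div1r//.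
  move: lo; rewrite leq_eqVlt => /predU1P[->|lo].
    by rewrite subrr normr0 mulr_ge0.
  have E : idx n v = (idx n u).+1 by apply/eqP; rewrite eqn_leq hi lo.
  by rewrite E; apply: Hf; rewrite -E idxN.
have := lim n u uN; have := lim n v vN.
rewrite distrC => h1 h2.
apply: le_trans (ler_distD (f (dyadic n (idx n v))) _ _) _.
have := ler_distD (f (dyadic n (idx n u))) (f u) (f (dyadic n (idx n v))).
rewrite (distrC (f (dyadic n (idx n u)))) (_ : 21 * b * th ^+ n =
  10 * b * th ^+ n + b * th ^+ n + 10 * b * th ^+ n); last by ring.
lra.
Unshelve. all: by end_near. Qed.

End continuity.

Lemma nneseries_le_bound {R : realType} (u : nat -> \bar R) (B : \bar R) :
  (forall i, 0 <= u i)%E -> (forall K, \sum_(0 <= i < K) u i <= B)%E ->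
  (\sum_(0 <= i <oo) u i <= B)%E.
Proof.
move=> u0 uB; apply: lime_le; first exact: is_cvg_nneseries.
exact: nearW.
Qed.

Lemma nneseries_ge_term {R : realType} (u : nat -> \bar R) n :
  (forall i, 0 <= u i)%E -> (u n <= \sum_(0 <= i <oo) u i)%E.
Proof.
move=> u0; apply: le_trans (nneseries_lim_ge n.+1 _); last by [].
by rewrite big_nat_recr//= leeDr// sume_ge0.
Qed.

Lemma bernoulli_inequality {R : realType} (x : R) n : 0 <= x ->
  1 + n%:R * x <= (1 + x) ^+ n.
Proof.
move=> x0; elim: n => [|n ih]; first by rewrite mul0r addr0 expr0.
rewrite exprS; apply: (@le_trans _ _ ((1 + x) * (1 + n%:R * x))).
  rewrite -natr1 -subr_ge0 (_ : _ - _ = n%:R * x ^+ 2); last by ring.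
  by rewrite mulr_ge0// sqr_ge0.
by rewrite ler_wpM2l// addr_ge0.
Qed.

(** * Brownian paths dominated by one random variable *)

Section brownian.
Context {d : measure_display} {T : measurableType d} {R : realType}.
Variables (P : probability T R) (W : R -> {RV P >-> R}).
Hypothesis hW : standard_brownian_motion W.

Local Notation mean := (mean P).

Let mW t : measurable_fun setT (W t : T -> R).
Proof. exact: measurable_funPT. Qed.

Lemma integral_increment (s t : R) (f : R -> \bar R) : 0 <= s -> s < t ->
  (forall x, 0 <= f x)%E -> measurable_fun setT f ->
  (\int[P]_w f (W t w - W s w)%R =
   \int[normal_prob 0 (Num.sqrt (t - s))]_x f x)%E.
Proof.
move=> s0 st f0 mf.
have mphi : measurable_fun setT ((fun w => W t w - W s w) : T ->
  measurableTypeR R).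
  exact: measurable_funB.
pose X : {mfun T >-> measurableTypeR R} := HB.pack (fun w => W t w - W s w)
  (isMeasurableFun.Build _ _ _ _ _ mphi).
transitivity (\int[pushforward P X]_x f x)%E.
  by rewrite ge0_integral_pushforward.
by apply: eq_measure_integral => A mA _; exact: (bm_gaussian hW s0 st mA).
Qed.

Let Delta n k w : R := W (dyadic n k.+1) w - W (dyadic n k) w.
(* The weights make the expectations of the terms below summable. *)
Let wt n k : R := (2 ^+ n.+1 * (k.+1 * k.+2)%:R)^-1.
Let term n k w : R := wt n k * expR (2 ^+ n * Delta n k w ^+ 2 / 4).
(** The sum runs over all [k], so one random variable controls the increments on every bounded
    interval; the horizon enters only in [increment_bound], through the weights. *)
Let Y w : \bar R := (\sum_(0 <= n <oo) \sum_(0 <= k <oo) (term n k w)%:E)%E.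

Let wt_gt0 n k : 0 < wt n k.
Proof. by rewrite invr_gt0 mulr_gt0 ?exprn_gt0// ltr0n muln_gt0. Qed.

Let term_ge0 n k w : 0 <= term n k w.
Proof. by rewrite mulr_ge0 ?expR_ge0// ltW. Qed.

Let mexp n k :
  measurable_fun setT (fun w => expR (2 ^+ n * Delta n k w ^+ 2 / 4)).
Proof.
apply: measurableT_comp => //; apply: measurable_funM => //.
apply: measurable_funM => //; apply: measurable_funX.
exact: measurable_funB.
Qed.

Let mterm n k : measurable_fun setT (fun w => (term n k w)%:E).
Proof. by apply/measurable_EFinP; apply: measurable_funM => //;
  exact: mexp. Qed.

Let inner_ge0 n w : (0 <= \sum_(0 <= k <oo) (term n k w)%:E)%E.
Proof. by apply: nneseries_ge0 => k _ _; rewrite lee_fin. Qed.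

Let minner n : measurable_fun setT
  (fun w => \sum_(0 <= k <oo) (term n k w)%:E)%E.
Proof.
apply: (@ge0_emeasurable_sum _ _ _ _ _ predT) => // k w _ _.
by rewrite lee_fin.
Qed.

Let Y_ge0 w : (0 <= Y w)%E.
Proof. exact: nneseries_ge0. Qed.

Let mY : measurable_fun setT Y.
Proof. exact: (@ge0_emeasurable_sum _ _ _ _ _ predT). Qed.

(** The increment has variance [(2 ^+ n)^-1], so the exponent is that of [normal_prob_exp_sqr] and
    the mean of the exponential depends on neither [n] nor [k]. *)
Let int_term n k : (\int[P]_w (term n k w)%:E = (wt n k * Num.sqrt 2)%:E)%E.
Proof.
have t01 : dyadic n k < dyadic n k.+1 :> R.
  by rewrite /dyadic ltr_pM2r ?invr_gt0 ?exprn_gt0// ltr_nat.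
have gap : dyadic n k.+1 - dyadic n k = (2 ^+ n)^-1 :> R.
  by rewrite /dyadic -mulrBl -natr1 addrAC subrr add0r mul1r.
pose f (x : R) : \bar R := (expR (2 ^+ n * x ^+ 2 / 4))%:E.
have mf : measurable_fun setT f.
  apply/measurable_EFinP; apply: measurableT_comp => //.
  by apply: measurable_funM => //; apply: measurable_funM.
under eq_integral do rewrite /term EFinM.
rewrite ge0_integralZl ?lee_fin ?(ltW (wt_gt0 _ _))//; last first.
  by apply/measurable_EFinP; exact: mexp.
rewrite EFinM; congr (_ * _)%E.
rewrite (integral_increment (f := f) (dyadic_ge0 _ _) t01)//; last first.
  by move=> x; rewrite lee_fin expR_ge0.
have s0 : 0 < Num.sqrt (dyadic n k.+1 - dyadic n k) :> R
  by rewrite sqrtr_gt0 subr_gt0.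
rewrite -(normal_prob_exp_sqr s0); apply: eq_integral => x _.
rewrite /f sqr_sqrtr ?subr_ge0 ?(ltW t01)// gap; congr (expR _)%:E.
by field; rewrite expf_neq0.
Qed.

Let sum_wt n K : \sum_(0 <= k < K) wt n k <= (2 ^+ n.+1)^-1.
Proof.
have E : \sum_(0 <= k < K) wt n k = (2 ^+ n.+1)^-1 * (1 - K.+1%:R^-1).
  elim: K => [|K ih]; first by rewrite big_geq// invr1 subrr mulr0.
  rewrite big_nat_recr//= ih /wt natrM invfM -mulrDr; congr (_ * _).
  have -> : K.+2%:R = K.+1%:R + 1 :> R by rewrite natr1.
  have := ltr0Sn R K; move: (K.+1%:R : R) => x x0.
  by field; rewrite !gt_eqF// ltr_wpDr.
by rewrite E ler_piMr ?invr_ge0 ?exprn_ge0// gerBl.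
Qed.

Let sum_pow K : \sum_(0 <= n < K) (2 ^+ n.+1)^-1 <= (1 : R).
Proof.
have -> : \sum_(0 <= n < K) (2 ^+ n.+1)^-1 = 1 - (2 ^+ K)^-1 :> R.
  elim: K => [|K ih]; first by rewrite big_geq// expr0 invr1 subrr.
  by rewrite big_nat_recr//= ih; have := @inv_exp2S R K; lra.
by rewrite gerBl.
Qed.

Let int_Y : (\int[P]_w Y w <= (Num.sqrt 2)%:E)%E.
Proof.
rewrite integral_nneseries//; apply: nneseries_le_bound.
  by move=> n; apply: integral_ge0.
move=> K; apply: (@le_trans
  _ _ (\sum_(0 <= n < K) ((2 ^+ n.+1)^-1 * Num.sqrt 2)%:E)%E).
  apply: lee_sum => n _; rewrite integral_nneseries//; last first.
    by move=> k w _; rewrite lee_fin.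
  under eq_eseriesr do rewrite int_term.
  apply: nneseries_le_bound => [k|L].
    by rewrite lee_fin mulr_ge0// ?sqrtr_ge0// ltW.
  by rewrite sumEFin lee_fin -mulr_suml ler_wpM2r ?sqrtr_ge0// sum_wt.
by rewrite sumEFin lee_fin -mulr_suml ler_piMl ?sqrtr_ge0// sum_pow.
Qed.

Let integrable_Y : P.-integrable setT Y.
Proof.
apply/integrableP; split => //.
under eq_integral do rewrite gee0_abs//.
exact: le_lt_trans int_Y (ltry _).
Qed.

(* Off this almost sure event the paths are replaced by 0 in [bm_version], so
   that the bounds by [bm_norm] hold for every outcome. *)
Definition bm_good : set T := [set w | (Y w < +oo)%E].

Lemma measurable_bm_good : measurable bm_good.
Proof.
have := emeasurable_fun_infty_o measurableT mY (+oo)%E.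
by rewrite setTI.
Qed.

Lemma bm_good_ae : \forall w \ae P, bm_good w.
Proof.
have := integrable_ae measurableT integrable_Y.
apply: filterS => w /(_ I); rewrite ge0_fin_numE//.
Qed.

(** Chosen so that on [bm_good] the value of [expR (bm_norm w ^+ 2)] is [expR 1 * (1 + Y w)], which
    is integrable. The outer 1 gives [1 <= bm_norm w]. Where [Y] is infinite, [fine] returns 0 and
    the value is 1. *)
Definition bm_norm (w : T) : R := Num.sqrt (1 + ln (1 + fine (Y w))).

Let y0 w : 0 <= fine (Y w). Proof. exact: fine_ge0. Qed.

Let lny w : 0 <= ln (1 + fine (Y w)). Proof. by rewrite ln_ge0// lerDl. Qed.

Let sqr_norm w : bm_norm w ^+ 2 = 1 + ln (1 + fine (Y w)).
Proof. by rewrite sqr_sqrtr// addr_ge0. Qed.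

Lemma bm_norm_ge1 w : 1 <= bm_norm w.
Proof. by rewrite -[leLHS]sqrtr1 ler_sqrt ?lerDl// addr_ge0. Qed.

Lemma measurable_bm_norm : measurable_fun setT bm_norm.
Proof.
apply: measurableT_comp.
  by apply: continuous_measurable_fun; exact: sqrt_continuous.
apply: measurable_funD => //.
apply: measurableT_comp => //; apply: measurable_funD => //.
exact: measurableT_comp.
Qed.

Lemma bm_norm_integrable :
  P.-integrable setT (fun w => (expR (bm_norm w ^+ 2))%:E).
Proof.
have i1 : P.-integrable setT (fun w => ((expR 1)%:E * (1 + Y w))%E).
  apply: integrableZl => //; apply: integrableD => //.
  exact: finite_measure_integrable_cst.
apply: (le_integrable _ _ _ i1) => //.
  apply/measurable_EFinP; apply: measurableT_comp => //.
  exact/measurable_funX/measurable_bm_norm.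
move=> w _ /=; rewrite ger0_norm ?expR_ge0//.
rewrite gee0_abs ?mule_ge0 ?adde_ge0 ?lee_fin ?expR_ge0//.
rewrite sqr_norm expRD lnK ?posrE ?ltr_wpDr//.
rewrite EFinM lee_pmul2l ?lte_fin ?expR_gt0// EFinD leeD2l//.
by have := Y_ge0 w; case: (Y w) => [r||]//=; rewrite ?lee_fin ?leey.
Qed.

(** A single term is at most [Y]. Taking logarithms bounds [2 ^+ n * Delta n k w ^+ 2 / 4] by
    [ln (1 + Y)] plus the logarithm of the inverse weight, which grows at most linearly in [n]; the
    factor [2 ^+ n] leaves room for geometric decay. *)
Let increment_bound (N : nat) n k w : bm_good w -> (k < N * 2 ^ n)%N ->
  `|Delta n k w| <= Num.sqrt (4 * (4 * N%:R ^+ 2 + 16)) *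
    bm_norm w * (9 / 10) ^+ n.
Proof.
move=> gw kN; set L := ln (1 + fine (Y w)).
have L0 : 0 <= L by exact: lny.
have yE : Y w = (fine (Y w))%:E by rewrite fineK// ge0_fin_numE.
have tY : term n k w <= fine (Y w).
  rewrite -lee_fin -yE.
  apply: le_trans (nneseries_ge_term n (fun i => inner_ge0 i w)).
  by apply: nneseries_ge_term => i; rewrite lee_fin.
have n2 : 0 < (2 ^+ n : R) by exact: exprn_gt0.
have kN' : k.+1%:R <= N%:R * 2 ^+ n :> R by rewrite -natrX -natrM ler_nat.
have k1 : 0 <= k.+1%:R :> R by [].
(* For [k < N * 2 ^ n] the inverse weight is at most [4 * N ^ 2 * 8 ^ n]; then [y <= expR y] is
   applied to [4 * N ^ 2] and to [8]. *)
have wtle : (wt n k)^-1 <= expR (4 * N%:R ^+ 2 + 8 * n%:R).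
  rewrite /wt invrK natrM exprS.
  apply: (@le_trans _ _ (4 * N%:R ^+ 2 * 8 ^+ n)).
    have k2 : k.+2%:R <= 2 * (N%:R * 2 ^+ n) :> R.
      by rewrite -natr1; move: kN'; rewrite -natr1; have : 0 <= k%:R :> R by [];
        lra.
    have kk : k.+1%:R * k.+2%:R <= (N%:R * 2 ^+ n) * (2 * (N%:R * 2 ^+ n)) :> R.
      by apply: ler_pM.
    apply: (@le_trans _ _ (2 * 2 ^+ n *
      ((N%:R * 2 ^+ n) * (2 * (N%:R * 2 ^+ n))))).
      by rewrite ler_wpM2l// mulr_ge0// ltW.
    have -> : 8 ^+ n = 2 ^+ n * 2 ^+ n * 2 ^+ n :> R.
      by rewrite -!exprMn; congr (_ ^+ n); ring.
    by rewrite le_eqVlt; apply/orP; left; apply/eqP; ring.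
  rewrite expRD; apply: ler_pM.
  - by rewrite mulr_ge0// sqr_ge0.
  - by rewrite exprn_ge0.
  - by apply: le_trans (expR_ge1Dx _); rewrite lerDr.
  - rewrite mulrC expRM_natl; apply: lerXn2r; rewrite ?nnegrE ?expR_ge0//.
    by apply: le_trans (expR_ge1Dx _); rewrite lerDr.
have A : 2 ^+ n * Delta n k w ^+ 2 / 4 <= L + (4 * N%:R ^+ 2 + 8 * n%:R).
  rewrite -ler_expR expRD /L lnK ?posrE ?ltr_wpDr//.
  apply: (@le_trans _ _ ((1 + fine (Y w)) * (wt n k)^-1)); last first.
    by apply: ler_wpM2l wtle; rewrite addr_ge0.
  rewrite ler_pdivlMr// mulrC (le_trans tY)// lerDr//.
have B : Delta n k w ^+ 2 <=
    (Num.sqrt (4 * (4 * N%:R ^+ 2 + 16)) * bm_norm w * (9 / 10) ^+ n) ^+ 2.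
  rewrite exprMn [X in _ <= X * _]exprMn sqr_sqrtr;
    last by rewrite mulr_ge0// addr_ge0// mulr_ge0// sqr_ge0.
  rewrite sqr_norm -/L.
  have -> : (9 / 10) ^+ n ^+ 2 = (81 / 50) ^+ n / 2 ^+ n :> R.
    by rewrite -exprM mulnC exprM -exprVn -exprMn; congr (_ ^+ n); field.
  rewrite mulrA ler_pdivlMr// mulrC.
  move: A; rewrite ler_pdivrMr// => /le_trans; apply.
  (* The ratio [9 / 10] matters through twice its square, [81 / 50 > 1], whose powers dominate the
     linear term [8 * n]; the constant 16 suffices because [16 * (31 / 50) >= 8]. *)
  have bern := @bernoulli_inequality R (31 / 50) n
    (divr_ge0 (ler0n _ _) (ler0n _ _)).
  rewrite (_ : 1 + 31 / 50 = 81 / 50) in bern; last by field.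
  set q := (81 / 50) ^+ n in bern *.
  have N0 : 0 <= N%:R ^+ 2 :> R by exact: sqr_ge0.
  have nn0 : 0 <= n%:R :> R by [].
  set M : R := 4 * N%:R ^+ 2 + 16.
  have Mq : 4 * N%:R ^+ 2 + 8 * n%:R <= M * q.
    apply: (@le_trans _ _ (M * (1 + n%:R * (31 / 50)))); last first.
      by rewrite ler_wpM2l// /M; lra.
    rewrite /M mulrDl !mulrDr !mulr1.
    have : 0 <= 4 * N%:R ^+ 2 * (n%:R * (31 / 50)) :> R by rewrite !mulr_ge0.
    lra.
  have Mq1 : 1 <= M * q.
    have q1 : 1 <= q by apply: le_trans bern; rewrite lerDl mulr_ge0.
    apply: (@le_trans _ _ M); first by rewrite /M; lra.
    by rewrite ler_peMr// /M; lra.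
  have : L <= L * (M * q) by rewrite ler_peMr.
  rewrite (_ : 4 * M * (1 + L) * q = (M * q + L * (M * q)) * 4); last by ring.
  by move=> h; rewrite ler_pM2r//; lra.
rewrite -(ger0_norm (x := _ * _ * _)); last first.
  by rewrite !mulr_ge0 ?sqrtr_ge0 ?exprn_ge0 ?divr_ge0//
    (le_trans _ (bm_norm_ge1 w)).
by rewrite -ler_sqr ?nnegrE// !real_normK ?num_real.
Qed.

Definition bm_version (t : R) (w : T) : R := \1_bm_good w * W t w.

Lemma bm_versionE t w : bm_good w -> bm_version t w = W t w.
Proof. by move=> gw; rewrite /bm_version indicE mem_set// mul1r. Qed.

Lemma measurable_bm_version t : measurable_fun setT (bm_version t).
Proof.
apply: measurable_funM => //; apply: measurable_indic.
exact: measurable_bm_good.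
Qed.

Let version_modulus (N : nat) : exists rho : nat -> R,
    [/\ rho n @[n --> \oo] --> 0, forall n, 0 <= rho n &
     forall n u v w, 0 <= u <= N%:R -> 0 <= v <= N%:R ->
       `|u - v| <= (2 ^+ n)^-1 ->
       `|bm_version u w - bm_version v w| <= rho n * bm_norm w].
Proof.
pose b := Num.sqrt (4 * (4 * N%:R ^+ 2 + 16)) : R.
have b0 : 0 <= b by exact: sqrtr_ge0.
have th0 n : 0 <= (9 / 10) ^+ n :> R by rewrite exprn_ge0// divr_ge0.
exists (fun n => 21 * b * (9 / 10) ^+ n); split.
- rewrite -[X in _ --> X](mulr0 (21 * b)); apply: cvgMl_tmp; apply: cvg_expr.
  rewrite ger0_norm ?divr_ge0//; lra.
- by move=> n; rewrite !mulr_ge0.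
move=> n u v w uN vN uv; have Z0 := le_trans ler01 (bm_norm_ge1 w).
have [gw|ngw] := pselect (bm_good w); last first.
  rewrite /bm_version indicE memNset// !mul0r subrr normr0.
  by rewrite !mulr_ge0.
rewrite !bm_versionE// mulrAC -(mulrA 21).
apply: (@chaining _ (W ^~ w) N) => //.
- exact: bm_continuous hW w.
- by rewrite mulr_ge0.
- by move=> m k kN; exact: increment_bound.
Qed.

Let version_lin t : 0 <= t -> lin_dominated bm_norm (bm_version t).
Proof.
move=> t0; split; first exact: measurable_bm_version.
have [rho [_ rho0 Hr]] := version_modulus (Num.truncn t).+1.
exists ((Num.truncn t).+1%:R * rho 0%N) => w; rewrite -mulrA.
have Z0 := le_trans ler01 (bm_norm_ge1 w).
apply: (@modulus_bound _ (bm_version ^~ w)).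
- by rewrite /bm_version (bm_start hW) mulr0.
- by rewrite mulr_ge0.
- by move=> u v uN vN uv; apply: Hr => //; rewrite expr0 invr1.
- by rewrite t0 ltW// truncnS_gt.
Qed.

Lemma mean_ae (f h : T -> R) : measurable_fun setT f -> measurable_fun setT h ->
  (forall w, bm_good w -> f w = h w) -> mean f = mean h.
Proof.
move=> mf mh fh; rewrite /mean /Rintegral; congr fine.
apply: ae_eq_integral => //; [exact/measurable_EFinP..|].
by apply: filterS bm_good_ae => w gw _; rewrite fh.
Qed.

Let symm t (phi : R -> R) : 0 <= t -> measurable_fun setT phi ->
  (forall x, 0 <= phi x) ->
  mean (fun w => phi (W t w)) = mean (fun w => phi (- W t w)).
Proof.
(* The Gaussian law is given over nondegenerate intervals, so time 0 is treated apart. *)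
rewrite le_eqVlt => /predU1P[<-|t0] mphi phi0.
  by apply: eq_mean => w; rewrite (bm_start hW) oppr0.
have s0 : 0 < Num.sqrt (t - 0) :> R by rewrite subr0 sqrtr_gt0.
have mE (f : R -> R) : measurable_fun setT f -> measurable_fun setT (EFin \o f).
  by move=> mf; exact/measurable_EFinP.
have mphiN : measurable_fun setT (fun x : R => phi (- x)).
  by apply: measurableT_comp.
have int (f : R -> R) : measurable_fun setT f -> (forall x, 0 <= f x) ->
    (\int[P]_w (f (W t w))%:E =
     \int[normal_prob 0 (Num.sqrt (t - 0))]_x (f x)%:E)%E.
  move=> mf f0.
  rewrite -(@integral_increment 0 t (EFin \o f))//; last exact: mE.
  by apply: eq_integral => w _ /=; rewrite (bm_start hW) subr0.
rewrite /mean /Rintegral; congr fine.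
rewrite (int phi)// (int (fun x => phi (- x)))//.
transitivity (\int[pushforward (normal_prob 0 (Num.sqrt (t - 0)))
   (-%R : R -> measurableTypeR R)]_x (phi x)%:E)%E.
  apply: eq_measure_integral => A mA _; exact/esym/normal_prob_sym.
rewrite ge0_integral_pushforward//; first exact (mE phi mphi).
by move=> x _; rewrite lee_fin.
Qed.

Let version_symm t (phi : R -> R) : 0 <= t -> measurable_fun setT phi ->
  (forall x, 0 <= phi x) ->
  mean (fun w => phi (bm_version t w)) = mean (fun w => phi (- bm_version t w)).
Proof.
move=> t0 mphi phi0; have mV := @measurable_bm_version t.
rewrite (@mean_ae _ (fun w => phi (W t w))); last 3 first.
- exact: measurableT_comp.
- exact: measurableT_comp.
- by move=> w gw; rewrite bm_versionE.
rewrite symm//; apply/esym/mean_ae.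
- by apply: measurableT_comp => //; exact: measurable_funN.
- by apply: measurableT_comp => //; exact: measurable_funN.
- by move=> w gw; rewrite bm_versionE.
Qed.

Let iZ := bm_norm_integrable.
Let Z1 := bm_norm_ge1.

Lemma bm_version_regular : regular_process P bm_norm bm_version.
Proof.
split.
- by move=> w; rewrite /bm_version (bm_start hW) mulr0.
- exact: measurable_bm_version.
- exact: version_modulus.
(* Symmetry is available for nonnegative functions, so it is applied to the positive and negative
   parts, whose means are equal. *)
- move=> t t0; pose phi (x : R) := Num.max x 0.
  have mphi : measurable_fun setT phi by exact: measurable_maxr.
  have phi0 x : 0 <= phi x by rewrite le_max lexx orbT.
  have lV := version_lin t0.
  have d1 : dominated bm_norm (fun w => phi (bm_version t w)).
    by apply: lin_dom => //; apply: lin_max => //; exact: lin_cst.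
  have d2 : dominated bm_norm (fun w => phi (- bm_version t w)).
    by apply: lin_dom => //; apply: lin_max; [exact: linN|exact: lin_cst].
  transitivity (mean (fun w => phi (bm_version t w) - phi (- bm_version t w))).
    apply: eq_mean => w; rewrite /phi.
    by case: (leP (bm_version t w) 0) => ?;
      case: (leP (- bm_version t w) 0) => ?; lra.
  by rewrite (meanB iZ)// version_symm// subrr.
(* One of [v] and [- v] is nonpositive, and there [phi] is at least [Num.min A c]. By symmetry both
   terms have the same mean, whence the factor [1 / 2]. *)
- move=> t A c t0 A0 c0; pose phi (x : R) := Num.min (Num.max (A - x) 0) c.
  have mphi : measurable_fun setT phi.
    by apply: measurable_minr => //; apply: measurable_maxr => //;
      exact: measurable_funB.
  have phi0 x : 0 <= phi x by rewrite le_min le_max lexx orbT ltW.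
  have lphi V : lin_dominated bm_norm V ->
    dominated bm_norm (fun w => phi (V w)).
    move=> lV; apply: lin_dom => //; apply: lin_min; last exact: lin_cst.
    by apply: lin_max; [apply: linB => //; exact: lin_cst|exact: lin_cst].
  have lV := version_lin t0.
  have d1 := lphi _ lV; have d2 := lphi _ (linN lV).
  have : mean (fun=> Num.min A c) <=
      mean (fun w => phi (bm_version t w) + phi (- bm_version t w)).
    apply: (mean_le iZ); [exact: dom_cst|exact: domD|move=> w].
    have H v : v <= 0 -> Num.min A c <= phi v.
      move=> v0; rewrite /phi le_min !ge_min lexx orbT andbT; apply/orP; left.
      by rewrite le_max lerDl oppr_ge0 v0.
    have [v0|/ltW v0] := leP (bm_version t w) 0.
      by have := H _ v0; have := phi0 (- bm_version t w); lra.
    have := H (- bm_version t w); rewrite oppr_le0 => /(_ v0).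
    by have := phi0 (bm_version t w); lra.
  rewrite mean_cst (meanD iZ)// -version_symm// -/(phi _); lra.
(* When [W s] lies in [[c, c + 1]] the clipped variable equals 1. The probability of this is bounded
   below uniformly over the variances between [s0] and [N]; [N.+1] keeps the square root positive
   for [N = 0]. *)
- move=> s0 C N s00; pose c := `|C| + 1.
  have c0 : 0 <= c by rewrite addr_ge0.
  pose p : R := (c + 1 - c) * ((Num.sqrt (N.+1%:R * pi *+ 2))^-1 *
    expR (- (c + 1) ^+ 2 / (s0 *+ 2))).
  exists p.
    rewrite /p addrAC subrr add0r mul1r mulr_gt0 ?expR_gt0// invr_gt0 sqrtr_gt0.
    by rewrite pmulrn_lgt0// mulr_gt0// pi_gt0.
  move=> s /andP[s0s sN].
  have spos : 0 < s by exact: lt_le_trans s0s.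
  have sq0 : 0 < Num.sqrt (s - 0) by rewrite subr0 sqrtr_gt0.
  pose phi (x : R) := Num.min (Num.max (x - C) 0) 1.
  have mphi : measurable_fun setT phi.
    by apply: measurable_minr => //; apply: measurable_maxr => //;
      exact: measurable_funB.
  have lV := version_lin (ltW spos).
  have dphi : dominated bm_norm (fun w => phi (bm_version s w)).
    apply: lin_dom => //; apply: lin_min; last exact: lin_cst.
    by apply: lin_max; [apply: linB => //; exact: lin_cst|exact: lin_cst].
  pose A : set T := (W s : T -> R) @^-1` `[c, c + 1]%classic.
  have mA : measurable A by rewrite -[A]setTI; apply: (mW s) => //;
    exact: measurable_itv.
  have pA : (p%:E <= P A)%E.
    have -> : P A = normal_prob 0 (Num.sqrt (s - 0)) `[c, c + 1]%classic.
      rewrite -(bm_gaussian hW (lexx 0) spos (measurable_itv _)).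
      congr (P _); apply/seteqP; split => w /=; rewrite (bm_start hW) subr0//.
    apply: normal_prob_itv_ge => //; first by rewrite lerDl.
    rewrite sqr_sqrtr ?subr0 ?(ltW spos)// s0s (le_trans sN)// ler_nat//.
  have dA : dominated bm_norm (\1_A : T -> R).
    split; first exact: measurable_indic.
    exists 1 => w; rewrite mul1r (le_trans _ (expZ_ge1 bm_norm w))//.
    by rewrite indicE; case: (_ \in _); rewrite ?normr1 ?normr0.
  apply: (@le_trans _ _ (mean (\1_A : T -> R))).
    rewrite /mean /Rintegral integral_indic// setIT.
    by rewrite -lee_fin fineK// fin_num_measure.
  rewrite (@mean_ae (fun w => Num.min (Num.max (bm_version s w - C) 0) 1)
    (fun w => phi (W s w))); last 3 first.
  - by apply: (measurableT_comp mphi); exact: measurable_bm_version.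
  - exact: measurableT_comp.
  - by move=> w gw; rewrite bm_versionE.
  rewrite /mean; apply: le_Rintegral => //.
  - exact: (dom_integrable iZ dA).
  - apply: (le_integrable _ _ _ (finite_measure_integrable_cst P 1
    measurableT)) => //.
      by apply/measurable_EFinP; exact: measurableT_comp.
    move=> w _ /=; rewrite lee_fin normr1 ger0_norm /phi.
      by rewrite ge_min lexx orbT.
    by rewrite le_min le_max lexx orbT ler01.
  move=> w _; rewrite indicE; case: (boolP (w \in A)); last first.
    by move=> _; rewrite le_min le_max lexx orbT ler01.
  rewrite inE /A /= in_itv/= => /andP[cW _].
  rewrite le_min lexx andbT le_max; apply/orP; left.
  by move: cW; rewrite /c; have := ler_norm C; lra.
Qed.

End brownian.

(** * Running maximum and reflection *)

Section running_maximum.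
Context {R : realType} (h : R -> R).
Hypothesis ch : continuous (fun s : R => h (Num.max 0 s)).

Lemma rmax_has_sup t : 0 <= t -> has_sup [set h s | s in `[0, t]].
Proof.
move=> t0; split; first by exists (h 0), 0 => //=; rewrite in_itv/= lexx.
have : compact ((fun s => h (Num.max 0 s)) @` `[0, t]).
  apply: continuous_compact; last exact: segment_compact.
  exact: continuous_subspaceT.
move=> /compact_bounded [M [_ HM]]; exists (`|M| + 1) => _ [s /= st <-].
apply: le_trans (ler_norm _) _; apply: (HM (`|M| + 1)).
  by have := ler_norm M; lra.
by exists s => //=; rewrite max_r//; move: st; rewrite in_itv/= => /andP[].
Qed.

Lemma rmax_ge s t : 0 <= s -> s <= t -> h s <= rmax h t.
Proof.
move=> s0 st; have [_ ub] := rmax_has_sup (le_trans s0 st).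
by apply: ub_le_sup => //; exists s => //=; rewrite in_itv/= s0.
Qed.

Lemma rmax_le t b : 0 <= t -> (forall s, 0 <= s -> s <= t -> h s <= b) ->
  rmax h t <= b.
Proof.
move=> t0 Hb; apply: ge_sup.
  by exists (h 0), 0 => //=; rewrite in_itv/= lexx.
by move=> _ [s /= + <-]; rewrite in_itv/= => /andP[? ?]; exact: Hb.
Qed.

Lemma rmax_mono s t : 0 <= s -> s <= t -> rmax h s <= rmax h t.
Proof.
move=> s0 st; apply: rmax_le => // r r0 rs.
by apply: rmax_ge => //; exact: le_trans st.
Qed.

Lemma rmax_zero : rmax h 0 = h 0.
Proof.
apply/eqP; rewrite eq_le rmax_ge// andbT; apply: rmax_le => // s s0 s1.
by rewrite (@le_anti _ _ s 0)// s0 s1.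
Qed.

(** Over a short interval the running maximum grows by at most the oscillation of [h] there. *)
Lemma rmax_continuous : continuous (fun t : R => rmax h (Num.max 0 t)).
Proof.
move=> t; apply/cvgrPdist_le => e e0.
have e2 : 0 < e / 2 by rewrite divr_gt0.
have cht : h (Num.max 0 u) @[u --> t] --> h (Num.max 0 t) by exact: ch.
move/cvgrPdist_le : cht => /(_ _ e2)/nbhs_ballP[r /= r0 Hr].
have close u : `|t - u| < r ->
    `|h (Num.max 0 t) - h (Num.max 0 u)| <= e / 2 by exact: Hr.
have mx (u : R) : 0 <= Num.max 0 u by rewrite le_max lexx.
have up u v : `|t - u| < r -> `|t - v| < r -> u <= v ->
    rmax h (Num.max 0 v) <= rmax h (Num.max 0 u) + e.
  move=> tu tv uv; apply: rmax_le => // s s0 sv.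
  have [su|us] := leP s (Num.max 0 u).
    by rewrite (le_trans (rmax_ge s0 su))// lerDl ltW.
  have su : u < s by apply: le_lt_trans us; rewrite le_max lexx orbT.
  have sv' : s <= v.
    by move: sv; rewrite le_max => /orP[s1|//]; have := mx u; lra.
  have ts : `|t - s| < r.
    by move: tu tv; rewrite !ltr_norml => /andP[? ?] /andP[? ?]; apply/andP;
      split; lra.
  have := close s ts; have := close u tu; rewrite (max_r s0) !ler_norml.
  move=> /andP[? ?] /andP[? ?].
  have := rmax_ge (mx u) (lexx (Num.max 0 u)); lra.
have mono u v : u <= v -> rmax h (Num.max 0 u) <= rmax h (Num.max 0 v).
  by move=> uv; apply: rmax_mono => //; rewrite ge_max le_max lexx/= le_max uv
    orbT.
near=> u.
have tu : `|t - u| < r by near: u; apply: cvgr_dist_lt;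
  [exact: cvg_id|exact: r0].
have tt : `|t - t| < r by rewrite subrr normr0.
have [ut|/ltW ut] := leP u t.
  by have := up u t tu tt ut; have := mono _ _ ut; rewrite ler_norml => *;
    apply/andP; split; lra.
by have := up t u tt tu ut; have := mono _ _ ut; rewrite ler_norml => *;
  apply/andP; split; lra.
Unshelve. all: by end_near. Qed.

(** Enumerates the rationals clamped to [[0, t]], with 0 for numbers that code no rational. Along it
    the running maximum becomes a countable supremum, which gives measurability. *)
Definition rat_time (t : R) (k : nat) : R :=
  if @unpickle rat k is Some q then Num.min t (Num.max 0 (ratr q)) else 0.

Lemma rat_time_itv t k : 0 <= t -> 0 <= rat_time t k <= t.
Proof.
move=> t0; rewrite /rat_time; case: unpickle => [q|]; last by rewrite lexx.
by rewrite le_min t0 ge_min lexx le_max lexx.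
Qed.

Lemma rmax_sups t : 0 <= t -> rmax h t = sups (fun k => h (rat_time t k)) 0.
Proof.
move=> t0; rewrite /sups /=.
set E := sdrop _ _.
have Et : ubound E (rmax h t).
  move=> _ [k _ <-]; have /andP[k0 kt] := rat_time_itv k t0; exact: rmax_ge.
apply/eqP; rewrite eq_le; apply/andP; split; last first.
  by apply: ge_sup => //; exists (h (rat_time t 0)), 0%N.
apply: rmax_le => // s s0 st; apply/ler_addgt0Pr => e e0.
have chs : h (Num.max 0 u) @[u --> s] --> h (Num.max 0 s) by exact: ch.
move/cvgrPdist_le : chs => /(_ _ e0)/nbhs_ballP[r /= r0 Hr].
have [q qs] : exists q : rat, ratr q \in `]s - r, s + r[.
  by apply: rat_in_itvoo; lra.
pose k := pickle q.
have rk : rat_time t k = Num.min t (Num.max 0 (ratr q))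
  by rewrite /rat_time pickleK.
have step_gap : `|s - rat_time t k| < r.
  move: qs; rewrite rk in_itv/= ltr_norml => /andP[? ?].
  by case: (leP 0 (ratr q : R)) => ?; case: (leP t _) => ?; apply/andP; split;
    lra.
have := Hr _ step_gap; rewrite /= max_r// max_r;
  last by have /andP[] := rat_time_itv k t0.
rewrite ler_norml => /andP[_ hk].
have : h (rat_time t k) <= sup E.
  by apply: ub_le_sup; [exists (rmax h t)|exists k].
lra.
Qed.

End running_maximum.

Lemma eq_rmax {R : realType} (h h' : R -> R) t :
  (forall s, 0 <= s -> s <= t -> h s = h' s) -> rmax h t = rmax h' t.
Proof.
move=> hh; congr sup; apply/seteqP; split => _ [s /= + <-]; rewrite in_itv/=.
  by move=> st; exists s; rewrite ?in_itv//= hh//; case/andP: st.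
by move=> st; exists s; rewrite ?in_itv//= hh//; case/andP: st.
Qed.

Lemma measurable_rmax {d} {T : measurableType d} {R : realType}
    (h : R -> T -> R) t : 0 <= t ->
  (forall s, measurable_fun setT (h s)) ->
  (forall w, continuous (fun s : R => h (Num.max 0 s) w)) ->
  measurable_fun setT (fun w => rmax (h ^~ w) t).
Proof.
move=> t0 mh ch.
rewrite (_ : (fun w => _) = fun w => sups (fun k => h (rat_time t k) w) 0);
  last first.
  by apply/funext => w; apply: (@rmax_sups _ (h ^~ w)).
apply: (measurable_fun_sups (h := fun k => h (rat_time t k))) => [w _|//].
exists (rmax (h ^~ w) t) => _ [k _ <-].
by have /andP[k0 kt] := rat_time_itv k t0; exact: (@rmax_ge _ (h ^~ w)).
Qed.

Lemma cadlag_extension {R : realType} (F G : R -> R) : continuous G ->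
  (forall t, 0 <= t -> F t = G t) -> cadlag F.
Proof.
move=> cG FG; split => t t0.
  rewrite FG//; apply: cvg_trans (cvg_at_right_filter (cG t)).
  apply: near_eq_cvg; apply: filterS (nbhs_right_ge t) => s ts.
  by rewrite FG// (le_trans t0).
apply/cvg_ex; exists (G t); apply: cvg_trans (cvg_at_left_filter (cG t)).
apply: near_eq_cvg; apply: filterS (nbhs_left_gt t0) => s ts.
by rewrite FG// ltW.
Qed.

Lemma stieltjes_ocitv {R : realType} (f : cumulative R R) (a b : R) : a <= b ->
  lebesgue_stieltjes_measure f `]a, b]%classic = (f b - f a)%:E.
Proof.
move=> ab; rewrite /lebesgue_stieltjes_measure /measure_extension.
rewrite measurable_mu_extE/=; last exact: is_ocitv.
by rewrite wlength_itv_bnd.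
Qed.

(** * Explicit solution of the Skorokhod problem *)

Section skorokhod.
Context {R : realType} (h : R -> R) (x : R).
Hypothesis ch : continuous (fun s : R => h (Num.max 0 s)).
Hypothesis x0 : 0 <= x.
Hypothesis h0 : h 0 = 0.

(** For [f = x - h] the supremum of [(f_s)_-] over [[0, t]] is the positive part of
    [rmax h t - x]. *)
Let z (t : R) := Num.max (rmax h (Num.max 0 t) - x) 0.
Let y (t : R) := x - h (Num.max 0 t) + z t.

Let mx (t : R) : 0 <= Num.max 0 t. Proof. by rewrite le_max lexx. Qed.

Let cz : continuous z.
Proof.
move=> t; apply: (@continuous_max R R (fun t => rmax h (Num.max 0 t) - x)
  (fun=> 0) t).
  by apply: cvgB; [exact: rmax_continuous|exact: cvg_cst].
exact: cst_continuous.
Qed.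

Let cy : continuous y.
Proof.
move=> t; apply: cvgD; last exact: cz.
by apply: cvgB; [exact: cvg_cst|exact: ch].
Qed.

Let z_mono s t : s <= t -> z s <= z t.
Proof.
move=> st; have : rmax h (Num.max 0 s) <= rmax h (Num.max 0 t).
  by apply: rmax_mono => //; rewrite ge_max le_max lexx/= le_max st orbT.
by rewrite /z ge_max !le_max lexx orbT andbT lerD2r => ->.
Qed.

(** Where [y] is positive, [h - x] lies strictly below [z]. By continuity the midpoint [c] separates
    the two on a neighbourhood, so no new maximum is reached there. *)
Let z_flat s : 0 < y s -> exists a b, [/\ a < s, s < b & z a = z b].
Proof.
move=> ys; pose c := (h (Num.max 0 s) - x + z s) / 2.
have hc : h (Num.max 0 s) - x < c by move: ys; rewrite /c /y; lra.
have zc : c < z s by move: ys; rewrite /c /y; lra.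
have H : \forall u \near s, h (Num.max 0 u) - x < c /\ c < z u.
  have H1 : \forall u \near s, h (Num.max 0 u) - x < c.
    apply: (@cvgr_lt R R (nbhs s) _ (fun u : R => h (Num.max 0 u) - x)
      (h (Num.max 0 s) - x) _ c hc).
    by apply: cvgB; [exact: ch|exact: cvg_cst].
  have H2 : \forall u \near s,
    c < z u by apply: (@cvgr_gt R R (nbhs s) _ z (z s) _ c zc); exact: cz.
  by apply: filterS2 H1 H2 => u h1 h2; split.
have /nbhs_ballP[r /= r0 Hr] := H.
have near u : `|s - u| < r -> h (Num.max 0 u) - x < c /\ c < z u by exact: Hr.
pose a := s - r / 2; pose b := s + r / 2.
have na : `|s - a| < r.
  by rewrite /a ltr_norml; apply/andP; split; lra.
exists a, b; split; [by rewrite /a; lra|by rewrite /b; lra|].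
have ab : a <= b by rewrite /a /b; lra.
apply/eqP; rewrite eq_le z_mono//=.
have za0 : 0 <= z a by rewrite le_max lexx orbT.
rewrite /z ge_max -/(z a) za0 andbT lerBlDr; apply: rmax_le => // u u0 ub.
have [ua|au] := leP u (Num.max 0 a).
  rewrite (le_trans (rmax_ge ch u0 ua))// -lerBlDr /z le_max lexx//.
have au' : a < u by apply: le_lt_trans au; rewrite le_max lexx orbT.
have ub' : u <= b by move: ub; rewrite le_max => /orP[|//]; have := mx a; lra.
have nu : `|s - u| < r.
  by move: au' ub'; rewrite /a /b ltr_norml => *; apply/andP; split; lra.
have [+ _] := near u nu; have [_ +] := near a na.
by rewrite (max_r u0); lra.
Qed.

(** Each point of the set lies in an interval with rational endpoints on which [z] is constant.
    There are countably many such intervals, and each has Stieltjes measure 0. *)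
Let flat_null (dz : cumulative R R) : stieltjes_extension z dz ->
  (lebesgue_stieltjes_measure dz).-negligible [set s | 0 < y s].
Proof.
move=> Hdz; pose mu := lebesgue_stieltjes_measure dz.
have dzE s : dz s = z s by rewrite Hdz /z (max_r (mx s)).
pose B (k : nat) : set R := if @unpickle (rat * rat)%type k is Some (p, q) then
  if (ratr p <= ratr q :> R) && (z (ratr p) == z (ratr q))
  then `]ratr p, ratr q]%classic else set0 else set0.
have HB k : mu.-negligible (B k).
  rewrite /B; case: unpickle => [[p q]|]; last exact: negligible_set0.
  case: ifPn => [/andP[pq /eqP zpq]|_]; last exact: negligible_set0.
  apply/negligibleP; first exact: measurable_itv.
  transitivity (dz (ratr q) - dz (ratr p))%:E; first exact: stieltjes_ocitv.
  by rewrite !dzE zpq subrr.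
apply: (negligibleS _ (negligible_bigcup HB)) => s /= ys.
have [a [b [as_ sb zab]]] := z_flat ys.
have [p /[!in_itv]/= /andP[ap ps]] := rat_in_itvoo as_.
have [q /[!in_itv]/= /andP[sq qb]] := rat_in_itvoo sb.
exists (pickle (p, q)); [exact: I|rewrite /B pickleK].
have pq : ratr p <= ratr q :> R by rewrite ltW// (lt_trans ps).
have -> : z (ratr p) = z (ratr q).
  apply/eqP; rewrite eq_le z_mono//=.
  by rewrite (le_trans (z_mono (ltW qb)))// -zab z_mono// ltW.
by rewrite pq eqxx/= in_itv/= ps ltW.
Qed.

Lemma rmax_skorokhod : skorokhod_solution (fun t => x - h t) y z.
Proof.
have z_cad : cadlag z by exact: (cadlag_extension cz).
split.
- apply: (@cadlag_extension _ _ (fun t => x - h (Num.max 0 t))).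
    by move=> t; apply: cvgB; [exact: cvg_cst|exact: ch].
  by move=> t t0; rewrite max_r.
- by rewrite h0 subr0.
- exact: (cadlag_extension cy).
- exact: z_cad.
- by move=> s t _; exact: z_mono.
- by rewrite /z (max_l (lexx 0)) (rmax_zero ch) h0 sub0r max_r// oppr_le0.
- by move=> t t0; rewrite /y max_r.
- move=> t t0; rewrite /y max_r// addrAC.
  have := rmax_ge ch t0 (lexx t).
  have : rmax h t - x <= z t by rewrite /z (max_r t0) le_max lexx.
  lra.
have [dz Hdz] := stieltjes_extension_exists z_cad (fun s t _ st => z_mono st).
exists dz => // t t0.
have mA : measurable [set s | 0 < y s].
  have -> : [set s | 0 < y s] = y @^-1` `]0%R, +oo[%classic.
    by apply/seteqP; split => s /=; rewrite in_itv/= andbT.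
  rewrite -[_ @^-1` _]setTI.
  by apply: (continuous_measurable_fun cy) => //; exact: measurable_itv.
rewrite (@integral_indic _ (measurableTypeR R) R (lebesgue_stieltjes_measure dz)
  _ (measurable_itv `[0%R, t]) _ mA).
apply: (subset_measure0 _ _ (@subIsetl _ _ _)).
- by apply: measurableI => //; exact: measurable_itv.
- exact: mA.
by apply/negligibleP; [exact: mA|exact: flat_null].
Qed.

End skorokhod.

(** * Proof of the theorem *)

Section call_fubini.
Context {d : measure_display} {T : measurableType d} {R : realType}.
Variables (P : probability T R) (mu : {measure set R -> \bar R}).
Hypothesis mufin : gauss_finite mu.
Variable M : T -> R.
Hypothesis mM : measurable_fun setT M.

Local Notation I := (`[0%R, +oo[%classic : set R).

Let mI : measurable I. Proof. exact: measurable_itv. Qed.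

(** The Gaussian integrability concerns the half-line only, so Fubini is applied to the restriction,
    which is exhausted by sets of finite mass. *)
Let restr_sigma_finite : sigma_finite setT (mrestr mu mI).
Proof.
exists (fun n => `]-oo, n%:R]%classic).
  apply/esym/seteqP; split => // x _; exists (Num.truncn x).+1 => //=.
  by rewrite in_itv/= ltW// truncnS_gt.
move=> n; split; first exact: measurable_itv.
rewrite /mrestr (_ : _ `&` _ = `[0%R, n%:R]%classic).
  by rewrite -ge0_fin_numE ?measure_ge0// mass_fin.
apply/seteqP; split => x /=; rewrite !in_itv/= andbT; first by case=> -> ->.
by case/andP.
Qed.

Let nu : {sigma_finite_measure set R -> \bar R} :=
  HB.pack_for {sigma_finite_measure set R -> \bar R}
    (Measure.sort (mrestr mu mI : {measure set R -> \bar R}))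
    (@isSFinite.Build _ _ _ (mrestr mu mI)
       (sfinite_measure_sigma_finite restr_sigma_finite))
    (@isSigmaFinite.Build _ _ _ (mrestr mu mI) restr_sigma_finite).

Let f (z : T * R) : \bar R := (call (M z.1) z.2 * \1_I z.2)%:E.

Let mf : measurable_fun setT f.
Proof.
apply/measurable_EFinP; apply: measurable_funM.
  apply: measurable_maxr => //; apply: measurable_funB => //.
  exact: measurableT_comp.
apply: measurableT_comp => //.
Qed.

Let f0 z : (0 <= f z)%E.
Proof. by rewrite lee_fin mulr_ge0 ?call_ge0. Qed.

Let nu_integral (h : R -> R) :
  (\int[nu]_x (h x * \1_I x)%:E = \int[mu]_(x in I) (h x)%:E)%E.
Proof.
transitivity (\int[nu]_(x in I) (h x)%:E)%E.
  rewrite [RHS]integral_mkcond; apply: eq_integral => x _;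
    rewrite patchE indicE.
  by case: ifPn => _; rewrite ?mulr1 ?mulr0.
by apply: eq_measure_integral => A mA AI; rewrite /= /mrestr setIidl.
Qed.

Lemma call_fubini : (\int[mu]_(x in I) \int[P]_w (call (M w) x)%:E =
  \int[P]_w \int[mu]_(x in I) (call (M w) x)%:E)%E.
Proof.
have := fubini_tonelli (m1 := P) (m2 := nu) f mf f0; rewrite /f/=.
under eq_integral do rewrite nu_integral.
move=> ->; transitivity (\int[nu]_(x in I) \int[P]_w (call (M w) x)%:E)%E.
  by apply/esym/eq_measure_integral => A mA AI; rewrite /= /mrestr setIidl.
rewrite [LHS]integral_mkcond; apply: eq_integral => x _; rewrite patchE indicE.
case: ifPn => _; first by under [RHS]eq_integral do rewrite mulr1.
by under [RHS]eq_integral do rewrite mulr0; rewrite integral0.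
Qed.

Lemma measurable_call_mean :
  measurable_fun I (fun x => \int[P]_w (call (M w) x)%:E)%E.
Proof.
have mc : measurable_fun setT (fun z : R * T => (call (M z.2) z.1)%:E).
  apply/measurable_EFinP; apply: measurable_maxr => //.
  by apply: measurable_funB => //; exact: measurableT_comp.
have := measurable_fun_fubini_tonelli_F (m2 := P) _ mc.
move=> /(_ (fun z => _)) H.
apply: measurable_funTS; apply: H => z; by rewrite lee_fin call_ge0.
Qed.

Lemma measurable_callint : measurable_fun setT (fun w => callint mu (M w)).
Proof.
have mF : measurable_fun setT (fun w => \int[mu]_(x in I) (call (M w) x)%:E)%E.
  have := measurable_fun_fubini_tonelli_F (m2 := nu) f mf f0.
  apply: eq_measurable_fun => w _; rewrite /fubini_F /f/=.
  exact: nu_integral.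
rewrite /callint /Rintegral; exact: (measurableT_comp _ mF).
Qed.

Lemma callint_fin w :
  (\int[mu]_(x in I) (call (M w) x)%:E)%E = (callint mu (M w))%:E.
Proof.
by rewrite fineK//; apply: integrable_fin_num => //; exact: call_integrable.
Qed.

Variable Z : T -> R.
Hypothesis Z1 : forall w, 1 <= Z w.
Hypothesis iZ : P.-integrable setT (fun w => (expR (Z w ^+ 2))%:E).
Hypothesis lM : lin_dominated Z M.
Hypothesis M0 : forall w, 0 <= M w.

(** Admissibility controls the difference of two call integrals, whereas [sintegrable] concerns each
    of them; hence a bound for a single measure, with the constant [c] chosen as for the growth
    condition. *)
Lemma callint_dom : dominated Z (fun w => callint mu (M w)).
Proof.
split; first exact: measurable_callint.
have [_ [C HC]] := lM.
pose c : R := (2 * (C ^+ 2 + 1))^-1.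
have C1 : 0 < C ^+ 2 + 1 by rewrite ltr_wpDl// sqr_ge0.
have c0 : 0 < c by rewrite invr_gt0 mulr_gt0.
exists (`|C| * gauss_mass mu c) => w.
have Zw := le_trans ler01 (Z1 w).
have MC : M w <= C * Z w by exact: le_trans (ler_norm _) (HC w).
have ge0 : 0 <= callint mu (M w).
  by apply: Rintegral_ge0 => x _; exact: call_ge0.
have up : callint mu (M w) <= M w * mass_upto mu (M w).
  have := callint_upper mufin (M0 w).
  by rewrite subr0 (callint_le0 _ (lexx 0)) subr0.
have cM : expR (c * M w ^+ 2) <= expR (Z w ^+ 2 / 2).
  rewrite ler_expR; apply: (@le_trans _ _ (c * (C * Z w) ^+ 2)).
    by rewrite ler_wpM2l ?(ltW c0)// ler_pXn2r ?nnegrE// (le_trans (M0 w)).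
  rewrite exprMn -subr_ge0 (_ : _ - _ = Z w ^+ 2 / 2 * (C ^+ 2 + 1)^-1).
    by rewrite mulr_ge0 ?divr_ge0 ?sqr_ge0// invr_ge0 ltW.
  by rewrite /c; field; rewrite gt_eqF.
rewrite ger0_norm// (le_trans up)// -(exp_halfM Z w).
rewrite [leRHS](_ : _ = (`|C| * expR (Z w ^+ 2 / 2)) *
  (expR (Z w ^+ 2 / 2) * gauss_mass mu c)); last by ring.
apply: ler_pM => //; first exact: mass_upto_ge0.
- rewrite (le_trans MC)//; apply: (@le_trans _ _ (`|C| * Z w)).
    by rewrite ler_wpM2r// ler_norm.
  by rewrite ler_wpM2l// Z_le_exp_half.
- rewrite (le_trans (mass_upto_le mufin c0 (M0 w)))// ler_wpM2r//.
  exact: gauss_mass_ge0.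
Qed.

Lemma call_mean_integral :
  mu.-integrable I (fun x => \int[P]_w (call (M w) x)%:E)%E /\
  (\int[mu]_(x in I) \int[P]_w (call (M w) x)%:E =
   (mean P (fun w => callint mu (M w)))%:E)%E.
Proof.
have E : (\int[mu]_(x in I) \int[P]_w (call (M w) x)%:E =
   (mean P (fun w => callint mu (M w)))%:E)%E.
  rewrite call_fubini; under eq_integral do rewrite callint_fin.
  rewrite /mean /Rintegral fineK//; apply: integrable_fin_num => //.
  exact: (dom_integrable iZ callint_dom).
split => //; apply/integrableP; split; first exact: measurable_call_mean.
under eq_integral => x _.
  rewrite gee0_abs; last by apply: integral_ge0 => w _;
    rewrite lee_fin call_ge0.
  over.
by rewrite E ltry.
Qed.

End call_fubini.

Theorem theorem1p13 (R : realType) (d : measure_display) (T : measurableType d)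
    (P : probability T R) (W : R -> {RV P >-> R}) (alpha : R)
    (m : signed_measure R R) :
  0 < alpha ->
  standard_brownian_motion W ->
  variation m `]-oo, 0%R[ = 0%E ->
  (forall K : set R, compact K -> (variation m K < +oo)%E) ->
  (m [set 0%R] < (alpha^-1)%:E)%E ->
  (forall x : R, 0 <= x -> (m `[0%R, x]%classic <= (alpha^-1)%:E)%E) ->
  (forall c : R, 0 < c ->
    (\int[variation m]_(x in `[0%R, +oo[) (expR (- c * x ^+ 2))%:E < +oo)%E) ->
  exists l : R -> R,
    {within `[0, +oo[, continuous l} /\
    exists X L : R -> R -> {RV P >-> R},
      (forall x : R, 0 <= x -> forall w : T,
        skorokhod_solution (fun t => x + W t w - alpha * l t)
          (fun t => X x t w) (fun t => L x t w)) /\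
      (forall t : R, 0 <= t ->
        sintegrable m `[0%R, +oo[ (fun x => 'E_P[L x t])%E /\
        (l t)%:E = sintegral m `[0%R, +oo[ (fun x => 'E_P[L x t])%E).
Proof.
move=> alpha0 hW _ _ m0 mx mexp.
have [fp fn] := spos_sneg_gauss_finite mexp.
have adm := signed_measure_admissible mexp alpha0 m0 mx.
pose Z := bm_norm W; pose V := bm_version W.
have mZ : measurable_fun setT Z := measurable_bm_norm W.
have Z1 w : 1 <= Z w := bm_norm_ge1 W w.
have iZ : P.-integrable setT (fun w => (expR (Z w ^+ 2))%:E).
  exact: bm_norm_integrable hW.
have reg : regular_process P Z V := bm_version_regular hW.
have [a [ca Ha]] := fixed_point mZ Z1 iZ adm reg.
have mW t : measurable_fun setT (W t : T -> R) by exact: measurable_funPT.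
have max0 (s : R) : 0 <= Num.max 0 s by rewrite le_max lexx.
have cmax : continuous (fun s : R => Num.max 0 s).
  move=> s; apply: (@continuous_max R R (fun=> 0) id s); last exact: cvg_id.
  exact: cst_continuous.
have ca' : continuous (fun s : R => a (Num.max 0 s)).
  by move=> s; apply: cvg_comp; [exact: cmax|exact: ca].
(* Two versions run in parallel: [h] is built from [W] and serves the Skorokhod problem at every
   outcome, [h'] from the modified paths, for which the pointwise bounds hold. They agree on
   [bm_good]. *)
pose h s w := a s - W s w; pose h' s w := a s - V s w.
have ch w : continuous (fun s : R => h (Num.max 0 s) w).
  move=> s; apply: cvgB; first exact: ca'.
  exact: within_extend (@bm_continuous _ _ _ _ _ hW w) s.
have ch' w : continuous (fun s : R => h' (Num.max 0 s) w).
  have [gw|ngw] := pselect (bm_good W w).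
    rewrite (_ : (fun s => _) = (fun s : R => h (Num.max 0 s) w));
      first exact: ch.
    by apply/funext => s; rewrite /h' /V bm_versionE.
  rewrite (_ : (fun s => _) = (fun s : R => a (Num.max 0 s))); first exact: ca'.
  by apply/funext => s; rewrite /h' /V /bm_version indicE memNset// mul0r subr0.
(* The Skorokhod data must start at [x]. At time 0 the equation reads [a 0 = g (a 0)]; a positive
   solution contradicts the gap condition, and at a nonpositive one [g] vanishes. *)
have a00 : a 0 = 0.
  have E : a 0 = alpha * signed_callint (spos m) (sneg m) (a 0).
    rewrite {1}Ha// (@eq_mean _ _ _ _ _
      (fun=> alpha * signed_callint (spos m) (sneg m) (a 0))) ?mean_cst// => w.
    by rewrite (@rmax_zero _ (h' ^~ w))// /h' (rp_start reg) subr0.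
  have [a0|a0] := leP (a 0) 0; first by rewrite E (adm_le0 adm).
  have [eta [y0 [eta0 y00]]] := adm_gap adm.
  move=> /(_ _ (ltW a0)); rewrite -E subrr leNgt.
  by rewrite mulr_gt0// lt_min a0.
pose M t w := rmax (h ^~ w) (Num.max 0 t).
pose M' t w := rmax (h' ^~ w) (Num.max 0 t).
have mM t : measurable_fun setT (M t).
  apply: measurable_rmax => // s; exact: measurable_funB.
have mM' t : measurable_fun setT (M' t).
  apply: measurable_rmax => // s; apply: measurable_funB => //.
  exact: rp_measurable reg s.
have MM' t w : bm_good W w -> M t w = M' t w.
  by move=> gw; apply: eq_rmax => s _ _; rewrite /h /h' /V bm_versionE.
have M'0 t w : 0 <= M' t w.
  apply: le_trans (@rmax_ge _ (h' ^~ w) (ch' w) 0 _ (lexx 0) (max0 t)).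
  by rewrite /h' a00 (rp_start reg) subr0.
have lM' t : lin_dominated Z (M' t).
  split => //; pose N := (Num.truncn (Num.max 0 t)).+1.
  have tN : Num.max 0 t <= N%:R by rewrite ltW// truncnS_gt.
  have [B B0 HB] := process_bound Z1 reg N.
  exists (rmax a (Num.max 0 t) + B) => w; rewrite ger0_norm//.
  have amx s : 0 <= s -> s <= Num.max 0 t -> a s <= rmax a (Num.max 0 t).
    by move=> s0 st; exact: rmax_ge.
  have rm0 : 0 <= rmax a (Num.max 0 t) by rewrite -{1}a00; exact: amx.
  apply: rmax_le => // s s0 st; rewrite mulrDl; apply: lerD.
    by rewrite (le_trans (amx s s0 st))// ler_peMr.
  rewrite (le_trans (ler_norm _))// normrN; apply: HB.
  by rewrite s0 (le_trans st).
have mL x t : measurable_fun setT (fun w => call (M t w) x).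
  by apply: measurable_maxr => //; exact: measurable_funB.
have mX x t : measurable_fun setT (fun w => x - h (Num.max 0 t) w +
  call (M t w) x).
  apply: measurable_funD => //; apply: measurable_funB => //.
  exact: measurable_funB.
pose L x t : {RV P >-> R} := HB.pack (fun w => call (M t w) x)
  (isMeasurableFun.Build _ _ _ _ _ (mL x t)).
pose X x t : {RV P >-> R} :=
  HB.pack (fun w => x - h (Num.max 0 t) w + call (M t w) x)
  (isMeasurableFun.Build _ _ _ _ _ (mX x t)).
exists (fun t => a t / alpha); split.
  by apply: continuous_subspaceT => s; apply: cvgMr_tmp; exact: ca.
exists X, L; split.
  move=> x x0 w.
  rewrite (_ : (fun t => x + _ - _) = (fun t => x - h t w)); last first.
    apply/funext => t; rewrite /h mulrC divfK ?gt_eqF//; ring.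
  apply: (@rmax_skorokhod _ (h ^~ w)) => //.
  by rewrite /h a00 (bm_start hW) subrr.
move=> t t0.
(* Under the expectation the paths of [W] may be exchanged for the modified ones, which differ from
   them on a null event only. *)
have EL : (fun x => 'E_P[L x t])%E =
  (fun x => \int[P]_w (call (M' t w) x)%:E)%E.
  apply/funext => x; rewrite unlock; apply: ae_eq_integral => //.
  - exact/measurable_EFinP/mL.
  - by apply/measurable_EFinP; apply: measurable_maxr => //;
    exact: measurable_funB.
  - by apply: filterS (bm_good_ae hW) => w gw _ /=; rewrite MM'.
rewrite EL.
have [ip Ep] := call_mean_integral fp (mM' t) Z1 iZ (lM' t) (M'0 t).
have [im En] := call_mean_integral fn (mM' t) Z1 iZ (lM' t) (M'0 t).
split => //; rewrite /sintegral Ep En -EFinB; congr EFin.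
have dp := callint_dom fp (mM' t) Z1 (lM' t) (M'0 t).
have dn := callint_dom fn (mM' t) Z1 (lM' t) (M'0 t).
have ds : dominated Z (fun w => signed_callint (spos m) (sneg m) (M' t w)) :=
  domB dp dn.
rewrite (_ : a t = mean P (fun w => alpha * signed_callint (spos m) (sneg m)
  (M' t w))).
  by rewrite (meanZ iZ alpha ds) mulrC mulKf ?gt_eqF// (meanB iZ dp dn).
rewrite (Ha t t0); apply: eq_mean => w; congr (alpha * signed_callint _ _ _).
by rewrite /M' (max_r t0).
Qed.
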